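(* Let $(\alpha_{n,k})_{n\geq k\geq 0}$ be non-zero complex numbers and let $\mathbb{D}$ be the open unit disc of $\mathbb{C}$. Denote by $\mathcal{U}_{\alpha}(\mathbb{D})$ the set of holomorphic functions $f\in\mathcal{H}(\mathbb{D})$ such that, for every compact subset $K\subset\mathbb{C}$ with $K\cap\mathbb{D}=\emptyset$ and $K^c$ connected, and every function $h$ continuous on $K$ and holomorphic in the interior of $K$, there exists an increasing sequence $(\lambda_n)_n\subset\mathbb{N}$ such that $$\sum_{k=0}^{\lambda_n}\alpha_{\lambda_n,k}\frac{f^{(k)}(0)}{k!}z^k\rightarrow h(z)\quad\text{uniformly on }K\text{ as }n\rightarrow+\infty.$$ The following assertions hold: (1) If the sequence $(\alpha_{n,k})_n$ is convergent in $\mathbb{C}$ for every $k\geq 0$ and if $$\limsup_{n\to+\infty}\left(\min_{0\leq k\leq n}\sqrt[n]{|\alpha_{n,k}|}\right)\geq 1,$$ then $\mathcal{U}_{\alpha}(\mathbb{D})\neq\emptyset$. (2) If $\mathcal{U}_{\alpha}(\mathbb{D})\neq\emptyset$, then $$\limsup_{n\to+\infty}\left(\max_{0\leq k\leq n}\sqrt[n]{|\alpha_{n,k}|}\right)\geq 1.$$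
   Context: $\mathcal{H}(\mathbb{D})$ is the space of holomorphic functions on $\mathbb{D}$; $K^c=\mathbb{C}\setminus K$. *)

(* Defs.v *)
From HB Require Import structures.
From mathcomp Require Import all_boot all_order all_algebra.
From mathcomp Require Import complex.
From mathcomp Require Import all_classical all_reals all_analysis.

Set Implicit Arguments.
Unset Strict Implicit.
Unset Printing Implicit Defensive.

Import Order.TTheory GRing.Theory Num.Theory.
Import numFieldNormedType.Exports.

Local Open Scope classical_set_scope.
Local Open Scope ring_scope.

(* Naming the complex numbers as a numClosedFieldType gives access to the
   topology and normed module structure that every numFieldType carries over
   itself; the bare type R[i] has no such instances. *)
Definition Cplx (R : realType) : numClosedFieldType := R[i].

(* The norm of Cplx R takes its values in Cplx R; this is the same modulus seen
   as an element of R. *)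
Definition modulus (R : realType) (z : Cplx R) : R := complex.Re (`|z| : Cplx R).

Definition unit_disc (R : realType) : set (Cplx R) := [set z | `|z| < 1].

(* Meant for open A. Since the scalar field is Cplx R, [derivable] is complex
   differentiability. Functions are total, and their values outside A are
   irrelevant. *)
Definition holomorphic_on (R : realType) (A : set (Cplx R))
    (f : Cplx R -> Cplx R) : Prop :=
  forall z, A z -> derivable f z 1.

Definition weighted_taylor (R : realType) (alpha : nat -> nat -> Cplx R)
    (f : Cplx R -> Cplx R) (n : nat) (z : Cplx R) : Cplx R :=
  \sum_(k < n.+1) alpha n k * (derive1n k f 0 / k`!%:R) * z ^+ k.

(* A holomorphic function on the disc is represented by any total extension:
   the derivatives at 0 only depend on the values inside the disc. *)
Definition universal (R : realType) (alpha : nat -> nat -> Cplx R) :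
    set (Cplx R -> Cplx R) :=
  [set f | holomorphic_on (@unit_disc R) f /\
    forall (K : set (Cplx R)) (h : Cplx R -> Cplx R),
      compact K -> K `&` @unit_disc R = set0 -> connected (~` K) ->
      {within K, continuous h} -> holomorphic_on (interior K) h ->
      exists2 lambda : nat -> nat, increasing_seq lambda &
        {uniform K,
          (fun n => weighted_taylor alpha f (lambda n)) @ \oo --> h}].

(* The value at n = 0 is a convention (0^-1 = 0) and does not affect the
   limits superior. *)
Definition nroot_modulus (R : realType) (n : nat) (z : Cplx R) : \bar R :=
  (powR (modulus z) n%:R^-1)%:E.

Definition min_root (R : realType) (alpha : nat -> nat -> Cplx R) (n : nat) :
    \bar R :=
  \big[mine/+oo%E]_(k < n.+1) nroot_modulus n (alpha n k).

Definition max_root (R : realType) (alpha : nat -> nat -> Cplx R) (n : nat) :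
    \bar R :=
  \big[maxe/-oo%E]_(k < n.+1) nroot_modulus n (alpha n k).

(* Main.v *)
Require Import Defs.
From mathcomp Require Import all_boot all_order all_algebra.
From mathcomp Require Import complex.
From mathcomp Require Import all_classical all_reals all_analysis.
From mathcomp Require Import ring lra zify.

(** Assertion (2) is a comparison of growth rates on [K = {1}]: if the maxima of
    the n-th roots stay below some [c < 1], then Cauchy's estimates bound the
    weighted Taylor sums at 1 by a geometric sequence, which tends to 0.

    Assertion (1) builds [f] as a sum of polynomial blocks. Given a compact [S]
    off the disc with connected complement, Mergelyan's theorem on the union of
    [S] with a disc [|z| <= r] yields a polynomial [u] close to 1 on [S] and
    close to 0 on that disc. The upper half of the binomial expansion of
    [(u + (1 - u)) ^ (2 M)] has degree at most [2 M deg u] and approaches these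
    values at the rate [2 ^ - M]. Multiplying it by the target polynomial and
    dividing its coefficients by [alpha_{lam,k}] changes its size by a factor
    [c ^ - lam] at most, with [c] as close to 1 as needed, so the block remains
    small on [|z| <= r]. The convergence of the columns of [alpha] controls the
    contribution of the earlier blocks. Countably many targets suffice: rational
    polynomials, and annuli from which finitely many rational balls are removed.

    Mergelyan's theorem is proved without integrals. On a square lattice of
    mesh [h], cell sums of the function against the Cauchy kernel at the cell
    centres become, after summation by parts, a convolution with a kernel that
    decays like [|w| ^ - 4], hence an approximate identity. Cells deep inside
    [K] are negligible by a discrete Goursat theorem, and near the boundary the
    pole is replaced by [G + t G ^ 2], where [G] is an inverse Joukowski map
    which is a uniform limit of polynomials on [K] and which matches the pole to
    second order at infinity. *)

Set Implicit Arguments.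
Unset Strict Implicit.
Unset Printing Implicit Defensive.

Import Order.TTheory GRing.Theory Num.Theory.
Import numFieldNormedType.Exports.

Local Open Scope classical_set_scope.
Local Open Scope ring_scope.

Local Arguments maxn : simpl never.

(** * The modulus on [Cplx R] *)

Section Modulus.
Context {R : realType}.
Local Notation C := (Cplx R).
Implicit Types (x y z w : C) (a b : R).

(** Mergelyan's theorem gives no control of the degree, whereas dividing by [alpha_{lam,k}] costs up
    to [c ^ - lam], and the indices [lam] with this lower bound cannot be prescribed. Hence [u] is
    only asked for a fixed tolerance, 1/16. Once its degree is known, [c] is chosen so close to 1
    that the loss per unit of [M] is less than the gain, and all further precision comes from [M],
    which is fitted to [lam].

    In the proof of Mergelyan's theorem the replaced poles lie in about [8 d] cells at lattice
    distance [d]. Matching a pole to first order only would give errors adding up to the logarithm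
    of the side of the square over [delta], which the modulus of continuity cannot absorb. One more
    order makes the sum bounded independently of all scales. The approximate identity is normalised
    by its own total mass, a discrete winding number; a lower bound 4 for its modulus suffices, so
    its limit, of modulus [2 pi], never enters. *)

Definition ofR a : C := real_complex R a.
Definition cRe z : R := complex.Re z.
Definition cIm z : R := complex.Im z.
Definition iC : C := Complex 0 1.

Lemma ofR_inj : injective ofR.
Proof. exact: complexI. Qed.

Lemma modulusE z : modulus z = Num.sqrt (cRe z ^+ 2 + cIm z ^+ 2).
Proof. by rewrite /modulus normc_def. Qed.

Lemma norm_modulus z : `|z| = ofR (modulus z).
Proof. by rewrite modulusE normc_def. Qed.

Lemma modulus_ge0 z : 0 <= modulus z.
Proof. by rewrite modulusE sqrtr_ge0. Qed.
Local Hint Resolve modulus_ge0 : core.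

Lemma lt_modulus z a : (`|z| < ofR a) = (modulus z < a).
Proof. by rewrite norm_modulus /ofR ltcR. Qed.

Lemma le_modulus z a : (`|z| <= ofR a) = (modulus z <= a).
Proof. by rewrite norm_modulus /ofR lecR. Qed.

Lemma modulusM z w : modulus (z * w) = modulus z * modulus w.
Proof.
apply: ofR_inj; rewrite -[LHS]norm_modulus normrM !norm_modulus.
exact: (esym (rmorphM (real_complex R) _ _)).
Qed.

Lemma modulusD z w : modulus (z + w) <= modulus z + modulus w.
Proof.
rewrite -le_modulus (_ : ofR _ = ofR (modulus z) + ofR (modulus w)).
  by rewrite -!norm_modulus ler_normD.
exact: (rmorphD (real_complex R)).
Qed.

Lemma modulusN z : modulus (- z) = modulus z.
Proof. by apply: ofR_inj; rewrite -2!norm_modulus normrN. Qed.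

Lemma modulusB z w : modulus (z - w) <= modulus z + modulus w.
Proof. by rewrite -(modulusN w) modulusD. Qed.

Lemma modulusBC z w : modulus (z - w) = modulus (w - z).
Proof. by rewrite -modulusN opprB. Qed.

Lemma modulus0 : modulus (0 : C) = 0.
Proof. by apply: ofR_inj; rewrite -[LHS]norm_modulus normr0. Qed.

Lemma modulus1 : modulus (1 : C) = 1.
Proof. by apply: ofR_inj; rewrite -[LHS]norm_modulus normr1. Qed.

Lemma modulus_iC : modulus iC = 1.
Proof. by rewrite modulusE /= expr0n add0r expr1n sqrtr1. Qed.

Lemma modulus_ofR a : modulus (ofR a) = `|a|.
Proof. by rewrite modulusE /= expr0n addr0 sqrtr_sqr. Qed.

Lemma modulus_nat n : modulus (n%:R : C) = n%:R.
Proof.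
apply: ofR_inj; rewrite -[LHS]norm_modulus normr_nat.
exact: (esym (rmorph_nat (real_complex R) _)).
Qed.

Lemma modulusX z n : modulus (z ^+ n) = modulus z ^+ n.
Proof.
by elim: n => [|n IH]; rewrite ?expr0 ?modulus1 // !exprS modulusM IH.
Qed.

Lemma modulusV z : modulus z^-1 = (modulus z)^-1.
Proof.
apply: ofR_inj; rewrite -[LHS]norm_modulus normfV norm_modulus.
exact: (esym (fmorphV (real_complex R) _)).
Qed.

Lemma modulus_eq0 z : (modulus z == 0) = (z == 0).
Proof.
rewrite -(normr_eq0 z) norm_modulus -(inj_eq ofR_inj).
by rewrite (_ : ofR 0 = 0).
Qed.

Lemma modulus_gt0 z : (0 < modulus z) = (z != 0).
Proof. by rewrite lt_def modulus_eq0 modulus_ge0 andbT. Qed.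

Lemma modulus_le_add z w : modulus z <= modulus (z - w) + modulus w.
Proof. by rewrite -{1}(subrK w z) modulusD. Qed.

Lemma modulus_dist z w u : modulus (z - w) <= modulus (z - u) + modulus (u - w).
Proof. by rewrite -(subrKA u) modulusD. Qed.

Lemma modulus_le_sub z w : modulus z - modulus w <= modulus (z + w).
Proof. by rewrite lerBlDr -{1}(addrK w z) modulusB. Qed.

Lemma le_Re_modulus z : `|cRe z| <= modulus z.
Proof.
rewrite modulusE -sqrtr_sqr ler_sqrt ?addr_ge0 ?sqr_ge0 //.
by rewrite lerDl sqr_ge0.
Qed.

Lemma le_Im_modulus z : `|cIm z| <= modulus z.
Proof.
rewrite modulusE -sqrtr_sqr ler_sqrt ?addr_ge0 ?sqr_ge0 //.
by rewrite lerDr sqr_ge0.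
Qed.

Lemma complexD_E z : z = ofR (cRe z) + iC * ofR (cIm z).
Proof.
case: z => a b; rewrite /ofR /iC /cRe /cIm /=.
by apply/eqP; rewrite eq_complex /= !(mul0r, mulr0, mul1r, subr0, addr0, add0r) !eqxx.
Qed.

Lemma modulus_le_ReIm z : modulus z <= `|cRe z| + `|cIm z|.
Proof.
rewrite {1}(complexD_E z); apply: le_trans (modulusD _ _) _.
by rewrite modulusM modulus_iC mul1r !modulus_ofR.
Qed.

Lemma cReD z w : cRe (z + w) = cRe z + cRe w.
Proof. by case: z w => [a b] [c d]. Qed.
Lemma cImD z w : cIm (z + w) = cIm z + cIm w.
Proof. by case: z w => [a b] [c d]. Qed.
Lemma cReN z : cRe (- z) = - cRe z. Proof. by case: z. Qed.
Lemma cImN z : cIm (- z) = - cIm z. Proof. by case: z. Qed.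
Lemma cReM z w : cRe (z * w) = cRe z * cRe w - cIm z * cIm w.
Proof. by case: z w => [a b] [c d]. Qed.
Lemma cImM z w : cIm (z * w) = cRe z * cIm w + cIm z * cRe w.
Proof. by case: z w => [a b] [c d]. Qed.
Lemma cRe_ofR a : cRe (ofR a) = a. Proof. by []. Qed.
Lemma cIm_ofR a : cIm (ofR a) = 0. Proof. by []. Qed.
Lemma cRe_iC : cRe iC = 0. Proof. by []. Qed.
Lemma cIm_iC : cIm iC = 1. Proof. by []. Qed.

Lemma complex_ext z w : cRe z = cRe w -> cIm z = cIm w -> z = w.
Proof. by case: z w => [a b] [c d] /= -> ->. Qed.

Lemma ofRD a b : ofR (a + b) = ofR a + ofR b. Proof. exact: (rmorphD (real_complex R)). Qed.
Lemma ofRN a : ofR (- a) = - ofR a. Proof. exact: (rmorphN (real_complex R)). Qed.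
Lemma ofRM a b : ofR (a * b) = ofR a * ofR b. Proof. exact: (rmorphM (real_complex R)). Qed.
Lemma ofRV a : ofR a^-1 = (ofR a)^-1. Proof. exact: (fmorphV (real_complex R)). Qed.
Lemma ofR0 : ofR 0 = 0. Proof. exact: (rmorph0 (real_complex R)). Qed.
Lemma ofR1 : ofR 1 = 1. Proof. exact: (rmorph1 (real_complex R)). Qed.
Lemma ofR_nat n : ofR n%:R = n%:R. Proof. exact: (rmorph_nat (real_complex R)). Qed.
Lemma sqr_iC : iC ^+ 2 = -1.
Proof. exact: sqr_i. Qed.

Lemma modulus_sum (I : Type) (r : seq I) (P : pred I) (F : I -> C) :
  modulus (\sum_(i <- r | P i) F i) <= \sum_(i <- r | P i) modulus (F i).
Proof.
elim/big_rec2: _ => [|i y1 y2 _ IH]; first by rewrite modulus0.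
by apply: le_trans (modulusD _ _) _; rewrite lerD2l.
Qed.

Lemma open_modulusP (A : set C) :
  open A <-> forall z, A z -> exists2 e : R, 0 < e &
    forall w, modulus (w - z) < e -> A w.
Proof.
split=> [oA z Az|H].
  have /nbhs_ballP[e /= e0 He] : nbhs z A by exact: open_nbhs_nbhs.
  have e_real : (0 : C) <= e by exact: ltW.
  have eE : e = ofR (complex.Re e) by rewrite /ofR RRe_real ?ger0_real.
  exists (complex.Re e); first by move: e0; rewrite eE /ofR ltcR.
  move=> w Hw; apply: He; rewrite -ball_normE /=.
  by rewrite eE lt_modulus modulusBC.
rewrite openE => z /H[e e0 He]; apply/nbhs_ballP; exists (ofR e) => /=.
  by rewrite /ofR ltcR.
by move=> w; rewrite -ball_normE /= lt_modulus modulusBC => /He.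
Qed.

Lemma nbhs_modulusP z (A : set C) :
  nbhs z A <-> exists2 e : R, 0 < e & forall w, modulus (w - z) < e -> A w.
Proof.
split.
  move=> /nbhs_interior => H.
  have /open_modulusP := @open_interior _ A => /(_ z (nbhs_singleton H)) [e e0 He].
  by exists e => // w /He; exact: interior_subset.
move=> [e e0 He]; apply/nbhs_ballP; exists (ofR e) => /=.
  by rewrite /ofR ltcR.
by move=> w; rewrite -ball_normE /= lt_modulus modulusBC => /He.
Qed.

Lemma cvg_modulusP (T : Type) (F : set_system T) (FF : Filter F) (f : T -> C) l :
  f x @[x --> F] --> l <->
  forall e : R, 0 < e -> \forall x \near F, modulus (f x - l) < e.
Proof.
split=> [/cvgrPdist_lt H e e0|H].
  have e0' : (0 : C) < ofR e by rewrite /ofR ltcR.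
  by apply: filterS (H _ e0') => x; rewrite lt_modulus modulusBC.
apply/cvgrPdist_lt => e e0.
have eE : e = ofR (complex.Re e) by rewrite /ofR RRe_real ?ger0_real ?ltW.
have : 0 < complex.Re e by move: e0; rewrite eE /ofR ltcR.
by move=> /H; apply: filterS => x; rewrite eE lt_modulus modulusBC.
Qed.

Lemma cplx_hausdorff : hausdorff_space C.
Proof. exact: norm_hausdorff. Qed.

End Modulus.
#[export] Hint Extern 0 (is_true (0 <= modulus _)) => exact: modulus_ge0 : core.
Arguments iC {R}.

(** * Completeness, compactness, derivatives *)

Section Analysis.
Context {R : realType}.
Local Notation C := (Cplx R).
Implicit Types (z w l : C) (K : set C) (f h : C -> C).

(** Completeness of [R] is applied to real and imaginary parts; the explicit rate [e] survives in
    the limit, which later error bounds rely on. *)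
Lemma cplx_cauchy_cvg (u : nat -> C) (e : nat -> R) :
  e @ \oo --> 0 -> (forall n m, (n <= m)%N -> modulus (u m - u n) <= e n) ->
  exists l, forall n, modulus (u n - l) <= e n.
Proof.
move=> e0 ue.
have cvg_part (g : C -> R) : (forall z w, g (z - w) = g z - g w) ->
    (forall z, `|g z| <= modulus z) -> cvgn (g \o u).
  move=> gB gle; apply/cauchy_cvgP/cauchy_exP => eps eps0.
  have [N _ HN] : \forall n \near \oo, e n < eps.
    by apply: (cvgr_lt 0).
  exists (g (u N)); exists N => // n /= Nn; rewrite -ball_normE /= -gB.
  apply: le_lt_trans (gle _) _; rewrite modulusBC.
  by apply: le_lt_trans (ue _ _ Nn) _; apply/HN => /=.
have cRe_cvg : cvgn (cRe \o u).
  by apply: cvg_part => [z w|z]; rewrite ?cReD ?cReN ?le_Re_modulus.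
have cIm_cvg : cvgn (cIm \o u).
  by apply: cvg_part => [z w|z]; rewrite ?cImD ?cImN ?le_Im_modulus.
pose l : C := Complex (limn (cRe \o u)) (limn (cIm \o u)).
exists l => n; apply/ler_addgt0Pr => eps eps0.
have e4 : 0 < eps / 2 by rewrite divr_gt0.
have [N1 _ HN1] : \forall m \near \oo, `|limn (cRe \o u) - (cRe \o u) m| < eps / 2.
  by move/cvgrPdist_lt : cRe_cvg => /(_ _ e4).
have [N2 _ HN2] : \forall m \near \oo, `|limn (cIm \o u) - (cIm \o u) m| < eps / 2.
  by move/cvgrPdist_lt : cIm_cvg => /(_ _ e4).
pose m := (n + N1 + N2)%N.
apply: le_trans (modulus_dist _ _ (u m)) _; apply: lerD.
  by rewrite modulusBC ue // /m -addnA leq_addr.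
rewrite modulusBC; apply: le_trans (modulus_le_ReIm _) _.
rewrite (splitr eps) cReD cImD cReN cImN; apply: lerD; apply/ltW.
  by apply: HN1; rewrite /m /= addnAC leq_addl.
by apply: HN2; rewrite /m /= leq_addl.
Qed.

(** Compactness for properties that hold from some threshold on: local thresholds merge into one.
    With [n.+1%:R^-1] or [n%:R] inside [P] this yields distances, moduli of continuity and
    bounds. *)
Lemma compact_near_cover (K : set C) (P : nat -> C -> Prop) : compact K ->
  (forall z, K z -> exists2 e : R, 0 < e & exists N, forall n w, (N <= n)%N ->
     modulus (w - z) < e -> P n w) ->
  exists N, forall n w, (N <= n)%N -> K w -> P n w.
Proof.
move=> /compact_near_coveringP cK H.
have [|N _ HN] := cK nat \oo P _; last by exists N => n w Nn Kw; exact: HN.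
move=> z Kz; have [e e0 [N HN]] := H _ Kz.
exists ([set w | modulus (w - z) < e], [set n | (N <= n)%N]); last first.
  by move=> [w n] /= [? ?]; exact: HN.
split => /=; last by exists N.
by apply/nbhs_modulusP; exists e.
Qed.

Lemma exists_inv_lt (e : R) : 0 < e -> exists N, forall n, (N <= n)%N ->
  n.+1%:R^-1 < e.
Proof.
move=> e0; have [N _ HN] : \forall n \near \oo, (n.+1%:R^-1 : R) < e.
  have /cvgrPdist_lt/(_ _ e0) := @cvg_harmonic R.
  by apply: filterS => n; rewrite sub0r normrN ger0_norm ?invr_ge0.
by exists N.
Qed.

Lemma compact_modulus_bounded K : compact K ->
  exists2 B : R, 0 < B & forall z, K z -> modulus z <= B.
Proof.
move=> /(@compact_near_cover K (fun n w => modulus w <= n%:R)) [|N HN].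
  move=> z Kz; exists 1 => //.
  have bz := truncnS_gt (modulus z + 1).
  exists (Num.truncn (modulus z + 1)).+1 => n w Nn wz.
  apply: (@le_trans _ _ (modulus z + 1)).
    rewrite addrC; apply: le_trans (modulus_le_add _ z) _.
    by rewrite lerD2r ltW.
  by apply/ltW; apply: lt_le_trans bz _; rewrite ler_nat.
exists N.+1%:R => // z Kz; apply: le_trans (HN N z _ Kz) _ => //.
by rewrite ler_nat.
Qed.

Lemma compact_far_point K p : compact K -> ~ K p ->
  exists2 e : R, 0 < e & forall z, K z -> e <= modulus (z - p).
Proof.
move=> cK Kp.
have [|N HN] := @compact_near_cover K (fun n w => n.+1%:R^-1 <= modulus (w - p)) cK.
  move=> z Kz; have zp : 0 < modulus (z - p).
    by rewrite modulus_gt0 subr_eq0; apply/eqP => zp; apply: Kp; rewrite -zp.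
  exists (modulus (z - p) / 2); first by rewrite divr_gt0.
  have [N HN] : exists N, forall n, (N <= n)%N -> n.+1%:R^-1 < modulus (z - p) / 2.
    by apply: exists_inv_lt; rewrite divr_gt0.
  exists N => n w /HN Hn wz; apply: le_trans (ltW Hn) _.
  have := modulus_dist z p w; rewrite (modulusBC z w); lra.
by exists N.+1%:R^-1; [rewrite invr_gt0 | move=> z Kz; exact: HN].
Qed.

Lemma within_continuous_modulusP K h : {within K, continuous h} <->
  forall z, K z -> forall e : R, 0 < e -> exists2 d : R, 0 < d &
    forall w, K w -> modulus (w - z) < d -> modulus (h w - h z) < e.
Proof.
split.
  move=> hK z Kz e e0.
  move/subspace_continuousP : hK => /(_ _ Kz) /cvg_modulusP /(_ _ e0).
  rewrite /within /= => /nbhs_modulusP[d d0 Hd]; exists d => // w Kw wz.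
  exact: Hd.
move=> H; apply/subspace_continuousP => z Kz; apply/cvg_modulusP => e e0.
have [d d0 Hd] := H _ Kz _ e0.
by rewrite /within; apply/nbhs_modulusP; exists d => // w wz Kw; exact: Hd.
Qed.

Lemma compact_unif_continuous K h : compact K -> {within K, continuous h} ->
  forall e : R, 0 < e -> exists2 d : R, 0 < d & forall z w, K z -> K w ->
    modulus (z - w) <= d -> modulus (h z - h w) <= e.
Proof.
move=> cK /within_continuous_modulusP hK e e0.
have [|N HN] := @compact_near_cover K (fun n w => forall v, K w -> K v ->
    modulus (w - v) <= n.+1%:R^-1 -> modulus (h w - h v) <= e) cK; last first.
  by exists N.+1%:R^-1; [rewrite invr_gt0|move=> z w Kz Kw; exact: HN].
move=> z Kz; have e2 : 0 < e / 2 by rewrite divr_gt0.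
have [d d0 Hd] := hK _ Kz _ e2; have d2 : 0 < d / 2 by rewrite divr_gt0.
exists (d / 2) => //; have [N HN] := exists_inv_lt d2.
exists N => n w /HN nd wz v Kw Kv wv; move: (le_lt_trans wv nd) => {nd} {}wv.
apply: le_trans (modulus_dist _ _ (h z)) _; rewrite (splitr e); apply: lerD.
  by apply/ltW/Hd => //; lra.
rewrite modulusBC; apply/ltW/Hd => //.
apply: le_lt_trans (modulus_dist _ _ w) _; rewrite (modulusBC v); lra.
Qed.

Lemma compact_continuous_bounded K h : compact K -> {within K, continuous h} ->
  exists2 B : R, 0 < B & forall z, K z -> modulus (h z) <= B.
Proof.
move=> cK /within_continuous_modulusP hK.
have [|N HN] := @compact_near_cover K (fun n w => K w -> modulus (h w) <= n%:R) cK.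
  move=> z Kz; have [d d0 Hd] := hK _ Kz _ (@ltr01 R).
  exists d => //.
  have bz := truncnS_gt (modulus (h z) + 1).
  exists (Num.truncn (modulus (h z) + 1)).+1 => n w Nn wz Kw.
  apply: (@le_trans _ _ (modulus (h z) + 1)).
    rewrite addrC; apply: le_trans (modulus_le_add _ (h z)) _.
    by rewrite lerD2r ltW // Hd.
  by apply/ltW; apply: lt_le_trans bz _; rewrite ler_nat.
exists N.+1%:R => // z Kz; apply: le_trans (HN N z _ Kz _) _ => //.
by rewrite ler_nat.
Qed.

(** Free of division: the inequality includes [w = z] and can be obtained as a limit of
    inequalities. *)
Definition cdiff_at f z l := forall e : R, 0 < e -> exists2 d : R, 0 < d &
  forall w, modulus (w - z) < d ->
    modulus (f w - f z - l * (w - z)) <= e * modulus (w - z).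

Lemma cdiff_at_quotient f z l : cdiff_at f z l <->
  (h^-1 *: (f (h + z) - f z)) @[h --> (0 : C)^'] --> l.
Proof.
split=> H.
  apply/cvg_modulusP => e e0; have e2 : 0 < e / 2 by rewrite divr_gt0.
  have [d d0 Hd] := H _ e2.
  apply/nbhs_modulusP; exists d => // w; rewrite subr0 => wd w0.
  have := Hd (w + z); rewrite addrK => /(_ wd) Hw.
  have w0' : w != 0 by apply/eqP => w00; move: w0; rewrite w00 eqxx.
  have -> : w^-1 *: (f (w + z) - f z) - l = w^-1 * (f (w + z) - f z - l * w).
    by rewrite mulrBr mulrCA mulVf // mulr1.
  rewrite modulusM modulusV mulrC ltr_pdivrMr ?modulus_gt0 //.
  by apply: le_lt_trans Hw _; rewrite ltr_pM2r ?modulus_gt0 //; lra.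
move=> e e0; move/cvg_modulusP : H => /(_ _ e0) /nbhs_modulusP[d d0 Hd].
exists d => // w wz; have [->|wz0] := eqVneq w z.
  by rewrite !subrr mulr0 subrr modulus0 mulr0.
have := Hd (w - z); rewrite subr0 => /(_ wz).
have wz1 : w - z != 0 by rewrite subr_eq0.
move=> /(_ wz1); rewrite subrK.
have -> : (w - z)^-1 *: (f w - f z) - l = (f w - f z - l * (w - z)) / (w - z).
  by rewrite mulrBl mulfK // mulrC.
by rewrite modulusM modulusV ltr_pdivrMr ?modulus_gt0 // => /ltW.
Qed.

Lemma derivable_cdiffP f z : derivable f z 1 <-> exists l, cdiff_at f z l.
Proof.
have E : (fun t => t^-1 *: ((f \o shift z) (t *: 1) - f z)) =
         (fun t => t^-1 *: (f (t + z) - f z)).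
  by apply/funext => t /=; rewrite /shift /= /GRing.scale /= mulr1.
rewrite /derivable E; split=> [H|[l /cdiff_at_quotient H]].
  by exists (lim ((t^-1 *: (f (t + z) - f z)) @[t --> (0 : C)^'])); apply/cdiff_at_quotient.
by apply/cvg_ex; exists l.
Qed.

Lemma cdiff_derive1 f z l : cdiff_at f z l -> derive1 f z = l.
Proof.
move=> /cdiff_at_quotient H; rewrite /derive1.
exact: (@cvg_lim _ cplx_hausdorff).
Qed.

Lemma interior_modulusP K z : interior K z <-> exists2 e : R, 0 < e &
  forall w, modulus (w - z) < e -> K w.
Proof. exact: nbhs_modulusP. Qed.

Lemma closed_disc_compact (r : R) : compact [set z : C | modulus z <= r].
Proof.
pose F (xy : R * R) : C := Complex xy.1 xy.2.
have Fc : continuous F.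
  move=> [x y]; apply/cvg_modulusP => e e0; have e2 : 0 < e / 2 by rewrite divr_gt0.
  exists ([set a | `|x - a| < e / 2], [set b | `|y - b| < e / 2]) => /=.
    by split; apply/nbhs_ballP; exists (e / 2).
  move=> [a b] /= [xa yb]; apply: le_lt_trans (modulus_le_ReIm _) _.
  by rewrite cReD cImD cReN cImN /F /= (splitr e) ltrD // distrC.
have cQ : compact (F @` (`[-r, r]%classic `*` `[-r, r]%classic)).
  apply: continuous_compact; first exact: continuous_subspaceT.
  by apply: compact_setX; exact: segment_compact.
apply: subclosed_compact cQ _; last first.
  move=> z /= zr; exists (cRe z, cIm z); last by case: (z).
  split => /=; rewrite in_itv /= -ler_norml.
    exact: le_trans (le_Re_modulus _) zr.
  exact: le_trans (le_Im_modulus _) zr.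
rewrite -openC; apply/open_modulusP => z /= /negP; rewrite -ltNge => rz.
exists (modulus z - r); first by rewrite subr_gt0.
move=> w wz; apply/negP; rewrite -ltNge.
have := modulus_le_add z w; rewrite (modulusBC z w); lra.
Qed.

End Analysis.

(** * The lattice form of Cauchy's integral *)

Section LatticeSums.
Context {R : realType}.
Implicit Types (phi : nat -> R) (N M : nat).

Definition ndist (a b : nat) : nat := ((a - b) + (b - a))%N.

Lemma ler_sum_widen phi n N : (forall m, 0 <= phi m) -> (n <= N)%N ->
  \sum_(m < n) phi m <= \sum_(m < N) phi m.
Proof.
move=> phi0 nN; rewrite -(subnKC nN) big_split_ord /= lerDl sumr_ge0 //.
Qed.

Lemma ndist_sum N b phi : (forall m, 0 <= phi m) -> (b < N)%N ->
  \sum_(a < N) phi (ndist a b) <= 2 * \sum_(m < N) phi m.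
Proof.
move=> phi0 bN; rewrite -(subnKC (ltnW bN)) big_split_ord /=.
rewrite mulr_natl mulr2n; apply: lerD.
  rewrite (reindex_inj rev_ord_inj) /=.
  apply: (@le_trans _ _ (\sum_(m < b.+1) phi m)).
    rewrite big_ord_recl /= ler_wpDl //; apply: ler_sum => i _ /=.
    have ib := ltn_ord i; rewrite (_ : ndist _ _ = bump 0 i) //.
    by rewrite /ndist /bump; lia.
  by apply: ler_sum_widen => //; rewrite subnKC // ltnW.
apply: (@le_trans _ _ (\sum_(m < N - b) phi m)).
  apply: ler_sum => i _; rewrite (_ : ndist _ _ = i) //; rewrite /ndist /=; lia.
by apply: ler_sum_widen => //; rewrite subnKC ?leq_subr // ltnW.
Qed.

Lemma ndist_count N b x : (b < N)%N ->
  \sum_(a < N) ((ndist a b <= x)%N)%:R <= 2 * x.+1%:R :> R.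
Proof.
move=> bN.
apply: le_trans (@ndist_sum N b (fun m => ((m <= x)%N)%:R) _ bN) _ => //.
rewrite ler_pM2l //; have [Nx|xN] := leqP N x.+1.
  apply: le_trans (_ : \sum_(m < N) 1 <= _).
    by apply: ler_sum => i _; case: leqP.
  by rewrite sumr_const card_ord ler_nat.
rewrite -(subnKC (ltnW xN)) big_split_ord /= [X in _ + X]big1 ?addr0; last first.
  by move=> i _; rewrite (_ : (_ <= x)%N = false) //; apply/negbTE; rewrite -ltnNge ltnS leq_addr.
apply: le_trans (_ : \sum_(m < x.+1) 1 <= _).
  by apply: ler_sum => i _; case: leqP.
by rewrite sumr_const card_ord.
Qed.

(** A square shell of radius [m] has at most [8 (m + 1)] points: two values for the coordinate at
    distance [m], [2 (m + 1)] for the other, and two choices of which is which. *)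
Lemma shell_sum N a0 b0 phi : (forall m, 0 <= phi m) -> (a0 < N)%N -> (b0 < N)%N ->
  \sum_(a < N) \sum_(b < N) phi (maxn (ndist a a0) (ndist b b0)) <=
  8 * \sum_(m < N) m.+1%:R * phi m.
Proof.
move=> phi0 aN bN.
apply: (@le_trans _ _
  (\sum_(a < N) \sum_(b < N) (((ndist b b0 <= ndist a a0)%N)%:R * phi (ndist a a0)) +
   \sum_(b < N) \sum_(a < N) (((ndist a a0 <= ndist b b0)%N)%:R * phi (ndist b b0)))).
  rewrite [X in _ + X]exchange_big -big_split /=; apply: ler_sum => a _.
  rewrite -big_split /=; apply: ler_sum => b _.
  have [ab|ba] := leqP (ndist b b0) (ndist a a0).
    by rewrite mul1r lerDl mulr_ge0.
  by rewrite mul0r add0r (ltnW ba) mul1r.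
have half x0 y0 : (x0 < N)%N -> (y0 < N)%N ->
  \sum_(a < N) \sum_(b < N) (((ndist b y0 <= ndist a x0)%N)%:R * phi (ndist a x0)) <=
  4 * \sum_(m < N) m.+1%:R * phi m.
  move=> xN yN.
  apply: (@le_trans _ _ (\sum_(a < N) 2 * ((ndist a x0).+1%:R * phi (ndist a x0)))).
    apply: ler_sum => a _; rewrite -mulr_suml mulrA ler_wpM2r //.
    exact: ndist_count.
  rewrite -mulr_sumr; set X := (X in _ <= 4 * X).
  have -> : 4 * X = 2 * (2 * X) by ring.
  rewrite ler_pM2l //.
  by apply: (@ndist_sum N x0 (fun m => m.+1%:R * phi m)) => // m; rewrite mulr_ge0.
set X := \sum_(m < N) _ * _ in half *; have -> : 8 * X = 4 * X + 4 * X by ring.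
by apply: lerD; apply: half.
Qed.

Lemma sum_inv_sqr N M : (0 < M)%N ->
  \sum_(m < N) M%:R / (M + m)%:R ^+ 2 <= 2 :> R.
Proof.
move=> M0; have M0' : 0 < M%:R :> R by rewrite ltr0n.
case: N => [|N]; first by rewrite big_ord0.
(* This bound telescopes: for [m > 0] the term is at most [M / (M + m - 1) - M / (M + m)], and
   [m = 0] contributes [M^-1]. *)
suff : \sum_(m < N.+1) M%:R / (M + m)%:R ^+ 2 <=
    M%:R^-1 + 1 - M%:R / (M + N)%:R :> R.
  have : 0 <= M%:R / (M + N)%:R :> R by rewrite divr_ge0.
  have : M%:R^-1 <= 1 :> R by rewrite invf_le1 // ler1n.
  lra.
elim: N => [|N IH].
  rewrite big_ord_recl big_ord0 addr0 addn0 divff ?gt_eqF // addrK.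
  by rewrite expr2 invfM mulrA divff ?gt_eqF // mul1r.
rewrite big_ord_recr /=; apply: le_trans (lerD IH (lexx _)) _.
rewrite -!addrA !lerD2l.
have MN0 : 0 < (M + N)%:R :> R by rewrite ltr0n addn_gt0 M0.
have MN1 : 0 < (M + N.+1)%:R :> R by rewrite ltr0n addn_gt0 M0.
rewrite addrC -lerBrDr opprK -[leLHS]mulr1.
move: MN0 MN1; rewrite addnS -natr1; move: (M + N)%:R => x MN0 _.
have x1 : 0 < x + 1 by lra.
rewrite mulr1 -mulrN -mulrDr ler_pM2l // -subr_ge0.
have -> : - (x + 1)^-1 + x^-1 - ((x + 1) ^+ 2)^-1 = (x * (x + 1) ^+ 2)^-1.
  by field; rewrite !gt_eqF.
by rewrite invr_ge0 mulr_ge0 ?sqr_ge0 // ltW.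
Qed.

End LatticeSums.

(** * The truncated Cauchy kernel and its lattice derivative *)

Section Kernel.
Context {R : realType}.
Local Notation C := (Cplx R).
Implicit Types (z w q : C) (h : R) (F : C -> C).

(** The point [z] may come arbitrarily close to the centre of a cell; the cut-off keeps the Cauchy
    kernel below [2 / h] there. *)
Definition kern h w : C := if modulus w < h / 2 then 0 else w^-1.

Definition half_diag h : C := (1 + iC) * ofR h / 2.

Definition grid q h (a b : nat) : C := q + ofR h * (a%:R + iC * b%:R).

(* The trapezoidal rule for the integral of [F] along the square with side [h]
   and lower left corner [q]. *)
Definition cell_sum F q h : C :=
  ofR h / 2 * ((1 - iC) * (F q - F (q + ofR h * (1 + iC)))
             + (1 + iC) * (F (q + ofR h) - F (q + ofR h * iC))).

(* The coefficient of [F p] at [w = z - p] once the products of [cell_sum F q h]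
   with the Cauchy kernel at the centre of the cell have been summed by parts
   over the lattice. For large [w] it equals
   [i h ^ 4 / (w ^ 4 + h ^ 4 / 4)]. *)
Definition akern h w : C :=
  ofR h / 2 * ((1 - iC) * (kern h (w - half_diag h) - kern h (w + half_diag h))
    + (1 + iC) * (kern h (w - iC * half_diag h) - kern h (w + iC * half_diag h))).

Lemma kern_le h w : 0 < h -> modulus (kern h w) <= 2 / h.
Proof.
move=> h0; rewrite /kern; case: ltrP => [_|hw].
  by rewrite modulus0 divr_ge0 // ltW.
have h2 : 0 < h / 2 by rewrite divr_gt0.
rewrite modulusV (_ : 2 / h = (h / 2)^-1); last by rewrite invf_div.
by rewrite lef_pV2 // posrE (lt_le_trans h2).
Qed.

Lemma kern_far h w : h / 2 <= modulus w -> kern h w = w^-1.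
Proof. by rewrite /kern ltNge => ->. Qed.

Lemma modulus_1iC : modulus (1 + iC : C) <= 2.
Proof. by apply: le_trans (modulusD _ _) _; rewrite modulus1 modulus_iC; lra. Qed.

Lemma modulus_1NiC : modulus (1 - iC : C) <= 2.
Proof. by apply: le_trans (modulusB _ _) _; rewrite modulus1 modulus_iC; lra. Qed.

Lemma half_diag_le h : 0 <= h -> modulus (half_diag h) <= h.
Proof.
move=> h0; rewrite /half_diag !modulusM modulusV modulus_ofR modulus_nat ger0_norm //.
have := modulus_1iC; nra.
Qed.

Lemma akern_le h w : 0 < h -> modulus (akern h w) <= 8.
Proof.
move=> h0; rewrite /akern !modulusM modulusV modulus_ofR modulus_nat gtr0_norm //.
set X := _ * _ + _; have : modulus X <= 16 / h.
  have D u v : modulus (kern h u - kern h v) <= 4 / h.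
    have := modulusB (kern h u) (kern h v); have := kern_le u h0; have := kern_le v h0.
    lra.
  apply: le_trans (modulusD _ _) _; rewrite !modulusM.
  have -> : 16 / h = 2 * (4 / h) + 2 * (4 / h) by field; rewrite gt_eqF.
  by apply: lerD; apply: ler_pM => //; rewrite ?modulus_1iC ?modulus_1NiC ?D.
have -> : 8 = h / 2 * (16 / h) by field; rewrite gt_eqF.
by rewrite ler_pM2l // divr_gt0.
Qed.

(** The four poles, [half_diag h] times the powers of [iC], are the fourth roots of [- h ^ 4 / 4],
    and the weights of [akern] leave a constant numerator. For [|w| >= 2 h] the denominator
    [w ^ 4 + h ^ 4 / 4] keeps at least half of [|w| ^ 4]. *)
Lemma akern_far h w : 0 < h -> 2 * h <= modulus w ->
  modulus (akern h w) <= 2 * h ^+ 4 / modulus w ^+ 4.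
Proof.
move=> h0 hw.
have e_le := half_diag_le (ltW h0).
have ie_le : modulus (iC * half_diag h) <= h by rewrite modulusM modulus_iC mul1r.
have farB v : modulus v <= h -> h <= modulus (w - v).
  by move=> vh; have := modulus_le_sub w (- v); rewrite modulusN; lra.
have farD v : modulus v <= h -> h <= modulus (w + v).
  by move=> vh; have := modulus_le_sub w v; lra.
have n0 v : h <= modulus v -> v != 0.
  by move=> hv; rewrite -modulus_gt0 (lt_le_trans h0).
have h2 v : h <= modulus v -> kern h v = v^-1.
  move=> hv; apply: kern_far; apply: le_trans hv; lra.
rewrite /akern !h2 ?farB ?farD //.
have [n1 n2] := (n0 _ (farB _ e_le), n0 _ (farD _ e_le)).
have [n3 n4] := (n0 _ (farB _ ie_le), n0 _ (farD _ ie_le)).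
have w0 : 0 < modulus w by lra.
have h40 : 0 < h ^+ 4 by rewrite exprn_gt0.
have w4 : h ^+ 4 * 16 <= modulus w ^+ 4.
  have -> : h ^+ 4 * 16 = (2 * h) ^+ 4 by ring.
  by apply: lerXn2r => //; rewrite nnegrE; lra.
have den : modulus w ^+ 4 / 2 <= modulus (w ^+ 4 + ofR h ^+ 4 / 4).
  have := modulus_le_sub (w ^+ 4) (ofR h ^+ 4 / 4).
  rewrite modulusM modulusV !modulusX modulus_nat modulus_ofR gtr0_norm //; lra.
have den0 : w ^+ 4 + ofR h ^+ 4 / 4 != 0.
  by rewrite -modulus_gt0; apply: lt_le_trans den; rewrite divr_gt0 // exprn_gt0.
have i2 := sqr_iC (R := R).
set e := half_diag h in n1 n2 n3 n4 *.
have ee : e * e = iC * ofR h ^+ 2 / 2.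
  rewrite /e /half_diag.
  have -> : (1 + iC) * ofR h / 2 * ((1 + iC) * ofR h / 2) =
    (1 + 2 * iC + iC ^+ 2) * ofR h ^+ 2 / 4 :> C by field.
  by rewrite i2; field.
have e4 : e ^+ 4 = - ofR h ^+ 4 / 4.
  have -> : e ^+ 4 = (e * e) ^+ 2 by ring.
  rewrite ee; have -> : (iC * ofR h ^+ 2 / 2) ^+ 2 = iC ^+ 2 * ofR h ^+ 4 / 4 :> C by field.
  by rewrite i2; field.
have E1 : (w - e)^-1 - (w + e)^-1 = 2 * e / (w ^+ 2 - e * e) :> C.
  have : w ^+ 2 - e * e != 0.
    rewrite (_ : w ^+ 2 - e * e = (w - e) * (w + e)) ?mulf_neq0 //; ring.
  by move=> n5; field; rewrite n1 n2 n5.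
have E2 : (w - iC * e)^-1 - (w + iC * e)^-1 = 2 * iC * e / (w ^+ 2 + e * e) :> C.
  have F : w ^+ 2 + e * e = (w - iC * e) * (w + iC * e).
    have -> : (w - iC * e) * (w + iC * e) = w ^+ 2 - iC ^+ 2 * (e * e) by ring.
    by rewrite i2; ring.
  have : w ^+ 2 + e * e != 0 by rewrite F mulf_neq0.
  move=> n5; rewrite F; field; rewrite n3 n4 //.
have F4 : w ^+ 4 + ofR h ^+ 4 / 4 = (w ^+ 2 - e * e) * (w ^+ 2 + e * e).
  have -> : (w ^+ 2 - e * e) * (w ^+ 2 + e * e) = w ^+ 4 - e ^+ 4 by ring.
  by rewrite e4; field.
have : (w ^+ 2 - e * e != 0) && (w ^+ 2 + e * e != 0).
  by rewrite -negb_or -mulf_eq0 -F4.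
move=> /andP[m1 m2].
have -> : ofR h / 2 * ((1 - iC) * ((w - e)^-1 - (w + e)^-1)
    + (1 + iC) * ((w - iC * e)^-1 - (w + iC * e)^-1)) =
    iC * ofR h ^+ 4 / (w ^+ 4 + ofR h ^+ 4 / 4).
  rewrite E1 E2.
  have -> : (1 - iC) * (2 * e / (w ^+ 2 - e * e)) = 2 * ofR h / (w ^+ 2 - e * e).
    rewrite mulrA; congr (_ / _); rewrite /e /half_diag.
    have -> : (1 - iC) * (2 * ((1 + iC) * ofR h / 2)) = (1 - iC ^+ 2) * ofR h :> C.
      by field.
    by rewrite i2; ring.
  have -> : (1 + iC) * (2 * iC * e / (w ^+ 2 + e * e)) = - (2 * ofR h) / (w ^+ 2 + e * e).
    rewrite mulrA; congr (_ / _); rewrite /e /half_diag.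
    have -> : (1 + iC) * (2 * iC * ((1 + iC) * ofR h / 2)) =
      (iC + 2 * iC ^+ 2 + iC ^+ 2 * iC) * ofR h :> C by field.
    by rewrite i2; ring.
  rewrite F4 {n1 n2 n3 n4 E1 E2 F4}.
  have -> : ofR h / 2 * (2 * ofR h / (w ^+ 2 - e * e) + - (2 * ofR h) / (w ^+ 2 + e * e)) =
     2 * (e * e) * ofR h ^+ 2 / ((w ^+ 2 - e * e) * (w ^+ 2 + e * e)).
    by field; rewrite m1 m2.
  by congr (_ / _); rewrite ee; field.
rewrite modulusM modulusM modulusV modulusX modulus_iC modulus_ofR gtr0_norm // mul1r.
have -> : 2 * h ^+ 4 / modulus w ^+ 4 = h ^+ 4 / (modulus w ^+ 4 / 2).
  by field; rewrite gt_eqF.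
rewrite ler_pM2l // lef_pV2 ?posrE //; last by rewrite divr_gt0 // exprn_gt0.
by apply: lt_le_trans den; rewrite divr_gt0 // exprn_gt0.
Qed.

(** The index shift of Abel summation; the truncated [a.-1] at [a = 0] is harmless because
    [u 0 = 0]. *)
Lemma shift_sum N (u V : nat -> C) : u 0 = 0 -> u N = 0 ->
  \sum_(a < N) u a.+1 * V a = \sum_(a < N) u a * V a.-1.
Proof.
move=> u0 uN; transitivity (\sum_(a < N.+1) u a * V a.-1).
  by rewrite big_ord_recl /= u0 mul0r add0r.
by rewrite big_ord_recr /= uN mul0r addr0.
Qed.

End Kernel.

(** * Summation by parts on the lattice *)

Section Grid.
Context {R : realType}.
Local Notation C := (Cplx R).
Implicit Types (z w q : C) (h : R) (F : C -> C) (N : nat).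

Lemma grid_S q h a b : grid q h a.+1 b = grid q h a b + ofR h.
Proof. by rewrite /grid -natr1; ring. Qed.

Lemma gridS_ q h a b : grid q h a b.+1 = grid q h a b + ofR h * iC.
Proof. by rewrite /grid -natr1; ring. Qed.

Lemma grid_add q h a b s t : grid (grid q h a b) h s t = grid q h (a + s) (b + t).
Proof. by rewrite /grid !natrD; ring. Qed.

Lemma sum_cross N (c p r : C) (x y u v : nat -> C) :
  \sum_(a < N) c * (p * (x a - y a) + r * (u a - v a)) =
  c * (p * (\sum_(a < N) x a - \sum_(a < N) y a)
     + r * (\sum_(a < N) u a - \sum_(a < N) v a)).
Proof. by rewrite -mulr_sumr big_split /= -!mulr_sumr !sumrB. Qed.

(** The value of [F] at an inner lattice point enters four cells, and collecting the four kernel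
    values gives [akern]. Since [F] vanishes on the frame, no boundary terms remain. *)
Lemma sum_by_parts F q h z N :
  (forall a b, (a <= N)%N -> (b <= N)%N ->
    [|| a == 0, b == 0, a == N | b == N]%N -> F (grid q h a b) = 0) ->
  \sum_(a < N) \sum_(b < N)
     cell_sum F (grid q h a b) h * kern h (z - grid q h a b - half_diag h) =
  \sum_(a < N) \sum_(b < N) F (grid q h a b) * akern h (z - grid q h a b).
Proof.
move=> F0; pose u a b := F (grid q h a b).
pose V a b := kern h (z - grid q h a b - half_diag h).
have two_e : half_diag h + half_diag h = ofR h * (1 + iC) :> C.
  by rewrite /half_diag; field.
have two_ie : iC * half_diag h + half_diag h = ofR h * iC :> C.
  have -> : iC * half_diag h + half_diag h = (1 + 2 * iC + iC ^+ 2) * ofR h / 2 :> C.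
    by rewrite /half_diag; field.
  by rewrite sqr_iC; field.
have two_ie' : half_diag h - iC * half_diag h = ofR h :> C.
  have -> : half_diag h - iC * half_diag h = (1 - iC ^+ 2) * ofR h / 2 :> C.
    by rewrite /half_diag; field.
  by rewrite sqr_iC; field.
have EL a : \sum_(b < N) cell_sum F (grid q h a b) h * V a b =
  ofR h / 2 * ((1 - iC) * (\sum_(b < N) u a b * V a b - \sum_(b < N) u a.+1 b.+1 * V a b)
  + (1 + iC) * (\sum_(b < N) u a.+1 b * V a b - \sum_(b < N) u a b.+1 * V a b)).
  rewrite -(@sum_cross N _ _ _ (fun b => u a b * V a b) (fun b => u a.+1 b.+1 * V a b)
    (fun b => u a.+1 b * V a b) (fun b => u a b.+1 * V a b)).
  apply: eq_bigr => b _.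
  rewrite /cell_sum -grid_S -gridS_ (_ : _ + ofR h * (1 + iC) = grid q h a.+1 b.+1).
    by rewrite /u /V; ring.
  by rewrite !(grid_S, gridS_); ring.
have ER a : (a < N)%N -> \sum_(b < N) F (grid q h a b) * akern h (z - grid q h a b) =
  ofR h / 2 * ((1 - iC) * (\sum_(b < N) u a b * V a b - \sum_(b < N) u a b * V a.-1 b.-1)
  + (1 + iC) * (\sum_(b < N) u a b * V a.-1 b - \sum_(b < N) u a b * V a b.-1)).
  move=> aN; rewrite -(@sum_cross N _ _ _ (fun b => u a b * V a b)
    (fun b => u a b * V a.-1 b.-1) (fun b => u a b * V a.-1 b) (fun b => u a b * V a b.-1)).
  apply: eq_bigr => b _; rewrite -/(u a b).
  (* Where [u a b] is nonzero both indices are positive, so their predecessors belong to genuine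
     neighbouring cells. *)
  have [u0|u0] := eqVneq (u a b) 0; first by rewrite u0 !mul0r !subrr !mulr0 addr0 mulr0.
  case: a aN u0 => [|a] aN u0.
    by move: u0; rewrite /u F0 ?eqxx // ltnW.
  case: b u0 => -[|b] bN /= u0.
    by move: u0; rewrite /u F0 ?eqxx ?orbT // ltnW.
  rewrite /akern /V /= !(grid_S, gridS_).
  move: (grid q h a b) (half_diag h) two_e two_ie two_ie' => g e E1 E2 E3.
  have -> : z - (g + ofR h * iC + ofR h) + e = z - g - e.
    have -> : z - (g + ofR h * iC + ofR h) + e = z - g - ofR h * (1 + iC) + e by ring.
    by rewrite -E1; ring.
  have -> : z - (g + ofR h * iC + ofR h) - iC * e = z - (g + ofR h * iC) - e.
    by rewrite -E3; ring.
  have -> : z - (g + ofR h * iC + ofR h) + iC * e = z - (g + ofR h) - e.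
    by rewrite -E2; ring.
  by ring.
etransitivity; first by apply: eq_bigr => a _; exact: EL.
symmetry; etransitivity; first by apply: eq_bigr => a _; exact: ER (ltn_ord a).
symmetry.
pose X f := fun a : nat => \sum_(b < N) f a b : C.
rewrite (@sum_cross N _ _ _ (X (fun a b => u a b * V a b))
  (X (fun a b => u a.+1 b.+1 * V a b)) (X (fun a b => u a.+1 b * V a b))
  (X (fun a b => u a b.+1 * V a b))).
rewrite (@sum_cross N _ _ _ (X (fun a b => u a b * V a b))
  (X (fun a b => u a b * V a.-1 b.-1)) (X (fun a b => u a b * V a.-1 b))
  (X (fun a b => u a b * V a b.-1))) /X.
have u0_ b : (b <= N)%N -> u 0 b = 0 by move=> bN; apply: F0.
have uN_ b : (b <= N)%N -> u N b = 0 by move=> bN; apply: F0 => //; rewrite eqxx !orbT.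
have u_0 a : (a <= N)%N -> u a 0 = 0 by move=> bN; apply: F0 => //; rewrite eqxx !orbT.
have u_N a : (a <= N)%N -> u a N = 0 by move=> bN; apply: F0 => //; rewrite eqxx !orbT.
have S10 : \sum_(a < N) \sum_(b < N) u a.+1 b * V a b =
           \sum_(a < N) \sum_(b < N) u a b * V a.-1 b.
  rewrite exchange_big [RHS]exchange_big; apply: eq_bigr => b _ /=.
  by rewrite (@shift_sum _ N (u^~ b) (V^~ b)) ?u0_ ?uN_ // ltnW.
have S01 : \sum_(a < N) \sum_(b < N) u a b.+1 * V a b =
           \sum_(a < N) \sum_(b < N) u a b * V a b.-1.
  apply: eq_bigr => a _ /=.
  by rewrite (@shift_sum _ N (u a) (V a)) ?u_0 ?u_N // ltnW.
have S11 : \sum_(a < N) \sum_(b < N) u a.+1 b.+1 * V a b =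
           \sum_(a < N) \sum_(b < N) u a b * V a.-1 b.-1.
  transitivity (\sum_(a < N) \sum_(b < N) u a.+1 b * V a b.-1).
    apply: eq_bigr => a _ /=.
    by rewrite (@shift_sum _ N (u a.+1) (V a)) ?u_0 ?u_N.
  rewrite exchange_big [RHS]exchange_big; apply: eq_bigr => b _ /=.
  by rewrite (@shift_sum _ N (u^~ b) (V^~ b.-1)) ?u0_ ?uN_ // ltnW.
by rewrite S10 S01 S11.
Qed.

(** The offset [t] treats lattice points ([t = 0]) and cell centres ([t = h / 2]) at once. *)
Lemma axis_near h (x : R) N : 0 < h -> 0 <= x < h * N%:R ->
  exists2 a0 : nat, (a0 < N)%N & forall a t, 0 <= t <= h ->
    `|x - h * a%:R| <= h * (ndist a a0).+1%:R /\
    h * ((ndist a a0)%:R - 1) <= `|x - h * a%:R - t|.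
Proof.
move=> h0 /andP[x0 xN]; have xh0 : 0 <= x / h by rewrite divr_ge0 // ltW.
have /andP[l1 l2] := truncn_itv xh0; set a0 := Num.truncn _ in l1 l2.
rewrite ler_pdivlMr // in l1; rewrite ltr_pdivrMr // in l2.
exists a0.
  rewrite -(ltr_nat R); apply: le_lt_trans (_ : x / h < _); first by rewrite ler_pdivlMr.
  by rewrite ltr_pdivrMr // mulrC.
move=> a t /andP[t0 th]; rewrite -natr1 in l2; rewrite -natr1.
have [aa|aa] := leqP a0 a.
  have -> : ndist a a0 = (a - a0)%N by rewrite /ndist; lia.
  have : 0 <= h * (a%:R - a0%:R) by rewrite mulr_ge0 ?subr_ge0 ?ler_nat // ltW.
  rewrite natrB // => ha; split; first by rewrite ler_norml; apply/andP; split; lra.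
  by rewrite ler_normr; apply/orP; right; lra.
have -> : ndist a a0 = (a0 - a)%N by rewrite /ndist; lia.
have : 0 <= h * (a0%:R - a%:R) by rewrite mulr_ge0 ?subr_ge0 ?ler_nat ?(ltnW aa) ?(ltW h0).
rewrite natrB ?(ltnW aa) // => ha; split; first by rewrite ler_norml; apply/andP; split; lra.
by rewrite ler_normr; apply/orP; left; lra.
Qed.

Lemma cRe_grid q h a b : cRe (grid q h a b) = cRe q + h * a%:R.
Proof.
rewrite /grid -!ofR_nat cReD cReM cReD cImD cReM cImM !cRe_ofR !cIm_ofR cRe_iC.
by rewrite !(mul0r, mulr0, subr0, addr0).
Qed.

Lemma cIm_grid q h a b : cIm (grid q h a b) = cIm q + h * b%:R.
Proof.
rewrite /grid -!ofR_nat cImD cImM cReD cImD cReM cImM !cRe_ofR !cIm_ofR cRe_iC cIm_iC.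
by rewrite !(mul0r, mulr0, subr0, addr0, add0r, mul1r).
Qed.

Lemma half_diagE h : half_diag h = Complex (h / 2) (h / 2) :> C.
Proof.
have -> : half_diag h = ofR (h / 2) + iC * ofR (h / 2) :> C.
  rewrite /half_diag ofRM ofRV ofR_nat; ring.
by rewrite [RHS]complexD_E.
Qed.

Lemma grid_near q h N z : 0 < h ->
  0 <= cRe (z - q) < h * N%:R -> 0 <= cIm (z - q) < h * N%:R ->
  exists a0 b0, [/\ (a0 < N)%N, (b0 < N)%N & forall a b,
    [/\ modulus (z - grid q h a b) <= 2 * h * (maxn (ndist a a0) (ndist b b0)).+1%:R,
        h * ((maxn (ndist a a0) (ndist b b0))%:R - 1) <= modulus (z - grid q h a b) &
        h * ((maxn (ndist a a0) (ndist b b0))%:R - 1) <=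
          modulus (z - grid q h a b - half_diag h)]].
Proof.
move=> h0 /(axis_near h0)[a0 a0N Ha] /(axis_near h0)[b0 b0N Hb].
exists a0, b0; split => // a b.
have z0 : (0 : R) <= 0 <= h by apply/andP; split; lra.
have zh : 0 <= h / 2 <= h by apply/andP; split; lra.
have [Ha1 Ha2] := Ha a _ z0; have [_ Ha3] := Ha a _ zh.
have [Hb1 Hb2] := Hb b _ z0; have [_ Hb3] := Hb b _ zh.
have eRe : cRe (z - grid q h a b) = cRe (z - q) - h * a%:R.
  by rewrite !cReD !cReN cRe_grid opprD addrA.
have eIm : cIm (z - grid q h a b) = cIm (z - q) - h * b%:R.
  by rewrite !cImD !cImN cIm_grid opprD addrA.
have max_le (m n : nat) (P : R) : h * (m%:R - 1) <= P -> h * (n%:R - 1) <= P ->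
    h * ((maxn m n)%:R - 1) <= P.
  by move=> ? ?; rewrite /maxn; case: ifP.
rewrite !subr0 in Ha2 Hb2; split.
- apply: le_trans (modulus_le_ReIm _) _; rewrite eRe eIm.
  rewrite (_ : 2 * h = h + h) ?mulrDl; last by ring.
  apply: lerD; [apply: le_trans Ha1 _|apply: le_trans Hb1 _];
  by rewrite ler_pM2l // ler_nat ltnS ?leq_maxl ?leq_maxr.
- apply: max_le.
    by apply: le_trans (le_Re_modulus _); rewrite eRe.
  by apply: le_trans (le_Im_modulus _); rewrite eIm.
- apply: max_le.
    by apply: le_trans (le_Re_modulus _); rewrite cReD eRe half_diagE.
  by apply: le_trans (le_Im_modulus _); rewrite cImD eIm half_diagE.
Qed.

End Grid.

(** * The total mass of the lattice kernel *)

Section BoxSum.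
Context {R : realType}.
Local Notation C := (Cplx R).
Variables (n : nat) (h X : R).
Hypotheses (n_gt0 : (0 < n)%N) (h_gt0 : 0 < h) (XE : X = h * (n%:R + 1 / 2)).
Implicit Types (z w : C).
Local Notation N := n.*2.+1.

Definition box_origin : C := Complex (- (h * n%:R)) (- (h * n%:R)).

Definition box_sum z : C :=
  \sum_(a < N) \sum_(b < N) akern h (z - grid box_origin h a b).

(** The dual lattice: corners of the squares of side [h] centred at the grid points. *)
Let bpt (a b : nat) : C :=
  Complex (h * (a%:R - n%:R - 1 / 2)) (h * (b%:R - n%:R - 1 / 2)).
Let V z a b := kern h (z - bpt a b).

Let top z a := V z a.+1 N + V z a N - V z a.+1 0 - V z a 0.
Let side z b := V z N b.+1 + V z N b - V z 0 b.+1 - V z 0 b.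

Lemma telescope_ord (f : nat -> C) m : \sum_(b < m) (f b.+1 - f b) = f m - f 0.
Proof.
elim: m => [|m IH]; first by rewrite big_ord0 subrr.
by rewrite big_ord_recr /= IH addrC subrKA.
Qed.

(** The double sum telescopes in each direction to the trapezoidal rule for the Cauchy kernel along
    the boundary of the square of half side [X]: a discrete winding number. *)
Lemma box_sumE z : box_sum z =
  ofR h / 2 * (\sum_(a < N) top z a - iC * \sum_(b < N) side z b).
Proof.
pose W1 a b := V z a.+1 b + V z a b; pose W2 a b := V z a b.+1 + V z a b.
have E a b : akern h (z - grid box_origin h a b) =
    ofR h / 2 * ((W1 a b.+1 - W1 a b) - iC * (W2 a.+1 b - W2 a b)).
  have [aS bS] : a.+1%:R = a%:R + 1 :> R /\ b.+1%:R = b%:R + 1 :> R by rewrite !natr1.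
  rewrite /akern /W1 /W2 /V.
  have eR : cRe (half_diag h) = h / 2 by rewrite half_diagE.
  have eI : cIm (half_diag h) = h / 2 by rewrite half_diagE.
  move: (half_diag h) eR eI => e eR eI.
  move: (cRe_grid box_origin h a b) (cIm_grid box_origin h a b).
  move: (grid box_origin h a b) => g gR gI.
  have -> : z - g - e = z - bpt a.+1 b.+1.
    apply: complex_ext;
      rewrite !(cReD, cImD, cReN, cImN) ?gR ?gI ?eR ?eI /= ?aS ?bS; by field.
  have -> : z - g + e = z - bpt a b.
    apply: complex_ext;
      rewrite !(cReD, cImD, cReN, cImN) ?gR ?gI ?eR ?eI /=; by field.
  have -> : z - g - iC * e = z - bpt a b.+1.
    apply: complex_ext;
      rewrite !(cReD, cImD, cReN, cImN, cReM, cImM) ?gR ?gI ?eR ?eI /= ?bS; by field.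
  have -> : z - g + iC * e = z - bpt a.+1 b.
    apply: complex_ext;
      rewrite !(cReD, cImD, cReN, cImN, cReM, cImM) ?gR ?gI ?eR ?eI /= ?aS; by field.
  by ring.
rewrite /box_sum; under eq_bigr do under eq_bigr do rewrite E.
under eq_bigr do rewrite -mulr_sumr.
rewrite -mulr_sumr; congr (_ * _).
under eq_bigr do rewrite sumrB -mulr_sumr telescope_ord.
rewrite sumrB -mulr_sumr; congr (_ - _ * _).
  by apply: eq_bigr => a _; rewrite /W1 /top; ring.
rewrite exchange_big; apply: eq_bigr => b _ /=.
by rewrite (telescope_ord (W2^~ b)) /W2 /side; ring.
Qed.

Let X_gt0 : 0 < X.
Proof. by rewrite XE mulr_gt0 // ltr_wpDl // divr_gt0. Qed.

Let hX : h <= X.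
Proof.
rewrite XE ler_peMr ?(ltW h_gt0) //.
by have : 1 <= n%:R :> R; [rewrite ler1n | lra].
Qed.

Let hN : h * N%:R = 2 * X.
Proof. by rewrite XE -natr1 -muln2 natrM; field. Qed.

Let bpt_le a : (a <= N)%N -> `|h * (a%:R - n%:R - 1 / 2)| <= X.
Proof.
move=> aN; rewrite normrM gtr0_norm // XE ler_pM2l // ler_norml.
have : a%:R <= N%:R :> R by rewrite ler_nat.
have : 0 <= a%:R :> R by [].
by rewrite -natr1 -muln2 natrM => ? ?; apply/andP; split; lra.
Qed.

Let bptN : h * (N%:R - n%:R - 1 / 2) = X.
Proof. by rewrite XE -natr1 -muln2 natrM; field. Qed.

Let bpt0 : h * (0%:R - n%:R - 1 / 2) = - X.
Proof. by rewrite XE; ring. Qed.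

Let V_diff z a b : modulus z <= X / 2 -> X <= modulus (bpt a b) ->
  modulus (V z a b - V 0 a b) <= 2 * modulus z / X ^+ 2.
Proof.
have [X0 hX0] := (X_gt0, hX); move=> zX cX; set c := bpt a b in cX *.
have zc : X / 2 <= modulus (z - c).
  by have := modulus_le_sub (- c) z; rewrite modulusN (addrC (- c)); lra.
have zc0 : z - c != 0 by rewrite -modulus_gt0; lra.
have c0 : c != 0 by rewrite -modulus_gt0; lra.
rewrite /V -/c kern_far; last by lra.
rewrite kern_far ?sub0r ?modulusN; last by lra.
have -> : (z - c)^-1 - (- c)^-1 = z * ((c * (z - c))^-1).
  by field; rewrite c0 zc0.
rewrite !modulusM modulusV modulusM mulrC.
have -> : 2 * modulus z / X ^+ 2 = (X * (X / 2))^-1 * modulus z.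
  by field; rewrite gt_eqF.
have X20 : 0 < X / 2 by rewrite divr_gt0.
rewrite ler_wpM2r // lef_pV2 ?posrE ?mulr_gt0 ?modulus_gt0 //.
by apply: ler_pM => //; apply: ltW.
Qed.

(** Moving the pole from 0 to [z] changes the kernel on the boundary by at most [2 |z| / X ^ 2], and
    the boundary has length [8 X]. *)
Lemma box_sum_diff z : modulus z <= X / 2 ->
  modulus (box_sum z - box_sum 0) <= 16 * modulus z / X.
Proof.
move=> zX; rewrite !box_sumE -mulrBr.
have bX a : X <= modulus (bpt a N) /\ X <= modulus (bpt a 0) /\
            X <= modulus (bpt N a) /\ X <= modulus (bpt 0 a).
  have n1 : `|X| = X by rewrite gtr0_norm.
  have n2 : `|- X| = X by rewrite normrN gtr0_norm.
  split; first by apply: le_trans (le_Im_modulus _); rewrite /= bptN n1.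
  split; first by apply: le_trans (le_Im_modulus _); rewrite /= bpt0 n2.
  split; first by apply: le_trans (le_Re_modulus _); rewrite /= bptN n1.
  by apply: le_trans (le_Re_modulus _); rewrite /= bpt0 n2.
set D := 2 * modulus z / X ^+ 2.
have four (p q r s p' q' r' s' : C) : modulus (p - p') <= D -> modulus (q - q') <= D ->
    modulus (r - r') <= D -> modulus (s - s') <= D ->
    modulus (p + q - r - s - (p' + q' - r' - s')) <= 4 * D.
  move=> ? ? ? ?; have -> : p + q - r - s - (p' + q' - r' - s') =
    (p - p') + (q - q') - (r - r') - (s - s') by ring.
  apply: le_trans (modulusB _ _) _.
  have := modulusB (p - p' + (q - q')) (r - r'); have := modulusD (p - p') (q - q').
  by lra.
have sumD (f : nat -> C -> C) : (forall a, modulus (f a z - f a 0) <= 4 * D) ->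
    modulus (\sum_(a < N) f a z - \sum_(a < N) f a 0) <= N%:R * (4 * D).
  move=> H; rewrite -sumrB; apply: le_trans (modulus_sum _ _ _) _.
  apply: le_trans (ler_sum _ (fun (a : 'I_N) _ => H a)) _.
  by rewrite sumr_const card_ord -[leLHS]mulr_natl.
have topD : modulus (\sum_(a < N) top z a - \sum_(a < N) top 0 a) <= N%:R * (4 * D).
  apply: (sumD (fun a z => top z a)) => a; rewrite /top.
  have [? [? [? ?]]] := bX a; have [? [? [? ?]]] := bX a.+1.
  by apply: four; apply: V_diff.
have sideD : modulus (\sum_(b < N) side z b - \sum_(b < N) side 0 b) <= N%:R * (4 * D).
  apply: (sumD (fun a z => side z a)) => a; rewrite /side.
  have [? [? [? ?]]] := bX a; have [? [? [? ?]]] := bX a.+1.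
  by apply: four; apply: V_diff.
rewrite modulusM modulusM modulusV modulus_ofR modulus_nat gtr0_norm //.
have -> : 16 * modulus z / X = h / 2 * (N%:R * (8 * D)).
  have -> : h / 2 * (N%:R * (8 * D)) = h * N%:R * (4 * D) by field.
  by rewrite hN /D; field; rewrite gt_eqF.
rewrite ler_pM2l ?divr_gt0 //.
set A := \sum_(a < N) top z a in topD *; set B := \sum_(a < N) side z a in sideD *.
set A' := \sum_(a < N) top 0 a in topD *; set B' := \sum_(a < N) side 0 a in sideD *.
have -> : A - iC * B - (A' - iC * B') = (A - A') - iC * (B - B') by ring.
apply: le_trans (modulusB _ _) _; rewrite modulusM modulus_iC mul1r; lra.
Qed.

Let inv_neg (x y : R) : (- (Complex x y : C))^-1 =
  Complex (- x / (x ^+ 2 + y ^+ 2)) (y / (x ^+ 2 + y ^+ 2)).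
Proof. by rewrite /GRing.inv /= !sqrrN !mulNr opprK. Qed.

Let V0E a b : X <= modulus (bpt a b) -> V 0 a b = (- bpt a b)^-1.
Proof. have [X0 hX0] := (X_gt0, hX); move=> H; rewrite /V sub0r kern_far // modulusN; lra. Qed.

Let frac_le (x : R) : `|x| <= X -> (2 * X)^-1 <= X / (x ^+ 2 + X ^+ 2).
Proof.
have X0 := X_gt0; move=> xX; have x2 : x ^+ 2 <= X ^+ 2.
  by rewrite -(real_normK (num_real x)) lerXn2r // nnegrE ?ltW.
have X2 : 0 < X ^+ 2 by rewrite exprn_gt0.
have p : 0 < x ^+ 2 + X ^+ 2 by have := sqr_ge0 x; lra.
have -> : (2 * X)^-1 = X / (X ^+ 2 + X ^+ 2).
  by field; rewrite !gt_eqF ?addr_gt0.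
have p' : 0 < X ^+ 2 + X ^+ 2 by rewrite addr_gt0.
by rewrite ler_pM2l // lef_pV2 ?posrE // lerD2r.
Qed.

Lemma cIm_sum (I : Type) (r : seq I) (P : pred I) (F : I -> C) :
  cIm (\sum_(i <- r | P i) F i) = \sum_(i <- r | P i) cIm (F i).
Proof. by apply: (big_morph cIm) => // z w; rewrite cImD. Qed.

(** On the boundary every kernel value contributes to the imaginary part with the same sign and at
    least [(2 X)^-1]; the length [8 X] gives 4. *)
Lemma box_sum0_ge : 4 <= modulus (box_sum 0).
Proof.
apply: le_trans (le_Im_modulus _); apply: le_trans (ler_norm _).
have mX : `|X| = X by rewrite gtr0_norm.
have mNX : `|- X| = X by rewrite normrN gtr0_norm.
have topT a : (a <= N)%N -> (2 * X)^-1 <= cIm (V 0 a N).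
  move=> aN; rewrite V0E; last by apply: le_trans (le_Im_modulus _); rewrite /= bptN mX.
  by rewrite inv_neg /= bptN frac_le // bpt_le.
have topB a : (a <= N)%N -> cIm (V 0 a 0) <= - (2 * X)^-1.
  move=> aN; rewrite V0E; last by apply: le_trans (le_Im_modulus _); rewrite /= bpt0 mNX.
  by rewrite inv_neg /= bpt0 sqrrN mulNr lerN2 frac_le // bpt_le.
have sideR b : (b <= N)%N -> cRe (V 0 N b) <= - (2 * X)^-1.
  move=> bN; rewrite V0E; last by apply: le_trans (le_Re_modulus _); rewrite /= bptN mX.
  by rewrite inv_neg /= bptN addrC mulNr lerN2 frac_le // bpt_le.
have sideL b : (b <= N)%N -> (2 * X)^-1 <= cRe (V 0 0 b).
  move=> bN; rewrite V0E; last by apply: le_trans (le_Re_modulus _); rewrite /= bpt0 mNX.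
  by rewrite inv_neg /= bpt0 sqrrN opprK addrC frac_le // bpt_le.
have topI a : (a < N)%N -> 4 * (2 * X)^-1 <= cIm (top 0 a).
  move=> aN; rewrite /top !cImD !cImN.
  by have := (topT a (ltnW aN), topT _ aN, topB a (ltnW aN), topB _ aN); case=> [[[]]]; lra.
have sideI b : (b < N)%N -> 4 * (2 * X)^-1 <= cIm (- (iC * side 0 b)).
  move=> bN; rewrite cImN cImM cRe_iC cIm_iC mul0r mul1r add0r /side !cReD !cReN.
  by have := (sideR b (ltnW bN), sideR _ bN, sideL b (ltnW bN), sideL _ bN); case=> [[[]]]; lra.
rewrite box_sumE.
have -> : ofR h / 2 = ofR (h / 2) :> C by rewrite ofRM ofRV ofR_nat.
rewrite cImM cRe_ofR cIm_ofR mul0r addr0 [iC * _]mulr_sumr -sumrN -big_split /= cIm_sum.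
have -> : 4 = h / 2 * (N%:R * (8 * (2 * X)^-1)).
  have -> : h / 2 * (N%:R * (8 * (2 * X)^-1)) = h * N%:R * (4 * (2 * X)^-1) by field; rewrite gt_eqF.
  by rewrite hN; field; rewrite gt_eqF.
rewrite ler_pM2l ?divr_gt0 //.
apply: le_trans (_ : \sum_(i < N) 8 * (2 * X)^-1 <= _).
  by rewrite sumr_const card_ord -[leRHS]mulr_natl.
apply: ler_sum => a _; rewrite cImD.
by have := (topI a (ltn_ord a), sideI a (ltn_ord a)); case; lra.
Qed.

End BoxSum.

(** * Uniform limits of polynomials and inverse Joukowski maps *)

Section PolyApprox.
Context {R : realType}.
Local Notation C := (Cplx R).
Implicit Types (z w v : C) (K : set C) (f g u : C -> C).

Definition poly_approx K f := forall e : R, 0 < e ->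
  exists p : {poly C}, forall z, K z -> modulus (p.[z] - f z) <= e.

Lemma modulus_horner_le (p : {poly C}) (r : R) z : modulus z <= r ->
  modulus p.[z] <= \sum_(k < size p) modulus p`_k * r ^+ k.
Proof.
move=> zr; rewrite horner_coef; apply: le_trans (modulus_sum _ _ _) _.
apply: ler_sum => k _; rewrite modulusM modulusX ler_wpM2l //.
by apply: lerXn2r => //; rewrite nnegrE //; exact: le_trans (modulus_ge0 _) zr.
Qed.

Lemma poly_approx_lim K f : (forall e : R, 0 < e -> exists2 g, poly_approx K g &
  forall z, K z -> modulus (g z - f z) <= e) -> poly_approx K f.
Proof.
move=> H e e0; have e2 : 0 < e / 2 by rewrite divr_gt0.
have [g Hg gf] := H _ e2; have [p Hp] := Hg _ e2.
exists p => z Kz; apply: le_trans (modulus_dist _ _ (g z)) _.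
by rewrite (splitr e) lerD ?Hp ?gf.
Qed.

Lemma eq_poly_approx K f g : (forall z, K z -> f z = g z) -> poly_approx K f ->
  poly_approx K g.
Proof. by move=> fg Hf e /Hf[p Hp]; exists p => z Kz; rewrite -fg // Hp. Qed.

Lemma poly_approx_poly K (p : {poly C}) : poly_approx K (horner p).
Proof. by move=> e e0; exists p => z _; rewrite subrr modulus0 ltW. Qed.

Lemma poly_approx_cst K (c : C) : poly_approx K (fun=> c).
Proof.
by apply: eq_poly_approx (poly_approx_poly K c%:P) => z _; rewrite hornerC.
Qed.

Lemma poly_approx_id K : poly_approx K id.
Proof. by apply: eq_poly_approx (poly_approx_poly K 'X) => z _; rewrite hornerX. Qed.

Lemma poly_approx_add K f g : poly_approx K f -> poly_approx K g ->
  poly_approx K (fun z => f z + g z).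
Proof.
move=> Hf Hg e e0; have e2 : 0 < e / 2 by rewrite divr_gt0.
have [p Hp] := Hf _ e2; have [q Hq] := Hg _ e2; exists (p + q) => z Kz.
rewrite hornerD (_ : _ - _ = (p.[z] - f z) + (q.[z] - g z)); last by ring.
by apply: le_trans (modulusD _ _) _; rewrite (splitr e) lerD ?Hp ?Hq.
Qed.

Lemma poly_approx_sum K (I : Type) (r : seq I) (P : pred I) (F : I -> C -> C) :
  (forall i, P i -> poly_approx K (F i)) ->
  poly_approx K (fun z => \sum_(i <- r | P i) F i z).
Proof.
move=> H; elim: r => [|i r IH].
  by apply: eq_poly_approx (poly_approx_cst K 0) => z _; rewrite big_nil.
case Pi : (P i); last first.
  by apply: eq_poly_approx IH => z _; rewrite big_cons Pi.
apply: eq_poly_approx (poly_approx_add (H _ Pi) IH) => z _.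
by rewrite big_cons Pi.
Qed.

Section Bounded.
Variables (K : set C) (B : R).
Hypothesis K_bounded : forall z, K z -> modulus z <= B.

Lemma poly_approx_bounded f : poly_approx K f ->
  exists2 M : R, 0 < M & forall z, K z -> modulus (f z) <= M.
Proof.
move=> /(_ _ (@ltr01 R)) [p Hp].
pose S := \sum_(k < size p) modulus p`_k * `|B| ^+ k.
have S0 : 0 <= S by apply: sumr_ge0 => k _; rewrite mulr_ge0 // exprn_ge0.
exists (S + 1); first by lra.
move=> z Kz; have := Hp _ Kz; rewrite modulusBC => fp.
have pz : modulus p.[z] <= S.
  by apply: modulus_horner_le; apply: le_trans (K_bounded Kz) _; exact: ler_norm.
by apply: le_trans (modulus_le_add _ p.[z]) _; lra.
Qed.

Lemma poly_approx_mul f g : poly_approx K f -> poly_approx K g ->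
  poly_approx K (fun z => f z * g z).
Proof.
move=> Hf Hg; have [M M0 HM] := poly_approx_bounded Hf.
have [M' M'0 HM'] := poly_approx_bounded Hg.
move=> e e0; pose e1 := Num.min 1 (e / (2 * M' + 2)).
have e10 : 0 < e1 by rewrite lt_min ltr01 divr_gt0 //; lra.
have e11 : e1 <= 1 by rewrite ge_min lexx.
have e1M : e1 * (M' + 1) <= e / 2.
  have : e1 <= e / (2 * M' + 2) by rewrite ge_min lexx orbT.
  by rewrite ler_pdivlMr; lra.
have e20 : 0 < e / (2 * M) by rewrite divr_gt0 // mulr_gt0.
pose e2 := Num.min 1 (e / (2 * M)).
have e2pos : 0 < e2 by rewrite lt_min ltr01.
have e21 : e2 <= 1 by rewrite ge_min lexx.
have e2M : M * e2 <= e / 2.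
  have : e2 <= e / (2 * M) by rewrite ge_min lexx orbT.
  by rewrite ler_pdivlMr ?mulr_gt0 //; lra.
have [p Hp] := Hf _ e10; have [q Hq] := Hg _ e2pos.
exists (p * q) => z Kz; rewrite hornerM.
have -> : p.[z] * q.[z] - f z * g z = (p.[z] - f z) * q.[z] + f z * (q.[z] - g z).
  by ring.
apply: le_trans (modulusD _ _) _; rewrite (splitr e) !modulusM; apply: lerD.
  apply: le_trans e1M; apply: ler_pM => //; first exact: Hp.
  by have := modulus_le_add q.[z] (g z); have := Hq _ Kz; have := HM' _ Kz; lra.
by apply: le_trans e2M; apply: ler_pM => //; [exact: HM|exact: Hq].
Qed.

Lemma poly_approx_scale (c : C) f : poly_approx K f -> poly_approx K (fun z => c * f z).
Proof. by move=> Hf; apply: poly_approx_mul => //; exact: poly_approx_cst. Qed.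

Lemma poly_approx_geo_lim (psi : nat -> C -> C) f (M : R) :
  (forall n, poly_approx K (psi n)) ->
  (forall n z, K z -> modulus (psi n z - f z) <= M * 2^-1 ^+ n) -> poly_approx K f.
Proof.
move=> Hpsi Hf; apply: poly_approx_lim => e e0.
have : (fun n => M * 2^-1 ^+ n) @ \oo --> M * 0.
  apply: cvgM; first exact: cvg_cst.
  by apply: cvg_expr; rewrite gtr0_norm // invf_lt1 // ltr1n.
rewrite mulr0 => /cvgrPdist_lt /(_ _ e0) [N _ /(_ N (leqnn N))].
rewrite sub0r normrN => MN; exists (psi N) => // z Kz.
by apply: le_trans (Hf _ _ Kz) _; apply: le_trans (ler_norm _) _; exact: ltW.
Qed.

Lemma poly_approx_inv1B u : poly_approx K u ->
  (forall z, K z -> modulus (u z) <= 1 / 2) -> poly_approx K (fun z => (1 - u z)^-1).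
Proof.
(* Partial sums of the geometric series; the recursion multiplies the error by [u z], hence halves
   it at least. *)
move=> Hu u2; pose psi := fix psi n := if n is n'.+1 then fun z => 1 + u z * psi n' z
  else fun=> 0 : C.
apply: (@poly_approx_geo_lim psi _ 2) => [|n z Kz].
  elim=> [|n IH]; first exact: poly_approx_cst.
  by apply: poly_approx_add; [exact: poly_approx_cst|exact: poly_approx_mul].
have u1 : 1 / 2 <= modulus (1 - u z).
  by have := modulus_le_sub 1 (- u z); rewrite modulus1 modulusN; have := u2 _ Kz; lra.
have n0 : 1 - u z != 0 by rewrite -modulus_gt0; lra.
elim: n => [|n IH]; rewrite /=.
  rewrite sub0r modulusN modulusV expr0 mulr1 -[leRHS]invrK lef_pV2 ?posrE ?modulus_gt0 ?invr_gt0 //.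
  lra.
have -> : 1 + u z * psi n z - (1 - u z)^-1 = u z * (psi n z - (1 - u z)^-1).
  by field.
rewrite modulusM exprS (mulrCA 2); apply: ler_pM => //.
by have := u2 _ Kz; lra.
Qed.

(** Runge's pole pushing: [(z - w)^-1] is [(z - v)^-1] times the geometric series in
    [(w - v) / (z - v)]. *)
Lemma poly_approx_inv_step v w : (forall z, K z -> 0 < modulus (z - v)) ->
  (forall z, K z -> 2 * modulus (w - v) <= modulus (z - v)) ->
  poly_approx K (fun z => (z - v)^-1) -> poly_approx K (fun z => (z - w)^-1).
Proof.
move=> v0 wv Hv; have Hu : poly_approx K (fun z => (w - v) * (z - v)^-1).
  exact: poly_approx_scale.
have u2 z : K z -> modulus ((w - v) * (z - v)^-1) <= 1 / 2.
  move=> Kz; rewrite modulusM modulusV ler_pdivrMr ?v0 //.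
  by have := wv _ Kz; lra.
apply: eq_poly_approx (poly_approx_mul Hv (poly_approx_inv1B Hu u2)) => z Kz.
have n0 : z - v != 0 by rewrite -modulus_gt0 v0.
have n1 : z - w != 0.
  rewrite -modulus_gt0; have := wv _ Kz; have := v0 _ Kz.
  by have := modulus_dist z v w; lra.
by field; rewrite n0 n1.
Qed.

Lemma poly_approx_inv_far w : 2 * B < modulus w -> poly_approx K (fun z => (z - w)^-1).
Proof.
move=> Bw; have [K0|/set0P[z0 Kz0]] := eqVneq K set0.
  by move=> e e0; exists 0 => z; rewrite K0.
have B0 : 0 <= B by apply: le_trans (K_bounded Kz0).
have w0 : w != 0 by rewrite -modulus_gt0; lra.
have Hu : poly_approx K (fun z => w^-1 * z).
  by apply: poly_approx_scale; exact: poly_approx_id.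
have u2 z : K z -> modulus (w^-1 * z) <= 1 / 2.
  move=> Kz; rewrite modulusM modulusV mulrC ler_pdivrMr ?modulus_gt0 //.
  by have := K_bounded Kz; lra.
apply: eq_poly_approx (poly_approx_scale (- w^-1) (poly_approx_inv1B Hu u2)) => z Kz.
have n1 : z - w != 0.
  rewrite -modulus_gt0 modulusBC; have := modulus_le_sub w (- z).
  by rewrite modulusN; have := K_bounded Kz; lra.
by field; rewrite ?w0 ?n1 // -modulus_gt0 modulusBC modulus_gt0.
Qed.

(** The two candidates for [2 - y] add up to 2, so one has modulus at least 1. As [y * (2 - y) = a],
    this choice forces [|y| <= |a|]. *)
Lemma sqrt_near1 (a : C) : exists y : C, (1 - y) ^+ 2 = 1 - a /\ 1 <= modulus (2 - y).
Proof.
pose s : C := sqrtC (1 - a); have s2 : s ^+ 2 = 1 - a by rewrite sqrtCK.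
have [h|h] := lerP 1 (modulus (1 + s)).
  exists (1 - s); split; first by rewrite -s2; ring.
  by rewrite (_ : 2 - (1 - s) = 1 + s) //; ring.
exists (1 + s); split; first by rewrite -s2; ring.
have := modulus_le_sub 2 (- (1 + s)); rewrite modulusN (modulus_nat 2); lra.
Qed.

(* For [|a| <= 1 / 2] this is the branch near 1, a limit of polynomials in [a];
   [sqrtC] normalises the argument differently and is discontinuous there. *)
Definition sqrt_defect (a : C) : C := projT1 (cid (sqrt_near1 a)).

Lemma sqrt_defectE a : (1 - sqrt_defect a) ^+ 2 = 1 - a.
Proof. by rewrite /sqrt_defect; case: cid => y []. Qed.

Lemma sqrt_defect_eq (a y : C) : (1 - y) ^+ 2 = 1 - a -> y * (2 - y) = a.
Proof.
move=> E; have -> : y * (2 - y) = 1 - (1 - y) ^+ 2 by ring.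
by rewrite E; ring.
Qed.

Lemma sqrt_defect_bound (a y : C) : (1 - y) ^+ 2 = 1 - a -> 1 <= modulus (2 - y) ->
  modulus y <= modulus a.
Proof.
move=> /sqrt_defect_eq <- y2; rewrite modulusM ler_peMr //.
Qed.

Lemma sqrt_defect_le a : modulus (sqrt_defect a) <= modulus a.
Proof.
rewrite /sqrt_defect; case: cid => y /= [E y2]; exact: sqrt_defect_bound E y2.
Qed.

Lemma poly_approx_sqrt u : poly_approx K u ->
  (forall z, K z -> modulus (u z) <= 1 / 2) ->
  poly_approx K (fun z => 1 - sqrt_defect (u z)).
Proof.
(* The defect solves [y = (u + y ^ 2) / 2]. Iterating from 0 keeps [psi] in the disc of radius 1/2,
   where the error is halved at each step. *)
move=> Hu u2; pose psi := fix psi n := if n is n'.+1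
  then fun z => 2^-1 * (u z + psi n' z * psi n' z) else fun=> 0 : C.
have Hpsi n : poly_approx K (psi n).
  elim: n => [|n IH]; first exact: poly_approx_cst.
  by apply: poly_approx_scale; apply: poly_approx_add => //; exact: poly_approx_mul.
have psi2 n z : K z -> modulus (psi n z) <= 1 / 2.
  move=> Kz; elim: n => [|n IH] /=; first by rewrite modulus0; lra.
  rewrite modulusM modulusV modulus_nat.
  have := modulusD (u z) (psi n z * psi n z); rewrite modulusM.
  by have := u2 _ Kz; have := modulus_ge0 (psi n z); nra.
have Hy : poly_approx K (fun z => sqrt_defect (u z)).
  apply: (@poly_approx_geo_lim psi _ 1) => // n z Kz.
  have yu := le_trans (sqrt_defect_le _) (u2 _ Kz).
  elim: n => [|n IH] /=.
    by rewrite sub0r modulusN expr0 mulr1; lra.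
  have yE := sqrt_defect_eq (sqrt_defectE (u z)).
  have -> : 2^-1 * (u z + psi n z * psi n z) - sqrt_defect (u z) =
    2^-1 * ((psi n z - sqrt_defect (u z)) * (psi n z + sqrt_defect (u z))).
    by rewrite -{1}yE; field.
  rewrite !modulusM modulusV modulus_nat exprS (mulrCA 1) ler_pM2l ?invr_gt0 //.
  apply: le_trans IH; rewrite ler_piMr //.
  by apply: le_trans (modulusD _ _) _; have := psi2 n _ Kz; lra.
apply: eq_poly_approx (poly_approx_add (poly_approx_cst K 1) (poly_approx_scale (-1) Hy)).
by move=> z _; rewrite mulN1r.
Qed.

End Bounded.
End PolyApprox.

(** * Moving poles and square roots along chains off [K] *)

Section Reach.
Context {R : realType}.
Local Notation C := (Cplx R).
Implicit Types (z w v p : C) (K : set C) (f g u s : C -> C) (d : R).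

(* A step is at most half the distance to [K], so that the pole of [(z - v)^-1],
   and the branch of a square root, can be moved along it by a power series. *)
Inductive reach K d p : C -> Prop :=
| reach0 : reach K d p p
| reachS v w : reach K d p v -> modulus (w - v) <= d ->
    (forall z, K z -> 2 * modulus (w - v) <= modulus (z - v)) -> reach K d p w.

Definition reachable K := forall d p w, 0 < d -> ~ K p -> ~ K w -> reach K d p w.

Lemma connected_reachable K : compact K -> connected (~` K) -> reachable K.
Proof.
move=> cK conK d p w d0 Kp; move: w.
pose B : set C := [set w | ~ K w /\ reach K d p w].
have oB : open B.
  apply/open_modulusP => w [Kw rw]; have [e e0 He] := compact_far_point cK Kw.
  have e2 : 0 < e / 2 by rewrite divr_gt0.
  exists (Num.min d (e / 2)); first by rewrite lt_min d0.
  move=> u; rewrite lt_min => /andP[ud ue].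
  split; first by move=> /He; rewrite modulusBC; have := modulusBC u w; lra.
  apply: reachS rw _ _; first exact: ltW.
  by move=> z /He; lra.
have oB' : open [set w | ~ K w /\ ~ reach K d p w].
  apply/open_modulusP => w [Kw rw]; have [e e0 He] := compact_far_point cK Kw.
  (* A quarter instead of a half: the step now starts at [u], whose distance to [K] is only known to
     exceed [3 e / 4]. *)
  have e2 : 0 < e / 4 by rewrite divr_gt0.
  exists (Num.min d (e / 4)); first by rewrite lt_min d0.
  move=> u; rewrite lt_min => /andP[ud ue]; split.
    by move=> /He; have := modulusBC u w; lra.
  move=> ru; apply: rw; apply: reachS ru _ _; first by rewrite modulusBC ltW.
  move=> z /He; have := modulus_dist z w u; rewrite (modulusBC w u); lra.
have BE : B = ~` K.
  apply: conK; first by exists p; split => //; exact: reach0.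
    by exists B => //; apply/seteqP; split => [w [? ?]|w []].
  exists (~` [set w | ~ K w /\ ~ reach K d p w]); first by rewrite closedC.
  apply/seteqP; split => w /=.
    by move=> [Kw rw]; split => // -[].
  move=> [Kw H]; split => //.
  by have [//|rw] := pselect (reach K d p w); exfalso; apply: H.
by move=> w Kw; have [] : B w by rewrite BE.
Qed.

Variables (K : set C) (B : R).
Hypothesis K_bounded : forall z, K z -> modulus z <= B.
Hypothesis K_reach : reachable K.

Lemma not_K_pos v z : ~ K v -> K z -> 0 < modulus (z - v).
Proof.
move=> Kv Kz; rewrite modulus_gt0 subr_eq0; apply/eqP => zv.
by apply: Kv; rewrite -zv.
Qed.

Lemma reach_notK d p w : ~ K p -> reach K d p w -> ~ K w.
Proof.
move=> Kp; elim=> // v {}w _ Kv _ H Kw.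
by have := H _ Kw; have := not_K_pos Kv Kw; lra.
Qed.

Lemma exists_far : exists p : C, 2 * `|B| + 1 <= modulus p /\ ~ K p.
Proof.
have r0 : 0 <= 2 * `|B| + 1 by rewrite addr_ge0 // mulr_ge0.
exists (ofR (2 * `|B| + 1)); rewrite modulus_ofR (ger0_norm r0); split => //.
move=> /K_bounded; rewrite modulus_ofR (ger0_norm r0).
by have := ler_norm B; have := normr_ge0 B; lra.
Qed.

Lemma poly_approx_pole w : ~ K w -> poly_approx K (fun z => (z - w)^-1).
Proof.
move=> Kw; have [p [pB Kp]] := exists_far.
elim: (K_reach ltr01 Kp Kw) => {w Kw} [|v w Kv IH _ H].
  apply: (poly_approx_inv_far K_bounded).
  by have := ler_norm B; lra.
apply: (poly_approx_inv_step K_bounded _ _ IH) => // z Kz.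
exact: not_K_pos (reach_notK Kp Kv) Kz.
Qed.

(** A branch of the square root of [(z - v) / (z - p)] on [K]. The last clause selects the branch
    near 1 far from [p], with a bound that must not deteriorate along a chain. *)
Let linked d p v := exists s, [/\ poly_approx K s,
  (forall z, K z -> s z ^+ 2 = (z - v) / (z - p)) &
  (forall z, K z -> 6 * d <= modulus (z - p) -> modulus (1 - s z) <= 1 / 3)].

Let linked_step d p v w : 0 < d -> ~ K p -> ~ K v ->
  modulus (v - p) <= d -> modulus (w - v) <= d ->
  (forall z, K z -> 2 * modulus (w - v) <= modulus (z - v)) ->
  linked d p v -> linked d p w.
Proof.
move=> d0 Kp Kv vp wv H [s [Hs s2 s1]].
have Hu : poly_approx K (fun z => (w - v) * (z - v)^-1).
  by apply: (poly_approx_scale K_bounded); exact: poly_approx_pole.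
have u2 z : K z -> modulus ((w - v) * (z - v)^-1) <= 1 / 2.
  move=> Kz; rewrite modulusM modulusV ler_pdivrMr ?not_K_pos //.
  by have := H _ Kz; lra.
exists (fun z => s z * (1 - sqrt_defect ((w - v) * (z - v)^-1))).
have sq z : K z -> (s z * (1 - sqrt_defect ((w - v) * (z - v)^-1))) ^+ 2 =
    (z - w) / (z - p).
  move=> Kz; rewrite exprMn s2 // sqrt_defectE; field.
  by rewrite -!modulus_gt0 !not_K_pos.
split => //.
  by apply: (poly_approx_mul K_bounded) => //; apply: (poly_approx_sqrt K_bounded).
move=> z Kz zp; have E := sq z Kz.
set y := sqrt_defect _ in E *; set t := s z in E *.
have y5 : modulus y <= 1 / 5.
  apply: le_trans (sqrt_defect_le _) _.
  rewrite modulusM modulusV ler_pdivrMr ?not_K_pos //.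
  by have := modulus_dist z p v; lra.
have t3 : modulus (1 - t) <= 1 / 3 := s1 z Kz zp.
(* Multiplying the factors would weaken the bound 1/3 at each step. The estimate 3/5 only shows that
   [x] is the right root, [|2 - x| >= 1]; then [sqrt_defect_bound] gives
   [|x| <= |w - p| / |z - p| <= 2 d / (6 d)] afresh. *)
pose x := 1 - t * (1 - y).
have x1 : modulus x <= 3 / 5.
  have -> : x = (1 - t) + y - (1 - t) * y by rewrite /x; ring.
  apply: le_trans (modulusB _ _) _; rewrite modulusM.
  have := modulusD (1 - t) y.
  by have := modulus_ge0 y; have := modulus_ge0 (1 - t); nra.
have x2 : 1 <= modulus (2 - x).
  by have := modulus_le_sub 2 (- x); rewrite modulusN (modulus_nat 2); lra.
have zp0 : z - p != 0 by rewrite -modulus_gt0 not_K_pos.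
have : (1 - x) ^+ 2 = 1 - (w - p) / (z - p).
  by rewrite (_ : 1 - x = t * (1 - y)) ?E /x; [field|ring].
move=> /sqrt_defect_bound /(_ x2) x3; apply: le_trans x3 _.
rewrite modulusM modulusV ler_pdivrMr ?not_K_pos //.
by have := modulus_dist w p v; lra.
Qed.

(** Follow a chain of steps of length at most [d] from [p] to a remote point and stop when it first
    leaves the disc of radius [d] about [p]. *)
Let exists_linked d p : 0 < d -> ~ K p -> exists b, [/\ linked d p b,
  d <= modulus (b - p), modulus (b - p) <= 2 * d & ~ K b].
Proof.
move=> d0 Kp.
have [w [wB Kw]] : exists w, d <= modulus (w - p) /\ ~ K w.
  pose r := `|B| + modulus p + d + 1.
  have r0 : 0 < r by rewrite /r; have := modulus_ge0 p; have := normr_ge0 B; lra.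
  exists (ofR r); split.
    have := modulus_le_sub (ofR r) (- p); rewrite modulusN modulus_ofR gtr0_norm //.
    by rewrite {1}/r; have := normr_ge0 B; lra.
  move=> /K_bounded; rewrite modulus_ofR gtr0_norm // /r.
  by have := modulus_ge0 p; have := ler_norm B; lra.
suff : (linked d p w /\ modulus (w - p) < d) \/ exists b, [/\ linked d p b,
  d <= modulus (b - p), modulus (b - p) <= 2 * d & ~ K b].
  by case=> // -[_]; lra.
elim: (K_reach d0 Kp Kw) => {w wB Kw} [|v w Kv IH wd H].
  left; split; last by rewrite subrr modulus0.
  exists (fun=> 1); split; first exact: poly_approx_cst.
    move=> z Kz; rewrite expr1n divff //.
    by rewrite -modulus_gt0 not_K_pos.
  by move=> z Kz _; rewrite subrr modulus0 divr_ge0.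
case: IH => [[lv vd]|]; last by right.
have Kv' := reach_notK Kp Kv.
have lw : linked d p w by apply: linked_step lv => //; exact: ltW.
have [wp|wp] := ltrP (modulus (w - p)) d; first by left.
right; exists w; split => //; first by have := modulus_dist w p v; lra.
by apply: (reach_notK Kp); exact: reachS Kv wd H.
Qed.

(* [G] inverts the Joukowski map [G |-> G^-1 + c * G]: the two square roots of
   [(z - p) * (z - b)] are separated by a chain from [p] to [b] that avoids
   [K], and this makes the bound on [G] independent of [K]. *)
Lemma joukowski d p : 0 < d -> ~ K p -> exists (m c : C) (G : C -> C),
  [/\ modulus (m - p) <= d, modulus c <= d ^+ 2 / 4, poly_approx K G &
   forall z, K z -> [/\ G z != 0, z - m = (G z)^-1 + c * G z &
     modulus (G z) <= 840 / (modulus (z - p) + d)]].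
Proof.
move=> d0 Kp; have [b [[s [Hs s2 s1]] bd bd2 Kb]] := exists_linked d0 Kp.
pose m := (p + b) / 2; pose s0 := (b - p) / 2.
have s0E : modulus s0 = modulus (b - p) / 2.
  by rewrite /s0 modulusM modulusV modulus_nat.
have s0n0 : s0 != 0 by rewrite -modulus_gt0 s0E; lra.
(* [S] is a square root of [(z - p) * (z - b) = (z - m) ^ 2 - s0 ^ 2]. Thus [G] has two forms,
   [2 / (x + t)] and a multiple of [x - t]: the first is bounded far from [p], the second near
   [p]. *)
pose S z := (z - p) * s z.
have S2 z : K z -> S z ^+ 2 = (z - m) ^+ 2 - s0 ^+ 2.
  move=> Kz; rewrite /S exprMn s2 // /m /s0; field.
  by rewrite -modulus_gt0 not_K_pos.
pose G z := (2 / s0 ^+ 2) * ((z - m) - S z).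
exists m, (s0 ^+ 2 / 4), G; split.
- by rewrite /m (_ : _ - p = s0) ?s0E; [lra|rewrite /s0; field].
- rewrite modulusM modulusV modulus_nat modulusX ler_pM2r ?invr_gt0 //.
  by rewrite lerXn2r ?nnegrE ?(ltW d0) // s0E; lra.
- apply: (poly_approx_scale K_bounded); apply: poly_approx_add.
    by apply: poly_approx_add; [exact: poly_approx_id|exact: poly_approx_cst].
  apply: eq_poly_approx (poly_approx_scale K_bounded (-1)
    (poly_approx_mul K_bounded (poly_approx_add (poly_approx_id K)
      (poly_approx_cst K (- p))) Hs)) => z _.
  by rewrite /S mulN1r.
move=> z Kz; have E := S2 z Kz.
set x := z - m in E *; set t := S z in E *.
have prod : (x - t) * (x + t) = s0 ^+ 2.
  have -> : (x - t) * (x + t) = x ^+ 2 - t ^+ 2 by ring.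
  by rewrite E; ring.
have n1 : x - t != 0.
  by apply/eqP => xt; move: prod; rewrite xt mul0r => /esym/eqP; rewrite sqrf_eq0 (negbTE s0n0).
have n2 : x + t != 0.
  by apply/eqP => xt; move: prod; rewrite xt mulr0 => /esym/eqP; rewrite sqrf_eq0 (negbTE s0n0).
have GE : G z = 2 / (x + t).
  by rewrite /G -/x -/t -prod; field; rewrite n1 n2.
have GE' : G z = 2 / s0 ^+ 2 * (x - t) by [].
split.
- by rewrite GE mulf_neq0 // ?invr_eq0 // -modulus_gt0 (modulus_nat 2).
- rewrite {1}GE GE'; field.
  by rewrite s0n0 n2.
set D := modulus (z - p).
have D0 : 0 <= D := modulus_ge0 _.
have Dd : 0 < D + d by lra.
have xm : modulus x <= D + modulus s0.
  have -> : x = (z - p) - s0 by rewrite /x /m /s0; field.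
  exact: modulusB.
have [far|near] := lerP (6 * d) D.
  have y3 := s1 z Kz far.
  have xt : x + t = (z - p) * (2 - (1 - s z)) - s0.
    by rewrite /x /t /S /m /s0; field.
  have : D * (5 / 3) - modulus s0 <= modulus (x + t).
    rewrite xt; apply: le_trans (modulus_le_sub _ _); rewrite modulusN lerD2r modulusM.
    apply: ler_wpM2l => //.
    by have := modulus_le_sub 2 (- (1 - s z)); rewrite modulusN (modulus_nat 2); lra.
  move=> xt1; have xt0 : 0 < modulus (x + t) by rewrite modulus_gt0.
  rewrite GE modulusM modulusV (modulus_nat 2) ler_pdivlMr // mulrAC ler_pdivrMr //.
  lra.
have s0d : modulus s0 <= d by lra.
have x7 : modulus x <= 7 * d by lra.
have t8 : modulus t <= 8 * d.
  have : modulus t ^+ 2 <= (8 * d) ^+ 2.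
    rewrite -modulusX E; apply: le_trans (modulusB _ _) _; rewrite !modulusX.
    by have := modulus_ge0 x; have := modulus_ge0 s0; nra.
  by rewrite ler_pXn2r ?nnegrE // mulr_ge0 // ltW.
(* The constant is [840 = 8 * 15 * 7], from [2 / |s0| ^ 2 <= 8 / d ^ 2], [|x - t| <= 15 d] and
   [D + d <= 7 d]. *)
have xt15 : modulus (x - t) <= 15 * d by have := modulusB x t; lra.
have s0d2 : d / 2 <= modulus s0 by lra.
rewrite GE' !modulusM modulusV modulusX (modulus_nat 2) ler_pdivlMr //.
have s00 : 0 < modulus s0 ^+ 2 by rewrite exprn_gt0 // modulus_gt0.
rewrite mulrAC -!mulrA mulrCA ler_pdivrMl //.
have : modulus (x - t) * (D + d) <= 15 * d * (7 * d) by apply: ler_pM => //; lra.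
by nra.
Qed.

End Reach.

(** * Replacing a pole by a limit of polynomials *)

Section ReplacePole.
Context {R : realType}.
Local Notation C := (Cplx R).
Variables (K : set C) (B : R).
Hypothesis K_bounded : forall z, K z -> modulus z <= B.
Hypothesis K_reach : reachable K.

(* [Q = G + t G ^ 2] where [t] is the difference of [zeta] and the [m] of [joukowski]. *)
Lemma replace_pole : exists2 k : R, 0 < k &
  forall (d : R) (p zeta : C), 0 < d -> ~ K p -> modulus (zeta - p) <= 5 * d ->
  exists2 Q : C -> C, poly_approx K Q &
  forall z, K z -> modulus (Q z) <= k / d /\
    (z != zeta -> modulus (Q z - (z - zeta)^-1) <=
      k * d ^+ 2 / (modulus (z - zeta) * (modulus (z - zeta) + d) ^+ 2)).
Proof.
have [k k1 Hk] : exists2 k : R, 1 <= k & forall (d : R) (p : C), 0 < d -> ~ K p ->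
  exists (m c : C) (G : C -> C),
  [/\ modulus (m - p) <= d, modulus c <= d ^+ 2 / 4, poly_approx K G &
   forall z, K z -> [/\ G z != 0, z - m = (G z)^-1 + c * G z &
     modulus (G z) <= k / (modulus (z - p) + d)]].
  by exists 840; [lra|move=> d p; exact: (joukowski K_bounded K_reach)].
have k0 : 0 < k by lra.
have k20 : 0 < k ^+ 2 by rewrite exprn_gt0.
exists (k ^+ 2 * 36 * (37 + 2 * k)); first by rewrite !mulr_gt0 // addr_gt0 // mulr_gt0.
move=> d p zeta d0 Kp zp; have [m [c [G [mp cd HG Gz]]]] := Hk _ _ d0 Kp.
pose t := zeta - m.
have t6 : modulus t <= 6 * d.
  by rewrite /t; have := modulus_dist zeta m p; rewrite (modulusBC p m); lra.
exists (fun z => G z + t * (G z * G z)).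
  apply: poly_approx_add => //; apply: (poly_approx_scale K_bounded).
  exact: (poly_approx_mul K_bounded).
move=> z Kz; have [G0 zm Gle] := Gz _ Kz.
set g := G z in G0 zm Gle *; set D := modulus (z - p) in Gle *.
have D0 : 0 <= D := modulus_ge0 _.
have Dd : 0 < D + d by lra.
have g0 : 0 <= modulus g by [].
have gd : modulus g * (D + d) <= k by rewrite -ler_pdivlMr.
have gd1 : modulus g * d <= k by nra.
split.
  apply: le_trans (modulusD _ _) _; rewrite !modulusM ler_pdivlMr // mulrDl.
  have : modulus t * (modulus g * modulus g) * d <= 6 * (k * k).
    have -> : modulus t * (modulus g * modulus g) * d = modulus t * modulus g * (modulus g * d).
      by ring.
    have -> : 6 * (k * k) = 6 * k * k by ring.
    apply: ler_pM => //; first by rewrite mulr_ge0.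
      by rewrite mulr_ge0 // ltW.
    apply: le_trans (_ : 6 * d * modulus g <= _); first by rewrite ler_wpM2r.
    by lra.
  have := mulr_gt0 k20 k0; nra.
move=> zz; have zz0 : z - zeta != 0 by rewrite subr_eq0.
have E : z - zeta = g^-1 + c * g - t by rewrite -zm /t; ring.
(* In [(g + t g ^ 2) (g^-1 + c g - t) - 1] the constant and the terms [t g] cancel, so the error
   carries a factor [g ^ 2]; together with [(z - zeta)^-1] this is cubic decay. *)
have -> : g + t * (g * g) - (z - zeta)^-1 =
    (z - zeta)^-1 * (g ^+ 2 * (c - t ^+ 2 + t * c * g)).
  have : (g + t * (g * g)) * (z - zeta) - 1 = g ^+ 2 * (c - t ^+ 2 + t * c * g).
    by rewrite E; field.
  by move=> <-; field.
rewrite modulusM modulusM modulusV modulusX.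
set r := modulus (z - zeta).
have r0 : 0 < r by rewrite modulus_gt0.
have rD : r + d <= 6 * (D + d).
  by have := modulus_dist z zeta p; rewrite (modulusBC p) -/r -/D; lra.
rewrite invfM [leRHS]mulrCA ler_pM2l ?invr_gt0 // ler_pdivlMr ?exprn_gt0 //; last by lra.
have m1 : modulus (c - t ^+ 2 + t * c * g) <= d ^+ 2 * (37 + 2 * k).
  apply: le_trans (modulusD _ _) _; rewrite !modulusM.
  have := modulusB c (t ^+ 2); rewrite modulusX => h1.
  have h2 : modulus t ^+ 2 <= (6 * d) ^+ 2.
    by rewrite lerXn2r ?nnegrE // mulr_ge0 // ltW.
  have h3 : modulus t * modulus c * modulus g <= 6 * d * (d ^+ 2 / 4) * modulus g.
    by rewrite ler_wpM2r // ler_pM.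
  have h4 : 6 * d * (d ^+ 2 / 4) * modulus g <= d ^+ 2 * (6 / 4 * k).
    have -> : 6 * d * (d ^+ 2 / 4) * modulus g = d ^+ 2 * (6 / 4 * (modulus g * d)) by field.
    by rewrite ler_pM2l ?exprn_gt0 // ler_pM2l.
  by have := sqr_ge0 d; have := mulr_ge0 (sqr_ge0 d) (ltW k0); lra.
have m2 : modulus g ^+ 2 * (r + d) ^+ 2 <= k ^+ 2 * 36.
  apply: le_trans (_ : (modulus g * (6 * (D + d))) ^+ 2 <= _).
    rewrite -exprMn lerXn2r ?nnegrE ?mulr_ge0 //; try lra.
    by rewrite ler_wpM2l.
  have -> : k ^+ 2 * 36 = (k * 6) ^+ 2 by ring.
  rewrite lerXn2r ?nnegrE ?mulr_ge0 //; try lra.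
rewrite mulrAC.
have -> : k ^+ 2 * 36 * (37 + 2 * k) * d ^+ 2 = k ^+ 2 * 36 * (d ^+ 2 * (37 + 2 * k)) by ring.
by apply: ler_pM => //; rewrite mulr_ge0 // exprn_ge0 //; lra.
Qed.

End ReplacePole.

(** * Mergelyan's theorem *)

Section Goursat.
Context {R : realType}.
Local Notation C := (Cplx R).
Implicit Types (z w q l : C) (h L e : R) (F G : C -> C) (M : nat).

(* A discrete contour integral: by [box_intE] only the values of [F] on the
   boundary of the box matter. *)
Definition box_int F q h M : C :=
  \sum_(a < M) \sum_(b < M) cell_sum F (grid q h a b) h.

Lemma box_intE F q h M : box_int F q h M = ofR h / 2 *
  (\sum_(a < M) (F (grid q h a 0) + F (grid q h a.+1 0)
                 - (F (grid q h a M) + F (grid q h a.+1 M)))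
   + iC * \sum_(b < M) (F (grid q h M b) + F (grid q h M b.+1)
                 - (F (grid q h 0 b) + F (grid q h 0 b.+1)))).
Proof.
pose u a b := F (grid q h a b).
pose W1 a b := u a b + u a.+1 b; pose W2 a b := u a b + u a b.+1.
have E a b : cell_sum F (grid q h a b) h =
    ofR h / 2 * (- (W1 a b.+1 - W1 a b) + iC * (W2 a.+1 b - W2 a b)).
  rewrite /cell_sum -grid_S -gridS_ (_ : _ + ofR h * (1 + iC) = grid q h a.+1 b.+1).
    by rewrite /W1 /W2 /u; ring.
  by rewrite !(grid_S, gridS_); ring.
rewrite /box_int; under eq_bigr do under eq_bigr do rewrite E.
under eq_bigr do rewrite -mulr_sumr.
rewrite -mulr_sumr; congr (_ * _).
under eq_bigr do rewrite big_split /= sumrN -mulr_sumr telescope_ord.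
rewrite big_split /= -mulr_sumr; congr (_ + _ * _).
  by apply: eq_bigr => a _; rewrite opprB.
rewrite exchange_big; apply: eq_bigr => b _ /=.
exact: (telescope_ord (W2^~ b)).
Qed.

(** The boundary weights add up to 0, so [l] can be subtracted: the bound is the perimeter times the
    oscillation. *)
Lemma box_int_le F q h M l e : 0 <= h ->
  (forall a b, (a <= M)%N -> (b <= M)%N -> modulus (F (grid q h a b) - l) <= e) ->
  modulus (box_int F q h M) <= 4 * (h * M%:R) * e.
Proof.
move=> h0 H; rewrite box_intE !modulusM modulusV modulus_ofR modulus_nat ger0_norm //.
have four (x y u v : C) : modulus (x - l) <= e -> modulus (y - l) <= e ->
    modulus (u - l) <= e -> modulus (v - l) <= e ->
    modulus (x + y - (u + v)) <= 4 * e.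
  move=> ? ? ? ?.
  have -> : x + y - (u + v) = (x - l) + (y - l) - (u - l) - (v - l) by ring.
  apply: le_trans (modulusB _ _) _.
  have := modulusB (x - l + (y - l)) (u - l); have := modulusD (x - l) (y - l).
  by lra.
have sumD (f : nat -> C) : (forall a, (a < M)%N -> modulus (f a) <= 4 * e) ->
    modulus (\sum_(a < M) f a) <= M%:R * (4 * e).
  move=> Hf; apply: le_trans (modulus_sum _ _ _) _.
  apply: le_trans (ler_sum _ (fun (a : 'I_M) _ => Hf a (ltn_ord a))) _.
  by rewrite sumr_const card_ord -[leLHS]mulr_natl.
set S := \sum_(a < M) _; set T := \sum_(b < M) _.
have HS : modulus S <= M%:R * (4 * e).
  apply: (sumD (fun a => F (grid q h a 0) + F (grid q h a.+1 0)
                 - (F (grid q h a M) + F (grid q h a.+1 M)))) => a aM.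
  by apply: four; apply: H => //; exact: ltnW.
have HT : modulus T <= M%:R * (4 * e).
  apply: (sumD (fun b => F (grid q h M b) + F (grid q h M b.+1)
                 - (F (grid q h 0 b) + F (grid q h 0 b.+1)))) => a aM.
  by apply: four; apply: H => //; exact: ltnW.
have ST : modulus (S + iC * T) <= M%:R * (8 * e).
  by apply: le_trans (modulusD _ _) _; rewrite modulusM modulus_iC mul1r; lra.
have -> : 4 * (h * M%:R) * e = h * 2^-1 * (M%:R * (8 * e)) by field.
by rewrite ler_wpM2l // mulr_ge0 // invr_ge0.
Qed.

Lemma cell_sumB F G q h : cell_sum (fun w => F w - G w) q h =
  cell_sum F q h - cell_sum G q h.
Proof. by rewrite /cell_sum; ring. Qed.

Lemma box_intB F G q h M : box_int (fun w => F w - G w) q h M =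
  box_int F q h M - box_int G q h M.
Proof.
rewrite /box_int -sumrB; apply: eq_bigr => a _; rewrite -sumrB.
by apply: eq_bigr => b _; rewrite cell_sumB.
Qed.

Lemma box_int_affine (x y : C) q h M : box_int (fun w => x + y * w) q h M = 0.
Proof.
rewrite /box_int big1 // => a _; rewrite big1 // => b _; rewrite /cell_sum.
set g := grid q h a b.
have -> : (1 - iC) * (x + y * g - (x + y * (g + ofR h * (1 + iC)))) +
   (1 + iC) * (x + y * (g + ofR h) - (x + y * (g + ofR h * iC))) = 0.
  have -> : (1 - iC) * (x + y * g - (x + y * (g + ofR h * (1 + iC)))) +
   (1 + iC) * (x + y * (g + ofR h) - (x + y * (g + ofR h * iC))) =
   (1 - iC ^+ 2) * y * ofR h - (1 - iC ^+ 2) * y * ofR h by ring.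
  by rewrite subrr.
by rewrite mulr0.
Qed.

Lemma box_int_shift F q q' h M :
  box_int F q h M = box_int (fun w => F (w + (q - q'))) q' h M.
Proof.
apply: eq_bigr => a _; apply: eq_bigr => b _.
rewrite /cell_sum.
have E x : grid q' h a b + x + (q - q') = grid q h a b + x by rewrite /grid; ring.
by rewrite !E -[grid q' _ _ _]addr0 E addr0.
Qed.

Lemma box_int_quarters F q h M : box_int F q h (M + M) =
  box_int F (grid q h 0 0) h M + box_int F (grid q h 0 M) h M
  + (box_int F (grid q h M 0) h M + box_int F (grid q h M M) h M).
Proof.
rewrite /box_int big_split_ord /=; congr (_ + _).
  rewrite -big_split; apply: eq_bigr => a _ /=.
  rewrite big_split_ord /=; congr (_ + _); apply: eq_bigr => b _;
  by rewrite grid_add.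
rewrite -big_split; apply: eq_bigr => a _ /=.
rewrite big_split_ord /=; congr (_ + _); apply: eq_bigr => b _;
by rewrite grid_add.
Qed.

Lemma grid_dist q h M a b : 0 <= h -> (a <= M)%N -> (b <= M)%N ->
  modulus (grid q h a b - q) <= 2 * (h * M%:R).
Proof.
move=> h0 aM bM; rewrite /grid addrC addKr modulusM modulus_ofR ger0_norm //.
rewrite mulrCA ler_wpM2l //; apply: le_trans (modulusD _ _) _.
rewrite modulusM modulus_iC mul1r !modulus_nat.
have : a%:R <= M%:R :> R by rewrite ler_nat.
have : b%:R <= M%:R :> R by rewrite ler_nat.
lra.
Qed.

Let small F e q L := exists n0, forall n, (n0 <= n)%N ->
  modulus (box_int F q (L / 2 ^+ n) (2 ^ n)) <= e * L ^+ 2.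

Let mesh L n : L / 2 ^+ n * (2 ^ n)%:R = L.
Proof. by rewrite natrX divfK // expf_neq0. Qed.

(** The four quarters use the same mesh with one level less, and [4 (L / 2) ^ 2 = L ^ 2]; so if all
    quarters were small, the square would be. *)
Lemma small_split F e q L : 0 < L -> ~ small F e q L ->
  exists2 q', ~ small F e q' (L / 2) & modulus (q' - q) <= L.
Proof.
move=> L0 nS; apply: contrapT => nE.
have L2 : 0 <= L / 2 by rewrite divr_ge0 // ltW.
have good q' : modulus (q' - q) <= L -> small F e q' (L / 2).
  by move=> q'L; apply: contrapT => nS'; apply: nE; exists q'.
have dist a b : (a <= 1)%N -> (b <= 1)%N -> modulus (grid q (L / 2) a b - q) <= L.
  by move=> a1 b1; have := grid_dist q L2 a1 b1; rewrite mulr1 (_ : 2 * (L / 2) = L) //; field.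
have [n1 H1] := good _ (dist 0 0 isT isT).
have [n2 H2] := good _ (dist 0 1 isT isT).
have [n3 H3] := good _ (dist 1 0 isT isT).
have [n4 H4] := good _ (dist 1 1 isT isT).
apply: nS; exists (n1 + n2 + n3 + n4).+1 => -[//|n]; rewrite ltnS => nn.
have E : L / 2 ^+ n.+1 = L / 2 / 2 ^+ n by rewrite exprS invfM mulrA.
have gE a b : grid q (L / 2 / 2 ^+ n) (a * 2 ^ n) (b * 2 ^ n) = grid q (L / 2) a b.
  rewrite /grid !natrM; congr (_ + _).
  have -> : ofR (L / 2) = ofR (L / 2 / 2 ^+ n) * (2 ^ n)%:R :> C.
    by rewrite -ofR_nat -ofRM mesh.
  ring.
have g00 := gE 0 0; have g01 := gE 0 1; have g10 := gE 1 0; have g11 := gE 1 1.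
rewrite !(mul0n, mul1n) in g00 g01 g10 g11.
rewrite expnS mul2n -addnn E box_int_quarters g00 g01 g10 g11.
have -> : e * L ^+ 2 = e * (L / 2) ^+ 2 + e * (L / 2) ^+ 2 +
  (e * (L / 2) ^+ 2 + e * (L / 2) ^+ 2) by field.
apply: le_trans (modulusD _ _) _; apply: lerD;
  apply: le_trans (modulusD _ _) _; apply: lerD;
  [apply: H1|apply: H2|apply: H3|apply: H4]; lia.
Qed.

Lemma goursat F q L : 0 < L ->
  (forall z, modulus (z - q) <= 3 * L -> exists l, cdiff_at F z l) ->
  forall e, 0 < e -> exists n0, forall n, (n0 <= n)%N ->
    modulus (box_int F q (L / 2 ^+ n) (2 ^ n)) <= e * L ^+ 2.
Proof.
move=> L0 HF e e0; apply: contrapT => nS.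
have Lj j : 0 < L / 2 ^+ j by rewrite divr_gt0 // exprn_gt0.
have LS j : L / 2 ^+ j.+1 = L / 2 ^+ j / 2.
  by rewrite exprS invfM mulrCA mulrC.
have /choice[f Hf] : forall x : nat * C, exists y : C,
    ~ small F e x.2 (L / 2 ^+ x.1) ->
    ~ small F e y (L / 2 ^+ x.1.+1) /\ modulus (y - x.2) <= L / 2 ^+ x.1.
  move=> [j z] /=; have [s|/(small_split (Lj j))[q' ? ?]] := pselect (small F e z (L / 2 ^+ j)).
    by exists z.
  by exists q' => _; rewrite LS.
pose qs := fix qs n := if n is n'.+1 then f (n', qs n') else q.
have qs_bad j : ~ small F e (qs j) (L / 2 ^+ j).
  elim: j => [|j IH] /=; first by rewrite expr0 divr1.
  by have [] := Hf (j, qs j) IH.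
have qs_step j : modulus (qs j.+1 - qs j) <= L / 2 ^+ j.
  by have [] := Hf (j, qs j) (qs_bad j).
have qs_dist j k : modulus (qs (j + k)%N - qs j) <= 2 * (L / 2 ^+ j) - 2 * (L / 2 ^+ (j + k)%N).
  elim: k => [|k IH]; first by rewrite addn0 (subrr (qs j)) modulus0 subrr.
  apply: le_trans (modulus_dist _ _ (qs (j + k)%N)) _.
  by have := qs_step (j + k)%N; rewrite addnS LS; lra.
have [l Hl] : exists l, forall n, modulus (qs n - l) <= 2 * (L / 2 ^+ n).
  apply: cplx_cauchy_cvg.
    have -> : (fun n => 2 * (L / 2 ^+ n)) = (fun n => (2 * L) * (2^-1 ^+ n)).
      by apply/funext => n; rewrite exprVn mulrA.
    rewrite -(mulr0 (2 * L)); apply: cvgM; first exact: cvg_cst.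
    by apply: cvg_expr; rewrite gtr0_norm // invf_lt1 // ltr1n.
  move=> n m nm; rewrite -(subnKC nm); apply: le_trans (qs_dist _ _) _.
  by have := Lj (n + (m - n))%N; lra.
have [|dl Hdl] := HF l.
  by rewrite modulusBC; have := Hl 0; rewrite /= expr0 divr1; lra.
(* The affine part of [F] at [l] sums to 0 over a box. For side [s] the remainder is at most
   [(e / 16) (4 s)], and the perimeter [4 s] turns this into [e s ^ 2]. *)
have e16 : 0 < e / 16 by rewrite divr_gt0.
have [d d0 Hd] := Hdl _ e16.
have [j jd] : exists j, 4 * (L / 2 ^+ j) < d.
  have : (fun n => (4 * L) * 2^-1 ^+ n) @ \oo --> 4 * L * 0.
    apply: cvgM; first exact: cvg_cst.
    by apply: cvg_expr; rewrite gtr0_norm // invf_lt1 // ltr1n.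
  rewrite mulr0 => /cvgrPdist_lt /(_ _ d0) [j _ /(_ j (leqnn j))].
  rewrite sub0r normrN => H; exists j; apply: le_lt_trans H.
  by apply: le_trans (ler_norm _); rewrite exprVn mulrA.
apply: (qs_bad j); exists 0 => n _.
set Lj' := L / 2 ^+ j in jd *.
have Lj'0 : 0 < Lj' := Lj j.
have h0 : 0 <= Lj' / 2 ^+ n by rewrite divr_ge0 ?ltW // exprn_gt0.
pose A w := (F l - dl * l) + dl * w.
have -> : box_int F (qs j) (Lj' / 2 ^+ n) (2 ^ n) =
    box_int (fun w => F w - A w) (qs j) (Lj' / 2 ^+ n) (2 ^ n).
  by rewrite box_intB box_int_affine subr0.
apply: le_trans (@box_int_le _ _ _ _ 0 (e / 16 * (4 * Lj')) h0 _) _; last first.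
  by rewrite mesh le_eqVlt; apply/orP; left; apply/eqP; field.
move=> a b aM bM; rewrite subr0; set w := grid _ _ _ _.
have wl : modulus (w - l) <= 4 * Lj'.
  apply: le_trans (modulus_dist _ _ (qs j)) _.
  have := grid_dist (qs j) h0 aM bM; rewrite mesh -/w.
  by have := Hl j; rewrite -/Lj'; lra.
have -> : F w - A w = F w - F l - dl * (w - l) by rewrite /A; ring.
apply: le_trans (Hd _ (le_lt_trans wl jd)) _.
by rewrite ler_wpM2l // ltW.
Qed.

(** Uniformity in [q] comes from compactness: translating a box by a short vector changes the
    boundary values little, by uniform continuity. *)
Lemma goursat_uniform (K : set C) F L e : compact K -> 0 < L -> 0 < e ->
  {within K, continuous F} ->
  (forall z, interior K z -> exists l, cdiff_at F z l) ->
  exists n0, forall n, (n0 <= n)%N -> forall q,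
    (forall w, modulus (w - q) <= 4 * L -> K w) ->
    modulus (box_int F q (L / 2 ^+ n) (2 ^ n)) <= e.
Proof.
move=> cK L0 e0 FK HF.
suff [n0 H] : exists n0, forall n q, (n0 <= n)%N -> K q ->
    (forall w, modulus (w - q) <= 4 * L -> K w) ->
    modulus (box_int F q (L / 2 ^+ n) (2 ^ n)) <= e.
  exists n0 => n nn q Hq; apply: H => //; apply: Hq.
  by rewrite subrr modulus0 mulr_ge0 // ltW.
apply: (compact_near_cover (P := fun n q =>
  (forall w, modulus (w - q) <= 4 * L -> K w) ->
    modulus (box_int F q (L / 2 ^+ n) (2 ^ n)) <= e)) => // z Kz.
(* If the disc about [z] leaves [K], so do the closed discs about all nearby [q], and there is
   nothing to prove for them. *)
have [Hz|] := pselect (forall w, modulus (w - z) < 4 * L -> K w); last first.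
  move=> /existsNP[w /not_implyP[wz Kw]].
  exists (4 * L - modulus (w - z)); first by rewrite subr_gt0.
  exists 0 => n q _ qz Hq; exfalso; apply: Kw; apply: Hq.
  by have := modulus_dist w q z; rewrite (modulusBC z q); lra.
have e1 : 0 < e / (8 * L) by rewrite divr_gt0 // mulr_gt0.
have e2 : 0 < e / (2 * L ^+ 2) by rewrite divr_gt0 // mulr_gt0 // exprn_gt0.
have [d d0 Hd] := compact_unif_continuous cK FK e1.
have [|n0 Hn0] := @goursat F z L L0 _ _ e2.
  move=> w wz; apply: HF; apply/interior_modulusP; exists L => // v vw.
  by apply: Hz; have := modulus_dist v z w; lra.
exists (Num.min d L); first by rewrite lt_min d0.
exists n0 => n q nn; rewrite lt_min => /andP[qd qL] Hq.
have h0 : 0 <= L / 2 ^+ n by rewrite divr_ge0 ?ltW // exprn_gt0.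
have -> : box_int F q (L / 2 ^+ n) (2 ^ n) =
    box_int (fun w => F (w + (q - z)) - F w) z (L / 2 ^+ n) (2 ^ n)
    + box_int F z (L / 2 ^+ n) (2 ^ n).
  by rewrite box_intB subrK -box_int_shift.
apply: le_trans (modulusD _ _) _; rewrite (splitr e); apply: lerD; last first.
  apply: le_trans (Hn0 _ nn) _.
  by rewrite le_eqVlt; apply/orP; left; apply/eqP; field; rewrite gt_eqF.
apply: le_trans (@box_int_le _ _ _ _ 0 (e / (8 * L)) h0 _) _; last first.
  by rewrite mesh le_eqVlt; apply/orP; left; apply/eqP; field; rewrite gt_eqF.
move=> a b aM bM; rewrite subr0; set w := grid _ _ _ _.
have wz : modulus (w - z) <= 2 * L by have := grid_dist z h0 aM bM; rewrite mesh.
apply: Hd.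
- apply: Hz; rewrite (_ : _ - z = (w - z) + (q - z)); last by ring.
  by apply: le_lt_trans (modulusD _ _) _; lra.
- by apply: Hz; lra.
rewrite (_ : _ - w = q - z) ?ltW //; ring.
Qed.

End Goursat.

(** * Extension, averaging and kernel bounds by lattice distance *)

Section Averages.
Context {R : realType}.
Local Notation C := (Cplx R).
Variable K : set C.
Variables (g : C -> C) (H : R).
Hypothesis g_le : forall z, K z -> modulus (g z) <= H.
Hypothesis H_gt0 : 0 < H.

(* No continuity is needed: averaging [f] over a box does what a partition of
   unity or a convolution would do. *)
Lemma rough_extension (d : R) : 0 < d -> exists f : C -> C, [/\
  forall z, K z -> f z = g z,
  forall w y, K y -> modulus (y - w) < d ->
    exists y', [/\ K y', modulus (y' - w) < d & f w = g y'],
  forall w, (forall y, K y -> d <= modulus (y - w)) -> f w = 0 &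
  forall w, modulus (f w) <= H].
Proof.
move=> d0; have /choice[f Hf] : forall w, exists v, [/\ K w -> v = g w,
  forall y, K y -> modulus (y - w) < d ->
    exists y', [/\ K y', modulus (y' - w) < d & v = g y'],
  (forall y, K y -> d <= modulus (y - w)) -> v = 0 & modulus v <= H].
  move=> w; have [Kw|Kw] := pselect (K w).
    exists (g w); split => //.
    - by move=> y Ky yw; exists w; rewrite subrr modulus0.
    - by move=> /(_ w Kw); rewrite subrr modulus0 => /(lt_le_trans d0); rewrite ltxx.
    - exact: g_le.
  have [[y [Ky yw]]|ny] := pselect (exists y, K y /\ modulus (y - w) < d).
    exists (g y); split => //.
    - by move=> _ _ _; exists y.
    - by move=> /(_ y Ky) /(lt_le_trans yw); rewrite ltxx.
    - exact: g_le.
  exists 0; split => //.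
  - by move=> y Ky yw; exfalso; apply: ny; exists y.
  - by rewrite modulus0 ltW.
by exists f; split=> w; have [] := Hf w.
Qed.

Definition box_avg (f : C -> C) (h : R) (M : nat) (p : C) : C :=
  (M%:R * M%:R)^-1 * \sum_(s < M) \sum_(t < M) f (grid p h s t).

(** Averaging commutes with translation, so one cell of the average carries a contour sum over
    [M * M] cells divided by [M ^ 2]. The oscillation bound gains a factor [M], and Goursat's
    theorem becomes applicable. *)
Lemma cell_sum_avg f h M q :
  cell_sum (box_avg f h M) q h = (M%:R * M%:R)^-1 * box_int f q h M.
Proof.
have gD x s t : grid (q + x) h s t = grid q h s t + x by rewrite /grid; ring.
rewrite /cell_sum /box_avg /box_int.
under [in RHS]eq_bigr => s _.
  rewrite /cell_sum (@sum_cross _ _ _ _ _ (fun t => f (grid q h s t))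
    (fun t => f (grid q h s t + ofR h * (1 + iC))) (fun t => f (grid q h s t + ofR h))
    (fun t => f (grid q h s t + ofR h * iC))).
  over.
rewrite (@sum_cross _ _ _ _ _ (fun s => \sum_(t < M) f (grid q h s t))
    (fun s => \sum_(t < M) f (grid q h s t + ofR h * (1 + iC)))
    (fun s => \sum_(t < M) f (grid q h s t + ofR h))
    (fun s => \sum_(t < M) f (grid q h s t + ofR h * iC))).
have E x : \sum_(s < M) \sum_(t < M) f (grid (q + x) h s t) =
           \sum_(s < M) \sum_(t < M) f (grid q h s t + x).
  by apply: eq_bigr => s _; apply: eq_bigr => t _; rewrite gD.
by rewrite !E; ring.
Qed.

Lemma box_avg_le f h M p (v : C) (e : R) : (0 < M)%N ->
  (forall s t, (s < M)%N -> (t < M)%N -> modulus (f (grid p h s t) - v) <= e) ->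
  modulus (box_avg f h M p - v) <= e.
Proof.
move=> M0 He; have M0' : (M%:R : C) != 0 by rewrite pnatr_eq0 -lt0n.
have -> : box_avg f h M p - v = (M%:R * M%:R)^-1 *
    \sum_(s < M) \sum_(t < M) (f (grid p h s t) - v).
  have -> : \sum_(s < M) \sum_(t < M) (f (grid p h s t) - v) =
      \sum_(s < M) \sum_(t < M) f (grid p h s t) - M%:R * M%:R * v.
    rewrite (_ : M%:R * M%:R * v = \sum_(s < M) \sum_(t < M) v); last first.
      by rewrite !sumr_const card_ord -mulrA !mulr_natl.
    by rewrite -sumrB; apply: eq_bigr => s _; rewrite -sumrB.
  by rewrite /box_avg; field.
have M1 : 0 < M%:R :> R by rewrite ltr0n.
rewrite modulusM modulusV modulusM modulus_nat ler_pdivrMl ?mulr_gt0 //.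
apply: le_trans (modulus_sum _ _ _) _.
apply: (@le_trans _ _ (\sum_(s < M) \sum_(t < M) e)); last first.
  by rewrite !sumr_const card_ord -mulrA !mulr_natl.
apply: ler_sum => s _; apply: le_trans (modulus_sum _ _ _) _.
by apply: ler_sum => t _; exact: He.
Qed.

(** [648 = 8 * 3 ^ 4] is dictated by [d <= 2], where only the bound 8 is used; for [d >= 3] the
    decay gives [2 * 2 ^ 4]. *)
Lemma akern_le4 (h : R) (w : C) (d : nat) : 0 < h -> h * (d%:R - 1) <= modulus w ->
  modulus (akern h w) <= 648 / d.+1%:R ^+ 4.
Proof.
move=> h0 hd; have d1 : 0 < d.+1%:R ^+ 4 :> R by rewrite exprn_gt0.
have [d2|d3] := leqP d 2.
  apply: le_trans (akern_le w h0) _; rewrite ler_pdivlMr //.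
  have : d.+1%:R ^+ 4 <= 3 ^+ 4 :> R.
    by apply: lerXn2r => //; rewrite ?nnegrE // ler_nat.
  lra.
have d3' : 3 <= d%:R :> R by rewrite ler_nat.
have hw : 2 * h <= modulus w by nra.
apply: le_trans (akern_far h0 hw) _.
have hw' : h * (d.+1%:R / 2) <= modulus w.
  apply: le_trans hd; rewrite ler_pM2l // -natr1; lra.
have w0 : 0 < modulus w by lra.
rewrite ler_pdivrMr ?exprn_gt0 // mulrAC ler_pdivlMr //.
have : (h * (d.+1%:R / 2)) ^+ 4 <= modulus w ^+ 4.
  apply: lerXn2r => //; rewrite nnegrE //.
  by rewrite mulr_ge0 ?ltW // divr_gt0.
have -> : (h * (d.+1%:R / 2)) ^+ 4 = h ^+ 4 * d.+1%:R ^+ 4 / 16 by field.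
set x := h ^+ 4 * _; have x0 : 0 <= modulus w ^+ 4 by rewrite exprn_ge0.
rewrite -mulrA -/x; lra.
Qed.

Lemma kern_le1 (h : R) (w : C) (d : nat) : 0 < h -> h * (d%:R - 1) <= modulus w ->
  modulus (kern h w) <= 4 / (h * d.+1%:R).
Proof.
move=> h0 hd; have d1 : 0 < d.+1%:R :> R by [].
have [d2|d3] := leqP d 1.
  apply: le_trans (kern_le w h0) _.
  rewrite ler_pdivrMr // invfM mulrA mulrAC divfK ?gt_eqF // ler_pdivlMr //.
  have : d.+1%:R <= 2 :> R by rewrite ler_nat.
  lra.
have d3' : 2 <= d%:R :> R by rewrite ler_nat.
have hw : h <= modulus w by nra.
rewrite kern_far; last by lra.
rewrite modulusV -[leLHS]mul1r ler_pdivrMr; last by lra.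
rewrite mulrAC ler_pdivlMr ?mulr_gt0 //.
by rewrite -natr1; nra.
Qed.

End Averages.

(** * Replacing the kernel of a single cell *)

Section CellReplace.
Context {R : realType}.
Local Notation C := (Cplx R).
Variables (K : set C) (B : R).
Hypothesis K_bounded : forall z, K z -> modulus z <= B.
Hypothesis K_reach : reachable K.
Variables (k : R) (k_gt0 : 0 < k).
Hypothesis replaceP : forall (d : R) (p zeta : C), 0 < d -> ~ K p ->
  modulus (zeta - p) <= 5 * d ->
  exists2 Q : C -> C, poly_approx K Q &
  forall z, K z -> modulus (Q z) <= k / d /\
    (z != zeta -> modulus (Q z - (z - zeta)^-1) <=
      k * d ^+ 2 / (modulus (z - zeta) * (modulus (z - zeta) + d) ^+ 2)).
Variables (delta h eps eta : R) (M : nat) (g f : C -> C).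
Hypotheses (h_gt0 : 0 < h) (M_gt0 : (0 < M)%N) (deltaE : delta = h * M%:R).
Hypotheses (eps_gt0 : 0 < eps) (eta_gt0 : 0 < eta).
Hypothesis g_unif : forall z w, K z -> K w -> modulus (z - w) <= 16 * delta ->
  modulus (g z - g w) <= eps.
Hypothesis f_eq : forall z, K z -> f z = g z.
Hypothesis f_near : forall w y, K y -> modulus (y - w) < 5 * delta ->
    exists y', [/\ K y', modulus (y' - w) < 5 * delta & f w = g y'].
Hypothesis g_int : forall q, (forall w, modulus (w - q) <= 4 * delta -> K w) ->
  modulus (box_int g q h M) <= eta.

Let M1 : 1 <= M%:R :> R. Proof. by rewrite ler1n. Qed.
Let delta_gt0 : 0 < delta. Proof. by rewrite deltaE mulr_gt0 // ltr0n. Qed.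
Let h_le : h <= delta. Proof. by rewrite deltaE ler_peMr // ltW. Qed.

(** [27 = 3 ^ 3]: for [d >= 2] each of the three distances in the denominator is at least a third of
    its lattice counterpart. For [d <= 1] the right-hand side is of order [h^-1], which covers the
    cut-off region as well. *)
Lemma kern_replace_le (zeta z : C) (Q : C) (d : nat) :
  modulus Q <= k / delta ->
  (z != zeta -> modulus (Q - (z - zeta)^-1) <=
     k * delta ^+ 2 / (modulus (z - zeta) * (modulus (z - zeta) + delta) ^+ 2)) ->
  h * (d%:R - 1) <= modulus (z - zeta) ->
  modulus (kern h (z - zeta) - Q) <=
    27 * k * (M%:R ^+ 2 / (h * d.+1%:R * (M + d)%:R ^+ 2)).
Proof.
move=> Q1 Q2 hd; set r := modulus (z - zeta) in Q2 hd *.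
have [M1' [delta0 [hdelta [h0 [k0 [e0 eta0]]]]]] :=
  (M1, (delta_gt0, (h_le, (h_gt0, (k_gt0, (eps_gt0, eta_gt0)))))).
have Md0 : 0 < (M + d)%:R :> R by rewrite ltr0n addn_gt0 M_gt0.
have Md : (M + d)%:R = M%:R + d%:R :> R by rewrite natrD.
have d_ge0 : 0 <= d%:R :> R by [].
have dS : 0 < d.+1%:R :> R by [].
have M0 : 0 < M%:R :> R by rewrite ltr0n.
have small : (d <= 1)%N ->
    (8 * h)^-1 <= M%:R ^+ 2 / (h * d.+1%:R * (M + d)%:R ^+ 2).
  move=> d1; have d1' : d%:R <= 1 :> R by rewrite -[1]/(1%:R) ler_nat.
  have d2 : d.+1%:R <= 2 :> R by rewrite ler_nat.
  rewrite ler_pdivlMr ?mulr_gt0 ?exprn_gt0 // ler_pdivrMl ?mulr_gt0 //.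
  have -> : 8 * h * M%:R ^+ 2 = h * 2 * (2 * M%:R) ^+ 2 by ring.
  apply: ler_pM; rewrite ?exprn_ge0 ?mulr_ge0 ?(ltW h_gt0) //.
    by rewrite ler_pM2l.
  by rewrite lerXn2r ?nnegrE ?mulr_ge0 // Md; lra.
have [rh|rh] := ltrP r (h / 2).
  rewrite /kern -/r rh sub0r modulusN.
  have d1 : (d <= 1)%N.
    rewrite -ltnS -(ltr_nat R).
    have : h * (d%:R - 1) < h * 1.
      by lra.
    by rewrite ltr_pM2l //; lra.
  apply: le_trans Q1 _; apply: (@le_trans _ _ (27 * k * (8 * h)^-1)); last first.
    by rewrite ler_pM2l ?small // mulr_gt0.
  have -> : 27 * k * (8 * h)^-1 = k * (8 / 27 * h)^-1 by field; rewrite gt_eqF.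
  by rewrite ler_pM2l // lef_pV2 ?posrE ?mulr_gt0 ?divr_gt0 //; lra.
rewrite kern_far // modulusBC.
have r0 : 0 < r by lra.
have rd0 : 0 < r + delta by lra.
have zz : z != zeta by rewrite -subr_eq0 -modulus_gt0.
apply: le_trans (Q2 zz) _; rewrite -2!mulrA (mulrCA 27) ler_pM2l //.
have [d1|d2] := leqP d 1.
  apply: (@le_trans _ _ (27 * (8 * h)^-1)); last by rewrite ler_pM2l // small.
  apply: (@le_trans _ _ (delta ^+ 2 / (h / 2 * delta ^+ 2))); last first.
    have -> : delta ^+ 2 / (h / 2 * delta ^+ 2) = 2 * h^-1 by field; rewrite !gt_eqF.
    by rewrite invfM mulrA ler_pM2r ?invr_gt0 //; lra.
  rewrite ler_pM2l ?exprn_gt0 // lef_pV2 ?posrE ?mulr_gt0 ?exprn_gt0 ?divr_gt0 //.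
  apply: ler_pM => //; first by rewrite divr_ge0 // ltW.
    by rewrite exprn_ge0 // ltW.
  by rewrite lerXn2r ?nnegrE ?ltW //; lra.
have d2' : 2 <= d%:R :> R by rewrite ler_nat.
have rd : h * (d.+1%:R / 3) <= r.
  apply: le_trans hd; rewrite ler_pM2l // -natr1; lra.
have rMd : h * ((M + d)%:R / 3) <= r + delta.
  rewrite deltaE Md; move: rd; rewrite -natr1; nra.
have -> : 27 * (M%:R ^+ 2 / (h * d.+1%:R * (M + d)%:R ^+ 2)) =
  delta ^+ 2 / (h * (d.+1%:R / 3) * (h * ((M + d)%:R / 3)) ^+ 2).
  by rewrite deltaE; field; rewrite -?Md ?natr1 !gt_eqF.
rewrite ler_pM2l ?exprn_gt0 // lef_pV2 ?posrE ?mulr_gt0 ?exprn_gt0 ?mulr_gt0 ?divr_gt0 //.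
apply: ler_pM => //.
- by rewrite mulr_ge0 ?ltW // divr_gt0.
- by rewrite exprn_ge0 // mulr_ge0 ?ltW // divr_gt0.
by rewrite lerXn2r ?nnegrE // ?mulr_ge0 ?divr_ge0 ?addr_ge0 // ltW.
Qed.

(* Cells away from [K] keep their pole, cells deep inside [K] are dropped, and
   the pole of the others is replaced. *)
Lemma cell_replace (q : C) : exists2 Psi : C -> C, poly_approx K Psi &
  forall z (d : nat), K z -> h * (d%:R - 1) <= modulus (z - q - half_diag h) ->
    modulus (cell_sum (box_avg f h M) q h * kern h (z - q - half_diag h) - Psi z) <=
    108 * k * eps * (M%:R / (d.+1%:R * (M + d)%:R ^+ 2)) +
    4 * eta / (M%:R ^+ 2 * h * d.+1%:R).
Proof.
have M0 : 0 < M%:R :> R by rewrite ltr0n.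
have [M1' [delta0 [hdelta [h0 [k0 [e0 eta0]]]]]] :=
  (M1, (delta_gt0, (h_le, (h_gt0, (k_gt0, (eps_gt0, eta_gt0)))))).
have bnd1 (d : nat) : 0 <= 108 * k * eps * (M%:R / (d.+1%:R * (M + d)%:R ^+ 2)).
  by rewrite !mulr_ge0 ?invr_ge0 ?mulr_ge0 ?exprn_ge0 // ltW.
have bnd2 (d : nat) : 0 <= 4 * eta / (M%:R ^+ 2 * h * d.+1%:R).
  by rewrite !mulr_ge0 ?invr_ge0 ?mulr_ge0 ?exprn_ge0 // ltW.
pose c := q + half_diag h.
have zc z : z - q - half_diag h = z - c by rewrite /c; ring.
have qc : modulus (q - c) <= delta.
  rewrite (_ : q - c = - half_diag h) ?modulusN; last by rewrite /c; ring.
  by apply: le_trans (half_diag_le (ltW h_gt0)) _.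
(* Here [K] avoids the cut-off disc of [c], so [c] lies off [K] and [kern] is the exact pole on [K].
   Otherwise [z1] anchors the box to a value of [g]. *)
have [out|/existsNP[z1 /not_implyP[Kz1 /negP]]] :=
    pselect (forall z, K z -> h / 2 <= modulus (z - c)).
  exists (fun z => cell_sum (box_avg f h M) q h * (z - c)^-1).
    apply: (poly_approx_scale K_bounded); apply: (poly_approx_pole K_bounded) => //.
    by move=> /out; rewrite subrr modulus0; lra.
  move=> z d Kz _; rewrite zc kern_far ?out // subrr modulus0.
  by rewrite addr_ge0.
rewrite -ltNge => z1c.
have cellE : modulus (cell_sum (box_avg f h M) q h) =
    modulus (box_int f q h M) / M%:R ^+ 2.
  by rewrite cell_sum_avg modulusM modulusV modulusM modulus_nat mulrC.
have [deep|/existsNP[p /not_implyP[pc Kp]]] :=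
    pselect (forall w, modulus (w - c) <= 5 * delta -> K w).
  exists (fun=> 0); first exact: poly_approx_cst.
  move=> z d Kz hd; rewrite subr0 modulusM cellE.
  have Kq w : modulus (w - q) <= 4 * delta -> K w.
    by move=> wq; apply: deep; have := modulus_dist w c q; lra.
  have : modulus (box_int f q h M) <= eta.
    have : modulus (box_int (fun w => f w - g w) q h M) <= 4 * (h * M%:R) * 0.
      apply: (@box_int_le _ _ _ _ _ 0) => [|a b aM bM]; first exact: ltW.
      rewrite subr0 f_eq ?subrr ?modulus0 //; apply: Kq.
      by have := grid_dist q (ltW h_gt0) aM bM; rewrite -deltaE; lra.
    rewrite box_intB mulr0; have := g_int Kq.
    have := modulus_le_add (box_int f q h M) (box_int g q h M); lra.
  move=> fe; rewrite -[leLHS]add0r; apply: lerD => //.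
  have -> : 4 * eta / (M%:R ^+ 2 * h * d.+1%:R) = eta / M%:R ^+ 2 * (4 / (h * d.+1%:R)).
    by field; rewrite !gt_eqF.
  apply: ler_pM => //; first by rewrite divr_ge0 // exprn_ge0.
    by rewrite ler_pM2r // invr_gt0 exprn_gt0.
  exact: kern_le1.
have [|Q HQ Qz] := replaceP delta_gt0 Kp (zeta := c); first by rewrite modulusBC.
exists (fun z => cell_sum (box_avg f h M) q h * Q z).
  exact: (poly_approx_scale K_bounded).
move=> z d Kz; rewrite zc => hd; rewrite -mulrBr modulusM cellE.
have [Q1 Q2] := Qz _ Kz.
(* On the box [f] only takes values of [g] at points within [17 / 2 * delta] of [z1], hence
   oscillates about [g z1] by at most [eps]. *)
have : modulus (box_int f q h M) <= 4 * (h * M%:R) * eps.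
  apply: (@box_int_le _ _ _ _ _ (g z1)) => [|a b aM bM]; first exact: ltW.
  have := grid_dist q (ltW h_gt0) aM bM; rewrite -deltaE; set w := grid _ _ _ _ => wq.
  have z1w : modulus (z1 - w) < 7 / 2 * delta.
    have := modulus_dist z1 w c; have := modulus_dist c w q.
    by rewrite (modulusBC c q) (modulusBC q w); lra.
  have [|y [Ky yw ->]] := f_near (w := w) Kz1; first by lra.
  apply: g_unif => //.
  by have := modulus_dist y z1 w; rewrite (modulusBC w z1); lra.
move=> fe; rewrite -[leLHS]addr0; apply: lerD => //.
have -> : 108 * k * eps * (M%:R / (d.+1%:R * (M + d)%:R ^+ 2)) =
   4 * (h * M%:R) * eps / M%:R ^+ 2 *
    (27 * k * (M%:R ^+ 2 / (h * d.+1%:R * (M + d)%:R ^+ 2))).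
  have Md0 : 0 < (M + d)%:R :> R by rewrite ltr0n addn_gt0 M_gt0.
  by field; rewrite -?natrD ?natr1 !gt_eqF.
apply: ler_pM => //; first by rewrite divr_ge0 // exprn_ge0.
  by rewrite ler_pM2r // invr_gt0 exprn_gt0.
exact: kern_replace_le.
Qed.

End CellReplace.

(** The error has three sources: replacing the kernels ([S1]), smearing [g] by the approximate
    identity ([S3]), and the variation of its total mass with [z] ([S4]). [S2] is the summation by
    parts. *)
Lemma mergelyan_step {R : realType} (K : set (Cplx R)) (B : R) (g : Cplx R -> Cplx R)
    (H c1 k eps eta delta h X : R) (M n : nat) :
  (forall z, K z -> modulus z <= B) -> 0 < B -> reachable K ->
  (forall z, K z -> modulus (g z) <= H) -> 0 < H ->
  0 < c1 -> (forall (h : R) (w : Cplx R) (d : nat), 0 < h -> h * (d%:R - 1) <= modulus w ->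
    modulus (akern h w) <= c1 / d.+1%:R ^+ 4) ->
  0 < k ->
  (forall (d : R) (p zeta : Cplx R), 0 < d -> ~ K p -> modulus (zeta - p) <= 5 * d ->
    exists2 Q : Cplx R -> Cplx R, poly_approx K Q &
    forall z, K z -> modulus (Q z) <= k / d /\
    (z != zeta -> modulus (Q z - (z - zeta)^-1) <=
      k * d ^+ 2 / (modulus (z - zeta) * (modulus (z - zeta) + d) ^+ 2))) ->
  0 < h -> (0 < M)%N -> delta = h * M%:R -> 0 < eps -> 0 < eta ->
  (forall z w, K z -> K w -> modulus (z - w) <= 16 * delta ->
    modulus (g z - g w) <= eps) ->
  (forall q, (forall w, modulus (w - q) <= 4 * delta -> K w) ->
    modulus (box_int g q h M) <= eta) ->
  H <= eps * M%:R -> X = h * (n%:R + 1 / 2) -> (0 < n)%N ->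
  B + 10 * delta <= h * n%:R -> 2 * B <= X -> 16 * B * H <= eps * X ->
  eta * (2 * X) <= eps * delta ^+ 2 ->
  exists2 psi : Cplx R -> Cplx R, poly_approx K psi & forall z, K z ->
    modulus (psi z - g z) <= (48 * c1 + 1 + 8 * (216 * k + 4)) * eps.
Proof.
move=> K_bounded B0 K_reach g_le H0 c10 akernP k0 replaceP h0 M0.
move=> deltaE eps0 eta0 g_unif g_int HM XE n0 Bn BX HX etaX.
have M1 : 0 < M%:R :> R by rewrite ltr0n.
have M1' : 1 <= M%:R :> R by rewrite ler1n.
have delta0 : 0 < delta by rewrite deltaE mulr_gt0.
have h_le : h <= delta by rewrite deltaE ler_peMr // ltW.
have X0 : 0 < X by lra.
have d5 : 0 < 5 * delta by lra.
have [f [f1 f2 f3 f4]] := rough_extension g_le H0 d5.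
pose F := box_avg f h M; pose o : Cplx R := box_origin n h; pose N := n.*2.+1.
have hN : h * N%:R = 2 * X.
  by rewrite XE /N -natr1 -muln2 natrM; field.
have /choice[Psi HPsi] : forall q, exists Psi : Cplx R -> Cplx R, poly_approx K Psi /\
  forall z (d : nat), K z -> h * (d%:R - 1) <= modulus (z - q - half_diag h) ->
    modulus (cell_sum F q h * kern h (z - q - half_diag h) - Psi z) <=
    108 * k * eps * (M%:R / (d.+1%:R * (M + d)%:R ^+ 2)) +
    4 * eta / (M%:R ^+ 2 * h * d.+1%:R).
  move=> q; have [Psi ? ?] := @cell_replace R K B K_bounded K_reach k k0 replaceP
    delta h eps eta M g f h0 M0 deltaE eps0 eta0 g_unif f1 f2 g_int q.
  by exists Psi.
have c0_ge : 4 <= modulus (box_sum n h 0 : Cplx R) := box_sum0_ge n0 h0 XE.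
pose c0 : Cplx R := box_sum n h 0.
have c0n : c0 != 0 by rewrite -modulus_gt0 /c0; lra.
exists (fun z => c0^-1 * \sum_(a < N) \sum_(b < N) Psi (grid o h a b) z).
  apply: (poly_approx_scale K_bounded).
  apply: (@poly_approx_sum _ _ _ _ _ (fun (a : 'I_N) z => \sum_(b < N) Psi (grid o h a b) z)) => a _.
  apply: (@poly_approx_sum _ _ _ _ _ (fun (b : 'I_N) z => Psi (grid o h a b) z)) => b _.
  by have [] := HPsi (grid o h a b).
move=> z Kz; have zB := K_bounded _ Kz.
have hn0 : h * N%:R = 2 * (h * n%:R) + h by rewrite /N -natr1 -muln2 natrM; ring.
have zRe : 0 <= cRe (z - o) < h * N%:R.
  rewrite cReD cReN /o /= opprK.
  have := le_trans (le_Re_modulus z) zB; rewrite ler_norml => /andP[u1 u2].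
  by clear -u1 u2 Bn delta0 h0 hn0; apply/andP; split; lra.
have zIm : 0 <= cIm (z - o) < h * N%:R.
  rewrite cImD cImN /o /= opprK.
  have := le_trans (le_Im_modulus z) zB; rewrite ler_norml => /andP[u1 u2].
  by clear -u1 u2 Bn delta0 h0 hn0; apply/andP; split; lra.
have [a0 [b0 [a0N b0N Hg]]] := grid_near h0 zRe zIm.
pose D a b := maxn (ndist a a0) (ndist b b0).
pose Phi := \sum_(a < N) \sum_(b < N)
  cell_sum F (grid o h a b) h * kern h (z - grid o h a b - half_diag h).
have c01 : modulus c0^-1 <= 1.
  by rewrite modulusV invf_le1 /c0; clear -c0_ge; lra.
have S4 : modulus (box_sum n h z * g z - c0 * g z) <= eps.
  rewrite -mulrBl modulusM.
  apply: (@le_trans _ _ (16 * modulus z / X * H)).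
    apply: ler_pM => //; last exact: g_le.
    by apply: box_sum_diff => //; clear -zB BX; lra.
  rewrite mulrAC ler_pdivrMr //; apply: le_trans HX.
  by rewrite ler_pM2r // ler_pM2l.
have S2 : Phi = \sum_(a < N) \sum_(b < N) F (grid o h a b) * akern h (z - grid o h a b).
  apply: sum_by_parts => a b aN bN ab.
  have far : h * n%:R <= modulus (grid o h a b).
    have hN' : h * N%:R = h * n%:R + (h * n%:R + h) by clear -hn0; lra.
    have hn : 0 <= h * n%:R by rewrite mulr_ge0 // ltW.
    have [ca|cb] : (a = 0 \/ a = N)%N \/ (b = 0 \/ b = N)%N.
      by case/or4P: ab => /eqP ->; [left; left|right; left|left; right|right; right].
      apply: le_trans (le_Re_modulus _); rewrite cRe_grid /o /=.
      case: ca => ->; first by rewrite mulr0 addr0 normrN ger0_norm.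
      by apply: le_trans (ler_norm _); clear -hN' h0 hn; lra.
    apply: le_trans (le_Im_modulus _); rewrite cIm_grid /o /=.
    case: cb => ->; first by rewrite mulr0 addr0 normrN ger0_norm.
    by apply: le_trans (ler_norm _); clear -hN' h0 hn; lra.
  apply/eqP; rewrite -modulus_eq0; apply/eqP/le_anti; rewrite modulus_ge0 andbT.
  rewrite -[X in modulus X]subr0; apply: box_avg_le => // s t sM tM.
  rewrite subr0 f3 ?modulus0 // => y Ky.
  have := grid_dist (grid o h a b) (ltW h0) (ltnW sM) (ltnW tM); rewrite -deltaE.
  set w := grid (grid _ _ _ _) _ _ _; set p := grid o h a b in far *.
  have := K_bounded _ Ky; have := modulus_le_add p w; have := modulus_le_add w y.
  by rewrite (modulusBC p w) (modulusBC w y); clear -far Bn delta0; lra.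
have S3 : modulus (Phi - box_sum n h z * g z) <= 48 * c1 * eps.
  rewrite S2 /box_sum -/N -/o mulr_suml -sumrB.
  apply: le_trans (modulus_sum _ _ _) _.
  (* The factor [3 eps (m + 1)] covers two ranges: for [m < M] uniform continuity gives [eps], for
     [m >= M] the crude [2 H] is at most [2 eps M]. One power of [m + 1] is spent here and one on
     the shell size, which leaves a convergent sum. *)
  pose phi m : R := 3 * c1 * eps / m.+1%:R ^+ 3.
  have phi0 m : 0 <= phi m by rewrite !mulr_ge0 ?invr_ge0 ?exprn_ge0 // ltW.
  apply: (@le_trans _ _ (\sum_(a < N) \sum_(b < N) phi (D a b))); last first.
    apply: le_trans (shell_sum phi0 a0N b0N) _.
    have -> : 48 * c1 * eps = 8 * (3 * c1 * eps * 2) by ring.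
    rewrite ler_pM2l //.
    have -> : \sum_(m < N) m.+1%:R * phi m =
        3 * c1 * eps * \sum_(m < N) 1%:R / (1 + m)%:R ^+ 2.
      rewrite mulr_sumr; apply: eq_bigr => m _; rewrite /phi add1n.
      by field; rewrite ?natr1 gt_eqF.
    rewrite ler_pM2l ?mulr_gt0 //.
    exact: sum_inv_sqr.
  apply: ler_sum => a _; rewrite mulr_suml -sumrB.
  apply: le_trans (modulus_sum _ _ _) _; apply: ler_sum => b _.
  have [g1 g2 _] := Hg a b; rewrite -/(D a b) in g1 g2.
  rewrite mulrC -mulrBr modulusM.
  set m := D a b in g1 g2 *; set p := grid o h a b in g1 g2 *.
  have m0 : 0 < m.+1%:R :> R by [].
  have m1 : 1 <= m.+1%:R :> R by rewrite ler1n.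
  have -> : phi m = c1 / m.+1%:R ^+ 4 * (3 * eps * m.+1%:R).
    by rewrite /phi; field; rewrite ?natr1 gt_eqF.
  apply: ler_pM => //; first exact: akernP.
  apply: box_avg_le => // s t sM tM.
  have := grid_dist p (ltW h0) (ltnW sM) (ltnW tM); rewrite -deltaE.
  set w := grid p h s t => wp.
  have em : eps <= eps * m.+1%:R by rewrite ler_peMr // ltW.
  have [mM|Mm] := leqP m.+1 M.
    have : 2 * h * m.+1%:R <= 2 * delta.
      by rewrite deltaE mulrA ler_pM2l ?ler_nat // mulr_gt0.
    move=> hm; have zw : modulus (z - w) <= 4 * delta.
      by have := modulus_dist z w p; rewrite (modulusBC p w); clear -g1 hm wp delta0; lra.
    have [|y [Ky yw ->]] := f2 w z Kz; first by clear -zw delta0; lra.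
    apply: (@le_trans _ _ eps); last by clear -em eps0; lra.
    apply: g_unif => //.
    by have := modulus_dist y z w; rewrite (modulusBC w z); clear -zw yw delta0; lra.
  apply: le_trans (modulusB _ _) _; have := f4 w; have := g_le _ Kz.
  have : eps * M%:R <= eps * m.+1%:R by rewrite ler_pM2l // ler_nat ltnW.
  by clear -HM em eps0; lra.
have S1 : modulus (Phi - \sum_(a < N) \sum_(b < N) Psi (grid o h a b) z) <=
    8 * (216 * k + 4) * eps.
  rewrite /Phi -sumrB; apply: le_trans (modulus_sum _ _ _) _.
  have ke : 0 <= 108 * k * eps by rewrite !mulr_ge0 // ltW.
  (* After multiplication by the shell size the first part is [M / (M + m) ^ 2], with sum at most 2;
     the second is the same for all [N] shells and is absorbed by the smallness of [eta]. *)
  pose phi m : R := 108 * k * eps * (M%:R / (m.+1%:R * (M + m)%:R ^+ 2)) +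
    4 * eta / (M%:R ^+ 2 * h * m.+1%:R).
  have phi0 m : 0 <= phi m.
    have p1 : 0 <= m.+1%:R * (M + m)%:R ^+ 2 :> R by rewrite mulr_ge0 ?exprn_ge0.
    have p2 : 0 <= M%:R ^+ 2 * h * m.+1%:R by rewrite !mulr_ge0 ?exprn_ge0 // ltW.
    by apply: addr_ge0; [apply: (mulr_ge0 ke)|]; apply: divr_ge0 => //; rewrite mulr_ge0 // ltW.
  apply: (@le_trans _ _ (\sum_(a < N) \sum_(b < N) phi (D a b))).
    apply: ler_sum => a _; rewrite -sumrB; apply: le_trans (modulus_sum _ _ _) _.
    apply: ler_sum => b _; have [_ HP] := HPsi (grid o h a b).
    by apply: HP => //; have [] := Hg a b.
  apply: le_trans (shell_sum phi0 a0N b0N) _; rewrite -!mulrA ler_pM2l //.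
  have -> : \sum_(m < N) m.+1%:R * phi m =
    108 * k * eps * (\sum_(m < N) M%:R / (M + m)%:R ^+ 2) +
      N%:R * (4 * eta / (M%:R ^+ 2 * h)).
    transitivity (\sum_(m < N) (108 * k * eps * (M%:R / (M + m)%:R ^+ 2) +
      4 * eta / (M%:R ^+ 2 * h))).
      apply: eq_bigr => m _; rewrite /phi.
      have Mm : 0 < (M + m)%:R :> R by rewrite ltr0n addn_gt0 M0.
      move: Mm; rewrite natrD => Mm.
      by field; rewrite ?natr1 !gt_eqF.
    by rewrite big_split /= -mulr_sumr sumr_const card_ord -[X in _ + X]mulr_natl.
  have s1 : \sum_(m < N) M%:R / (M + m)%:R ^+ 2 <= 2 :> R by apply: sum_inv_sqr.
  have s2 : N%:R * (4 * eta / (M%:R ^+ 2 * h)) <= 4 * eps.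
    have -> : N%:R * (4 * eta / (M%:R ^+ 2 * h)) = 4 * (eta * (h * N%:R)) / delta ^+ 2.
      by rewrite deltaE; field; rewrite !gt_eqF.
    by rewrite hN ler_pdivrMr ?exprn_gt0 //; clear -etaX; lra.
  have := ler_wpM2l ke s1; clear -s2; lra.
set S := \sum_(a < N) _ in S1 *.
have -> : c0^-1 * S - g z = c0^-1 * (S - c0 * g z) by rewrite mulrBr mulKf.
rewrite modulusM; apply: le_trans (_ : 1 * modulus (S - c0 * g z) <= _).
  exact: ler_wpM2r.
rewrite mul1r (_ : S - c0 * g z = (box_sum n h z * g z - c0 * g z)
   + ((Phi - box_sum n h z * g z) - (Phi - S))); last by ring.
apply: le_trans (modulusD _ _) _.
have := modulusB (Phi - box_sum n h z * g z) (Phi - S); clear -S1 S3 S4; lra.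
Qed.

Lemma mergelyan {R : realType} (K : set (Cplx R)) (g : Cplx R -> Cplx R) :
  compact K -> reachable K -> {within K, continuous g} ->
  (forall z, interior K z -> exists l, cdiff_at g z l) -> poly_approx K g.
Proof.
move=> cK rK gc gh.
have [B B0 HB] := compact_modulus_bounded cK.
have [H H0 HH] := compact_continuous_bounded cK gc.
have [k k0 Hk] := replace_pole HB rK.
have [c1 c10 Hc1] : exists2 c1 : R, 0 < c1 & forall (h : R) (w : Cplx R) (d : nat),
  0 < h -> h * (d%:R - 1) <= modulus w -> modulus (akern h w) <= c1 / d.+1%:R ^+ 4.
  by exists 648; [rewrite ltr0n|move=> h w d; exact: akern_le4].
apply: poly_approx_lim => e e0.
pose cst := 48 * c1 + 1 + 8 * (216 * k + 4).
have cst0 : 0 < cst by rewrite /cst; lra.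
have : 0 < e / cst by rewrite divr_gt0.
set eps := e / cst => eps0.
have [d d0 Hd] := compact_unif_continuous cK gc eps0.
have [delta deltaE] : exists delta, delta = d / 16 by exists (d / 16).
have delta0 : 0 < delta by rewrite deltaE divr_gt0.
pose rb := 2 * B + 10 * delta + 16 * B * H / eps.
have rbE : 16 * B * H / eps = rb - 2 * B - 10 * delta by rewrite /rb; ring.
have rbH : 0 < 16 * B * H / eps by rewrite divr_gt0 // !mulr_gt0.
have HX0 : 16 * B * H <= eps * rb.
  by rewrite (mulrC eps) -ler_pdivrMr // rbE; lra.
have rb0 : 0 < rb by lra.
clearbody rb.
(* [Y] will bound [2 X] for every mesh [h <= delta]; hence [eta], which decides the mesh through
   Goursat's theorem, can be fixed before [h]. *)
pose Y := 2 * rb + 4 * delta.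
have Y0 : 0 < Y by rewrite /Y; lra.
have eta0 : 0 < eps * delta ^+ 2 / Y by rewrite divr_gt0 // mulr_gt0 // exprn_gt0.
have [n0 Hn0] := goursat_uniform cK delta0 eta0 gc gh.
pose j := maxn n0 (Num.truncn (H / eps)).+1; pose M := (2 ^ j)%N.
have HM : H <= eps * M%:R.
  rewrite mulrC -ler_pdivrMr //; apply: le_trans (ltW (truncnS_gt _)) _.
  by rewrite ler_nat; apply: leq_trans (leq_maxr n0 _) (ltnW (ltn_expl _ _)).
have M0 : (0 < M)%N by rewrite expn_gt0.
have M1 : 0 < M%:R :> R by rewrite ltr0n.
have h0 : 0 < delta / M%:R by rewrite divr_gt0.
have Hj := Hn0 j (leq_maxl _ _); rewrite -natrX -/M in Hj.
have dE : delta = delta / M%:R * M%:R by rewrite divfK // gt_eqF.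
have hd : delta / M%:R <= delta.
  by rewrite ler_pdivrMr // ler_peMr ?ler1n // ltW.
move: (delta / M%:R) h0 Hj dE hd => h h0 Hj dE hd.
have rh0 : 0 <= rb / h by rewrite divr_ge0 // ltW.
have /andP[t1 t2] := truncn_itv rh0; move: (Num.truncn (rb / h)) t1 t2 => t t1 t2.
rewrite ler_pdivlMr // in t1; rewrite ltr_pdivrMr // in t2.
have hn : h * t.+1%:R <= rb + h by rewrite -natr1; lra.
have [X XE] : exists X, X = h * (t.+1%:R + 1 / 2) by exists (h * (t.+1%:R + 1 / 2)).
have Xlo : h * t.+1%:R + h / 2 = X by rewrite XE; field.
have [|||||psi Hpsi Hpsi'] := @mergelyan_step R K B g H c1 k eps
    (eps * delta ^+ 2 / Y) delta h X M t.+1 HB B0 rK HH H0 c10 Hc1 k0 Hk h0 M0 dE eps0 eta0 _ Hj HM XE isT.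
- by move=> z w Kz Kw zw; apply: Hd => //; lra.
- lra.
- lra.
- by apply: le_trans HX0 _; rewrite ler_pM2l //; lra.
- have ed : 0 < eps * delta ^+ 2 by rewrite mulr_gt0 // exprn_gt0.
  rewrite mulrAC ler_pdivrMr // ler_pM2l // /Y.
  by clear -Xlo hn hd delta0 h0; lra.
exists psi => // z Kz; apply: le_trans (Hpsi' z Kz) _.
by rewrite -/cst /eps mulrC divfK // gt_eqF.
Qed.

(** * Connectivity of plane sets *)

Section Connectivity.
Context {R : realType}.
Local Notation C := (Cplx R).
Implicit Types (z w p q : C) (A K : set C) (s t : R).

Lemma continuous_ofR : continuous (ofR : R -> C).
Proof.
move=> x; apply/cvg_modulusP => e e0; apply/nbhs_ballP; exists e => //= y.
by rewrite /ball /= => xy; rewrite -ofRN -ofRD modulus_ofR distrC.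
Qed.

Lemma path_connected A :
  (forall p q, A p -> A q -> exists gamma : R -> C, [/\ continuous gamma,
    gamma 0 = p, gamma 1 = q & forall t, 0 <= t <= 1 -> A (gamma t)]) ->
  connected A.
Proof.
move=> HA B [p Bp] [C1 oC1 BC1] [C2 cC2 BC2].
have BA w : B w -> A w by rewrite BC1 => -[].
apply/seteqP; split => [w /BA//|q Aq].
have [gamma [gc g0 g1 gA]] := HA p q (BA _ Bp) Aq.
pose Y := gamma @` `[0, 1]%classic.
have YA w : Y w -> A w.
  by move=> [t /= tI <-]; apply: gA; move: tI; rewrite in_itv.
have cY : connected Y.
  apply: connected_continuous_connected; first exact: segment_connected.
  exact: continuous_subspaceT.
have Yp : Y p by exists 0 => //=; rewrite in_itv /= lexx ler01.
have Yq : Y q by exists 1 => //=; rewrite in_itv /= lexx ler01.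
have BY : B `&` Y = Y.
  apply: cY; first by exists p.
    exists C1 => //; rewrite BC1; apply/seteqP; split => w /=; first by case=> -[].
    by move=> [Yw C1w]; split => //; split => //; exact: YA.
  exists C2 => //; rewrite BC2; apply/seteqP; split => w /=; first by case=> -[].
  by move=> [Yw C2w]; split => //; split => //; exact: YA.
by have [] : (B `&` Y) q by rewrite BY.
Qed.

Lemma setT_connected : connected (~` (set0 : set C)).
Proof.
apply: path_connected => p q _ _.
exists (fun t => p + ofR t * (q - p)); split => [t|||t _ []].
- apply: cvgD; first exact: cvg_cst.
  by apply: cvgM; [exact: continuous_ofR|exact: cvg_cst].
- by rewrite ofR0 mul0r addr0.
- by rewrite ofR1 mul1r addrC subrK.
Qed.

(* Either the segment from [p] to [q] or a parabola over it avoids [c]. *)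
Lemma punctured_connected (c : C) : connected (~` [set c]).
Proof.
apply: path_connected => p q /= pc qc.
pose gamma s t := p + (ofR t + ofR (s * (t * (1 - t))) * iC) * (q - p).
have gamma_c s : continuous (gamma s).
  move=> t; apply: cvgD; first exact: cvg_cst.
  apply: cvgM; last exact: cvg_cst.
  apply: cvgD; first exact: continuous_ofR.
  apply: cvgM; last exact: cvg_cst.
  apply: (@cvg_comp _ _ _ (fun t => s * (t * (1 - t))) ofR); last exact: continuous_ofR.
  apply: cvgM; first exact: cvg_cst.
  apply: cvgM; first exact: cvg_id.
  by apply: cvgB; [exact: cvg_cst|exact: cvg_id].
have gamma0 s : gamma s 0 = p.
  by rewrite /gamma mul0r mulr0 !ofR0 mul0r addr0 mul0r addr0.
have gamma1 s : gamma s 1 = q.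
  by rewrite /gamma subrr !mulr0 ofR0 ofR1 mul0r addr0 mul1r addrC subrK.
have [qp|qp] := eqVneq q p.
  exists (gamma 0); split => // t _ /=.
  by rewrite /gamma qp subrr mulr0 addr0.
have qp0 : q - p != 0 by rewrite subr_eq0.
pose v := (c - p) / (q - p).
have vP s t : gamma s t = c -> v = ofR t + ofR (s * (t * (1 - t))) * iC.
  by move=> E; rewrite /v -E /gamma addrC addKr mulfK.
have vIm s t : gamma s t = c -> cIm v = s * (t * (1 - t)) /\ cRe v = t.
  move=> /vP ->; rewrite cImD cImM cReD cReM !cRe_ofR !cIm_ofR cRe_iC cIm_iC.
  by split; ring.
have [v0|v0] := eqVneq (cIm v) 0; last first.
  exists (gamma 0); split => // t _ /= /vIm[].
  by rewrite mul0r => /eqP; rewrite (negbTE v0).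
(* On the parabola the imaginary part [t * (1 - t)] vanishes only at the endpoints. *)
exists (gamma 1); split => // t t01 /= E.
have [Iv _] := vIm _ _ E; move: Iv; rewrite v0 mul1r => /esym/eqP.
rewrite mulf_eq0 subr_eq0 => /orP[/eqP t0|/eqP t1].
  by apply: pc; rewrite -E t0 gamma0.
by apply: qc; rewrite -E -t1 gamma1.
Qed.

Lemma polar z : exists theta : R,
  z = ofR (modulus z) * (ofR (cos theta) + ofR (sin theta) * iC).
Proof.
have [->|z0] := eqVneq z 0; first by exists 0; rewrite modulus0 ofR0 mul0r.
have m0 : 0 < modulus z by rewrite modulus_gt0.
pose x := cRe z / modulus z; pose y := cIm z / modulus z.
have xy : x ^+ 2 + y ^+ 2 = 1.
  rewrite /x /y !exprMn -mulrDl exprVn.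
  have -> : cRe z ^+ 2 + cIm z ^+ 2 = modulus z ^+ 2.
    by rewrite modulusE sqr_sqrtr // addr_ge0 // sqr_ge0.
  by rewrite divff // expf_neq0 // gt_eqF.
have x1 : -1 <= x <= 1.
  rewrite -ler_norml normrM normfV (gtr0_norm m0) ler_pdivrMr // mul1r.
  exact: le_Re_modulus.
have y2 : Num.sqrt (1 - x ^+ 2) = `|y|.
  by rewrite -xy addrC addKr sqrtr_sqr.
have [_ cx] := acos_def x1; have sx := sin_acos x1.
have E (th : R) : cos th = x -> sin th = y ->
    z = ofR (modulus z) * (ofR (cos th) + ofR (sin th) * iC).
  move=> -> ->; apply: complex_ext;
    rewrite !(cReD, cImD, cReM, cImM) !cRe_ofR !cIm_ofR cRe_iC cIm_iC /x /y;
    by field; rewrite gt_eqF.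
have [y0|y0] := lerP 0 y.
  by exists (acos x); apply: E => //; rewrite sx y2 ger0_norm.
exists (- acos x); apply: E; first by rewrite cosN.
by rewrite sinN sx y2 ltr0_norm // opprK.
Qed.

Lemma modulus_cis (theta : R) : modulus (ofR (cos theta) + ofR (sin theta) * iC) = 1.
Proof.
rewrite modulusE !(cReD, cImD, cReM, cImM) !cRe_ofR !cIm_ofR cRe_iC cIm_iC.
rewrite (_ : _ + _ = cos theta ^+ 2 + sin theta ^+ 2); last by ring.
by rewrite cos2Dsin2 sqrtr1.
Qed.

(** Interpolating modulus and argument separately keeps the moduli on the path between those of its
    ends. *)
Lemma rotation_invariant_connected (I : set R) : is_interval I ->
  (forall x, I x -> 0 <= x) -> connected [set z : C | I (modulus z)].
Proof.
move=> Iint I0; apply: path_connected => p q /= Ip Iq.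
have [a Ea] := polar p; have [b Eb] := polar q.
pose line (x y t : R) := x + t * (y - x).
have line_c x y : continuous (line x y).
  move=> t; apply: cvgD; first exact: cvg_cst.
  by apply: cvgM; [exact: cvg_id|exact: cvg_cst].
pose gamma t := ofR (line (modulus p) (modulus q) t) *
  (ofR (cos (line a b t)) + ofR (sin (line a b t)) * iC).
have l0 x y : line x y 0 = x by rewrite /line mul0r addr0.
have l1 x y : line x y 1 = y by rewrite /line mul1r addrC subrK.
exists gamma; split.
- move=> t; apply: cvgM.
    by apply: (@cvg_comp _ _ _ (line _ _) ofR); [exact: line_c|exact: continuous_ofR].
  apply: cvgD.
    apply: (@cvg_comp _ _ _ (fun t => cos (line a b t)) ofR); last exact: continuous_ofR.
    by apply: (@cvg_comp _ _ _ (line a b) cos); [exact: line_c|exact: continuous_cos].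
  apply: cvgM; last exact: cvg_cst.
  apply: (@cvg_comp _ _ _ (fun t => sin (line a b t)) ofR); last exact: continuous_ofR.
  by apply: (@cvg_comp _ _ _ (line a b) sin); [exact: line_c|exact: continuous_sin].
- by rewrite /gamma !l0 -Ea.
- by rewrite /gamma !l1 -Eb.
move=> t /andP[t0 t1]; rewrite /gamma modulusM modulus_cis mulr1 modulus_ofR.
have Iline : I (line (modulus p) (modulus q) t).
  have h1 : 0 <= 1 - t by lra.
  rewrite /line; have [pq|qp] := lerP (modulus p) (modulus q).
    apply: (Iint _ _ Ip Iq); have := mulr_ge0 t0 (_ : 0 <= modulus q - modulus p).
    have := mulr_ge0 h1 (_ : 0 <= modulus q - modulus p).
    rewrite subr_ge0 => /(_ pq) h2 /(_ pq) h3; apply/andP; split; lra.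
  have pq : 0 <= modulus p - modulus q by lra.
  apply: (Iint _ _ Iq Ip); have := mulr_ge0 t0 pq; have := mulr_ge0 h1 pq.
  by move=> h2 h3; apply/andP; split; lra.
by rewrite ger0_norm ?I0.
Qed.

Lemma annulus_connected (r : R) : 0 <= r ->
  connected [set z : C | r < modulus z /\ modulus z < 1].
Proof.
move=> r0; apply: (@rotation_invariant_connected [set x | r < x /\ x < 1]).
  by move=> x y [rx x1] [ry y1] v /andP[xv vy] /=; split; lra.
by move=> x [rx _]; lra.
Qed.

Lemma exterior_connected (m : R) : 0 <= m -> connected [set z : C | m < modulus z].
Proof.
move=> m0; apply: (@rotation_invariant_connected [set x | m < x]).
  by move=> x y /= mx my v /andP[xv vy] /=; lra.
by move=> x /=; lra.
Qed.

Lemma disc_connected (c : C) (r : R) : connected [set z : C | modulus (z - c) < r].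
Proof.
apply: path_connected => p q /= pc qc.
exists (fun t => p + ofR t * (q - p)); split => [t||| t /andP[t0 t1] /=].
- apply: cvgD; first exact: cvg_cst.
  by apply: cvgM; [exact: continuous_ofR|exact: cvg_cst].
- by rewrite ofR0 mul0r addr0.
- by rewrite ofR1 mul1r addrC subrK.
have -> : p + ofR t * (q - p) - c = ofR (1 - t) * (p - c) + ofR t * (q - c).
  by rewrite ofRD ofRN ofR1; ring.
apply: le_lt_trans (modulusD _ _) _; rewrite !modulusM !modulus_ofR.
have h1 : 0 <= 1 - t by lra.
rewrite !ger0_norm //.
pose M := Num.max (modulus (p - c)) (modulus (q - c)).
have Mr : M < r by rewrite gt_max pc qc.
apply: le_lt_trans Mr.
have -> : M = (1 - t) * M + t * M by ring.
by apply: lerD; apply: ler_wpM2l => //; rewrite le_max lexx ?orbT.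
Qed.

Lemma compact_compl_open K : compact K -> open (~` K).
Proof.
move=> cK; apply/open_modulusP => z Kz; have [e e0 He] := compact_far_point cK Kz.
by exists e => // w wz Kw; have := He _ Kw; lra.
Qed.

Lemma connected_setU_disc K (r : R) : compact K -> K `&` @unit_disc R = set0 ->
  connected (~` K) -> 0 <= r < 1 ->
  connected (~` (K `|` [set z | modulus z <= r])).
Proof.
move=> cK KD conK /andP[r0 r1] B [b Bb] [C1 oC1 BC1] [C2 cC2 BC2].
set E := [set z : C | modulus z <= r] in BC1 BC2 *.
have DK w : modulus w < 1 -> ~ K w.
  move=> w1 Kw; have : (K `&` @unit_disc R) w by split => //=; rewrite -lt_modulus ofR1 in w1.
  by rewrite KD.
have oL : open (~` (K `|` E)).
  rewrite setCU; apply: openI; first exact: compact_compl_open.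
  exact: compact_compl_open (@closed_disc_compact R r).
have oB : open B by rewrite BC1; exact: openI.
have oB' : open (~` (K `|` E) `&` ~` B).
  have -> : ~` (K `|` E) `&` ~` B = ~` (K `|` E) `&` ~` C2.
    rewrite BC2; apply/seteqP; split => w /= [Lw H]; split => //.
      by move=> C2w; apply: H.
    by case.
  by apply: openI => //; exact: closed_openC.
have BL w : B w -> ~ (K w \/ E w) by rewrite BC1 => -[].
pose A : set C := [set z | r < modulus z /\ modulus z < 1].
have AL w : A w -> ~ (K w \/ E w).
  by move=> [rw w1] [/(DK _ w1)//|]; rewrite /E /=; lra.
have oD : open [set z : C | modulus z < 1].
  apply/open_modulusP => z /= z1; exists (1 - modulus z); first by rewrite subr_gt0.
  by move=> w wz; have := modulus_le_add w z; lra.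
(* The annulus lies on one side of a separation of the complement of [K `|` E];
   adding the unit disc to that side separates the complement of [K]. *)
have split_K (U V : set C) : open U -> open V -> (forall w, U w -> ~ (K w \/ E w)) ->
    (forall w, V w -> ~ (K w \/ E w)) -> (forall w, ~ (K w \/ E w) -> U w \/ V w) ->
    (forall w, U w -> V w -> False) -> (forall w, A w -> U w) -> forall w, ~ V w.
  move=> oU oV UL VL UV UVd AU v Vv.
  suff VK : V = ~` K.
    have : V 0 by rewrite VK => /= ; apply: DK; rewrite modulus0.
    by move=> /VL; apply; right; rewrite /E /= modulus0.
  apply: conK; first by exists v.
    by exists V => //; apply/seteqP; split => [w Vw|w []//]; split => // Kw; apply: (VL _ Vw); left.
  exists (~` (U `|` [set z | modulus z < 1])); first by rewrite closedC; exact: openU.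
  apply/seteqP; split => w /=.
    move=> Vw; split; first by move=> Kw; apply: (VL _ Vw); left.
    move=> [Uw|w1]; first exact: UVd Uw Vw.
    have [Ew|Ew] := lerP (modulus w) r; first by apply: (VL _ Vw); right.
    exact: UVd (AU _ (conj Ew w1)) Vw.
  move=> [Kw Uw]; have [] // := UV w.
    move=> [//|]; rewrite /E /= => wr; apply: Uw; right; lra.
  by move=> ?; exfalso; apply: Uw; left.
have [AB|AB] := pselect (exists a, A a /\ B a).
  have AsubB : A `&` B = A.
    apply: (annulus_connected r0); first by case: AB => a [? ?]; exists a.
      exists C1 => //; rewrite BC1; apply/seteqP; split => w /=; first by case=> ? [].
      by move=> [Aw C1w]; split => //; split => //; exact: AL.
    exists C2 => //; rewrite BC2; apply/seteqP; split => w /=; first by case=> ? [].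
    by move=> [Aw C2w]; split => //; split => //; exact: AL.
  apply/seteqP; split => [w /BL//|w Lw].
  apply: contrapT => nBw.
  apply: (@split_K B (~` (K `|` E) `&` ~` B) _ _ _ _ _ _ _ w) => //.
  - by move=> v [].
  - by move=> v Lv; have [|] := pselect (B v); [left|right].
  - by move=> v Bv [_].
  - by move=> v; rewrite -AsubB => -[].
exfalso; apply: (@split_K (~` (K `|` E) `&` ~` B) B _ _ _ _ _ _ _ b) => //.
- by move=> v [].
- by move=> v Lv; have [|] := pselect (B v); [right|left].
- by move=> v [_ nB] /nB.
- by move=> v Av; split; [exact: AL|move=> Bv; apply: AB; exists v].
Qed.

End Connectivity.

(** * Taylor coefficients, and assertion (2) *)

Section PolyEstimates.
Context {R : realType}.
Local Notation C := (Cplx R).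
Implicit Types (p q : {poly C}) (z w : C) (r s : R).

(** Take [n] successive square roots of -1: the [2 ^ n]-th power is -1, so no smaller power of 2 can
    be the order. *)
Lemma exists_prim_root n : exists w : C, (2 ^ n.+1).-primitive_root w.
Proof.
pose u := fix u n : C := if n is n'.+1 then sqrtC (u n') else -1.
have u2 m : u m.+1 ^+ 2 = u m by rewrite /= sqrtCK.
have uN m : u m ^+ (2 ^ m) = -1.
  by elim: m => [|m IH]; [rewrite expn0 expr1|rewrite expnS exprM u2].
have u1 : u n ^+ (2 ^ n.+1) = 1 by rewrite expnSr exprM uN sqrrN expr1n.
have [|m mp] := prim_order_exists _ u1; first by rewrite expn_gt0.
move=> /(dvdn_pfactor _ _ (isT : prime 2)) [k kn mE]; exists (u n).
move: kn; rewrite leq_eqVlt => /orP[/eqP <-|kn]; first by rewrite -mE.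
have : u n ^+ (2 ^ n) = 1.
  by apply/eqP; rewrite -(prim_order_dvd mp) mE dvdn_exp2l.
rewrite uN => E; have /eqP : (1 + 1 : C) = 0 by rewrite -{1}E addNr.
by rewrite -(natrD _ 1 1) pnatr_eq0.
Qed.

(* The mean over the [2 ^ m]-th roots of unity of order above the degree replaces
   Cauchy's integral formula. *)
Lemma cauchy_coef p r B k : 0 <= r ->
  (forall z, modulus z <= r -> modulus p.[z] <= B) -> modulus p`_k * r ^+ k <= B.
Proof.
move=> r0 HB; have B0 : 0 <= B.
  by apply: le_trans (HB 0 _); rewrite ?modulus0.
have [kp|kp] := leqP (size p) k; first by rewrite nth_default // modulus0 mul0r.
have [w wp] := exists_prim_root (size p).
set N := (2 ^ (size p).+1)%N in wp.
have pN : (size p <= N)%N by apply: ltnW; apply: ltn_trans (ltn_expl _ _).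
have kN : (k < N)%N by exact: leq_trans kp pN.
have N0 : (0 < N)%N by rewrite expn_gt0.
have w1 : w ^+ N = 1 := prim_expr_order wp.
have mw : modulus w = 1.
  apply/eqP; rewrite -(@pexpr_eq1 _ (modulus w) N) //.
  by rewrite -modulusX w1 modulus1.
have geo i : (i < size p)%N -> i != k -> \sum_(j < N) (w ^+ (i + (N - k))) ^+ j = 0.
  move=> ip ik; have x1 : w ^+ (i + (N - k)) != 1.
    rewrite -(prim_order_dvd wp); apply/negP => /dvdnP[c].
    have iN := leq_trans ip pN.
    case: c => [|[|c]]; rewrite ?mul0n ?mul1n; [lia|move/eqP; lia|nia].
  have := subrX1 (w ^+ (i + (N - k))) N.
  rewrite -exprM mulnC exprM w1 expr1n subrr => /esym/eqP.
  by rewrite mulf_eq0 subr_eq0 (negbTE x1) => /eqP.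
have E : \sum_(j < N) p.[ofR r * w ^+ j] * (w ^+ (N - k)) ^+ j =
    N%:R * (p`_k * ofR r ^+ k).
  under eq_bigr do rewrite horner_coef mulr_suml.
  rewrite exchange_big /= (bigD1 (Ordinal kp)) //= [X in _ + X]big1 ?addr0.
    rewrite (_ : N%:R * _ = \sum_(j < N) (p`_k * ofR r ^+ k)); last first.
      by rewrite sumr_const card_ord mulr_natl.
    apply: eq_bigr => j _; rewrite exprMn -!mulrA; congr (_ * _); rewrite -[RHS]mulr1; congr (_ * _).
    by rewrite -exprM -exprM mulnC -exprD -mulnDl subnKC ?(ltnW kN) // exprM w1 expr1n.
  move=> i; rewrite -val_eqE /= => ik.
  transitivity (p`_i * ofR r ^+ i * \sum_(j < N) (w ^+ (i + (N - k))) ^+ j); last first.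
    by rewrite geo // mulr0.
  rewrite mulr_sumr.
  apply: eq_bigr => j _; rewrite exprMn -!mulrA; congr (_ * (_ * _)).
  by rewrite -!exprM -exprD mulnC -mulnDl.
have NR : 0 < N%:R :> R by rewrite ltr0n.
rewrite -(ler_pM2l NR) -{1}(ger0_norm r0) -(modulus_ofR r) -(modulus_nat N).
rewrite -modulusX -!modulusM -E; apply: le_trans (modulus_sum _ _ _) _.
rewrite modulus_nat (_ : N%:R * B = \sum_(j < N) B); last first.
  by rewrite sumr_const card_ord mulr_natl.
apply: ler_sum => j _; rewrite modulusM !modulusX mw !expr1n mulr1 HB //.
by rewrite modulusM modulusX mw expr1n mulr1 modulus_ofR ger0_norm.
Qed.

(** Both bounds are coefficient estimates for the expansion of [p] at [c]; the remainder is
    dominated by a geometric series of ratio 1/2. *)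
Lemma cauchy_deriv p (c : C) s B : 0 < s ->
  (forall z, modulus (z - c) <= s -> modulus p.[z] <= B) ->
  modulus p^`().[c] <= B / s /\
  forall w, modulus (w - c) <= s / 2 ->
    modulus (p.[w] - p.[c] - p^`().[c] * (w - c)) <=
      2 * B / s ^+ 2 * modulus (w - c) ^+ 2.
Proof.
move=> s0 HB; pose q := p \Po ('X + c%:P).
have qE z : q.[z] = p.[z + c] by rewrite horner_comp hornerD hornerX hornerC.
have Hq k : modulus q`_k * s ^+ k <= B.
  apply: cauchy_coef; first exact: ltW.
  by move=> z zs; rewrite qE HB // addrK.
have B0 : 0 <= B by apply: le_trans (HB c _); rewrite ?subrr ?modulus0 // ltW.
have q0 : q`_0 = p.[c] by rewrite -horner_coef0 qE add0r.
have q1 : q`_1 = p^`().[c].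
  have -> : q`_1 = q^`()`_0 by rewrite coef_deriv mulr1n.
  rewrite -horner_coef0 deriv_comp hornerM derivD derivX derivC addr0 hornerC mulr1.
  by rewrite horner_comp hornerD hornerX hornerC add0r.
split; first by rewrite -q1 ler_pdivlMr //; have := Hq 1; rewrite expr1.
move=> w wc; have -> : p.[w] = q.[w - c] by rewrite qE subrK.
set x := w - c in wc *.
have -> : q.[x] - p.[c] - p^`().[c] * x = \sum_(k < size q) q`_k.+2 * x ^+ k.+2.
  have sz : (size q <= (size q).+2)%N by rewrite ltnW.
  rewrite (horner_coef_wide x sz).
  by rewrite 2!big_ord_recl /= q0 q1 expr0 expr1 mulr1; ring.
apply: le_trans (modulus_sum _ _ _) _.
pose y := modulus x / s.
have y0 : 0 <= y by rewrite divr_ge0 // ltW.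
have y2 : y <= 1 / 2 by rewrite ler_pdivrMr //; lra.
apply: (@le_trans _ _ (\sum_(k < size q) B * y ^+ 2 * (1 / 2) ^+ k)).
  apply: ler_sum => k _; rewrite modulusM modulusX.
  have -> : modulus x = y * s by rewrite divfK // gt_eqF.
  rewrite exprMn mulrCA mulrA.
  apply: (@le_trans _ _ (B * y ^+ k.+2)).
    by rewrite -mulrA mulrC ler_wpM2r // ?exprn_ge0.
  rewrite -mulrA ler_wpM2l // -2!addn1 -addnA addnC exprD ler_wpM2l ?exprn_ge0 //.
  by apply: lerXn2r => //; rewrite nnegrE //; lra.
have geo m : \sum_(k < m) (1 / 2) ^+ k <= 2 - (1 / 2) ^+ m * 2 :> R.
  elim: m => [|m IH]; first by rewrite big_ord0 expr0; lra.
  by rewrite big_ord_recr /= exprS; lra.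
rewrite -mulr_sumr; apply: (@le_trans _ _ (B * y ^+ 2 * 2)).
  have By : 0 <= B * y ^+ 2 by apply: mulr_ge0 => //; apply: exprn_ge0.
  apply: ler_wpM2l => //; apply: le_trans (geo _) _.
  by rewrite gerBl mulr_ge0 // exprn_ge0 // divr_ge0.
rewrite /y exprMn exprVn le_eqVlt; apply/orP; left; apply/eqP; field.
by rewrite gt_eqF.
Qed.

(** The monotone rate bounds [u m - u n] by [2 e n] for all [m >= n], which is the Cauchy condition
    in terms of [n] alone. *)
Definition unif_limit (u : nat -> {poly C}) (f : C -> C) (r : R) :=
  exists e : nat -> R, [/\ e @ \oo --> 0, (forall n m, (n <= m)%N -> e m <= e n) &
    forall n z, modulus z < r -> modulus ((u n).[z] - f z) <= e n].

(** Weierstrass's theorem. The quadratic remainder bound of [cauchy_deriv] is uniform in [n], so it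
    passes to the limit and identifies the derivative of [f]. *)
Lemma unif_limit_deriv u f (r' r : R) : r' < r -> unif_limit u f r ->
  (forall z, modulus z < r' -> cdiff_at f z (derive1 f z)) /\
  unif_limit (fun n => (u n)^`()) (derive1 f) r'.
Proof.
move=> rr [e [e0 edec ue]]; have [s [s0 sE]] : exists s, 0 < s /\ s = (r - r') / 2.
  by exists ((r - r') / 2); rewrite divr_gt0 // subr_gt0.
have e_ge0 z : modulus z < r -> forall n, 0 <= e n.
  by move=> zr n; apply: le_trans (ue n z zr).
have in_r c z : modulus c < r' -> modulus (z - c) <= s -> modulus z < r.
  by move=> cr zc; have := modulus_le_add z c; rewrite sE in zc; lra.
pose e' n := (e n + e n) / s.
have e'0 : e' @ \oo --> 0.
  have -> : 0 = (0 + 0) / s by rewrite addr0 mul0r.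
  by apply: cvgMl; exact: cvgD.
have ex_lim c : modulus c < r' -> exists l, forall n, modulus ((u n)^`().[c] - l) <= e' n.
  move=> cr; apply: (@cplx_cauchy_cvg R (fun n => (u n)^`().[c])) => // n m nm.
  rewrite -hornerN -hornerD -derivB.
  apply: (cauchy_deriv (p := u m - u n) s0 _).1 => z zc.
  have zr := in_r c z cr zc.
  rewrite hornerD hornerN; apply: le_trans (modulus_dist _ _ (f z)) _.
  apply: lerD; first by apply: le_trans (ue m z zr) _; exact: edec.
  by rewrite modulusBC ue.
have [M HM] : exists M, forall n z, modulus z < r -> modulus (u n).[z] <= M.
  pose S := \sum_(k < size (u 0)) modulus (u 0)`_k * r ^+ k.
  exists (S + (e 0 + e 0)) => n z zr.
  have : modulus (u 0).[z] <= S by apply: modulus_horner_le; exact: ltW.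
  have := ue n z zr; have := ue 0 z zr; have := edec 0 n isT.
  have := modulus_dist (u n).[z] (u 0).[z] (f z).
  have := modulus_le_add (u n).[z] (u 0).[z].
  rewrite (modulusBC (f z) (u 0).[z]); lra.
have cd c l : modulus c < r' -> (forall n, modulus ((u n)^`().[c] - l) <= e' n) ->
    cdiff_at f c l.
  move=> cr Hl eps eps0; have [k kE] : exists k, k = 2 * M / s ^+ 2 by exists (2 * M / s ^+ 2).
  have M0 : 0 <= M by apply: le_trans (HM 0 c _) => //; apply: (in_r c) => //; rewrite subrr modulus0 ltW.
  have k0 : 0 <= k.
    by rewrite kE; apply: divr_ge0; [apply: mulr_ge0|apply: exprn_ge0; apply: ltW].
  have k1 : 0 < k + 1 by lra.
  exists (Num.min (s / 2) (eps / (k + 1))).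
    by rewrite lt_min !divr_gt0.
  move=> w; rewrite lt_min => /andP[ws we].
  have ws' : modulus (w - c) <= s by lra.
  have lim_le : modulus (f w - f c - l * (w - c)) <= k * modulus (w - c) ^+ 2.
    apply/ler_addgt0Pr => d d0.
    pose t n := e n + e n + e' n * modulus (w - c).
    have t0 : t @ \oo --> 0.
      have -> : 0 = 0 + 0 + 0 * modulus (w - c) by rewrite mul0r !addr0.
      by apply: cvgD; [exact: cvgD|exact: cvgMl].
    have [n _ /(_ n (leqnn n)) tn] : \forall n \near \oo, t n < d by apply: (cvgr_lt 0).
    have h1 := ue n w (in_r c w cr ws').
    have cr' : modulus c < r by apply: (in_r c) => //; rewrite subrr modulus0 ltW.
    have h2 := ue n c cr'.
    have h3 : modulus (((u n)^`().[c] - l) * (w - c)) <= e' n * modulus (w - c).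
      by rewrite modulusM ler_wpM2r // Hl.
    have [_ /(_ w (ltW ws)) h4] := cauchy_deriv (p := u n) s0
      (fun z zc => HM n z (in_r c z cr zc)).
    have -> : f w - f c - l * (w - c) = ((u n).[w] - (u n).[c] - (u n)^`().[c] * (w - c))
      - ((u n).[w] - f w) + (((u n).[c] - f c) + ((u n)^`().[c] - l) * (w - c)) by ring.
    apply: le_trans (modulusD _ _) _.
    have := modulusB ((u n).[w] - (u n).[c] - (u n)^`().[c] * (w - c)) ((u n).[w] - f w).
    have := modulusD ((u n).[c] - f c) (((u n)^`().[c] - l) * (w - c)).
    by move: tn; rewrite -kE in h4; rewrite /t => tn; lra.
  apply: le_trans lim_le _; rewrite expr2 mulrA ler_wpM2r //.
  move: we; rewrite ltr_pdivlMr // => we.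
  by have := modulus_ge0 (w - c); nra.
split=> [c cr|]; first by have [l Hl] := ex_lim c cr; rewrite (cdiff_derive1 (cd c l cr Hl)); exact: cd Hl.
exists e'; split => // [n m nm|n c cr].
  by rewrite /e' ler_pM2r ?invr_gt0 //; have := edec n m nm; lra.
by have [l Hl] := ex_lim c cr; rewrite (cdiff_derive1 (cd c l cr Hl)).
Qed.

Lemma unif_limit_derivn u f (r' r : R) k : r' < r -> unif_limit u f r ->
  unif_limit (fun n => (u n)^`(k)) (derive1n k f) r'.
Proof.
move=> rr uf; elim: k r' rr => [|k IH] r' rr.
  have [e [e0 edec ue]] := uf; exists e; split => // n z zr.
  by apply: ue; exact: lt_trans zr rr.
have rm : (r' + r) / 2 < r by lra.
have rm' : r' < (r' + r) / 2 by lra.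
exact: (unif_limit_deriv rm' (IH _ rm)).2.
Qed.

Lemma unif_limit_coef u f r k : 0 < r -> unif_limit u f r ->
  exists e : nat -> R, e @ \oo --> 0 /\
    forall n, modulus ((u n)`_k - derive1n k f 0 / k`!%:R) <= e n.
Proof.
move=> r0 uf; have r2 : r / 2 < r by lra.
have [e [e0 _ ue]] := unif_limit_derivn k r2 uf.
have k0 : 0 < k`!%:R :> R by rewrite ltr0n fact_gt0.
have kn : (k`!%:R : C) != 0 by rewrite pnatr_eq0 -lt0n fact_gt0.
exists (fun n => e n / k`!%:R); split.
  by rewrite -(mul0r (k`!%:R^-1)); exact: cvgMl.
move=> n; rewrite ler_pdivlMr // -(modulus_nat k`!) -modulusM mulrBl divfK //.
have -> : (u n)`_k * k`!%:R = (u n)^`(k).[0].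
  by rewrite horner_coef0 coef_derivn addn0 ffactnn mulr_natr.
by apply: ue; rewrite modulus0 divr_gt0.
Qed.

End PolyEstimates.

(** * Modulus forms of the definitions, and assertion (2) *)

Section Bridges.
Context {R : realType}.
Local Notation C := (Cplx R).
Implicit Types (z w : C) (K : set C) (alpha : nat -> nat -> C).

Lemma uniform_cvg_modulusP K (F : nat -> C -> C) (h : C -> C) :
  {uniform K, F @ \oo --> h} <-> forall e : R, 0 < e -> exists N, forall n z,
    (N <= n)%N -> K z -> modulus (F n z - h z) < e.
Proof.
split=> H.
  move=> e e0; have e0' : (0 : C) < ofR e by rewrite /ofR ltcR.
  have /H [N _ HN] : nbhs (h : {uniform` K -> C})
      [set g | forall y, K y -> modulus (h y - g y) < e].
    apply/uniform_nbhs; exists [set xy : C * C | ball xy.1 (PosNum e0')%:num xy.2].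
    split; first exact: entourage_ball.
    by move=> g Hg y /Hg; rewrite -ball_normE /= lt_modulus.
  by exists N => n z Nn Kz; rewrite modulusBC; apply: (HN n Nn).
move=> P /uniform_nbhs [E [entE HE]].
move: entE; rewrite -entourage_ballE => -[e /= e0 He].
have eE : e = ofR (complex.Re e) by rewrite /ofR RRe_real ?ger0_real ?ltW.
have e0' : 0 < complex.Re e by move: e0; rewrite eE /ofR ltcR.
have [N HN] := H _ e0'; exists N => // n /= Nn; apply: HE => y Ky; apply: He => /=.
by rewrite -ball_normE /= eE lt_modulus modulusBC; exact: HN.
Qed.

Lemma unit_discE z : unit_disc z <-> modulus z < 1.
Proof. by rewrite /unit_disc /= -lt_modulus ofR1. Qed.

Lemma nroot_le (c : R) n z : 0 < c -> (0 < n)%N ->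
  (nroot_modulus n z <= c%:E)%E = (modulus z <= c ^+ n).
Proof.
move=> c0 n0; rewrite /nroot_modulus lee_fin.
have nR : 0 < n%:R :> R by rewrite ltr0n.
have E : modulus z = powR (modulus z) n%:R^-1 ^+ n.
  by rewrite -powR_mulrn ?powR_ge0 // -powRrM mulVf ?gt_eqF // powRr1.
by rewrite {2}E ler_pXn2r ?nnegrE ?powR_ge0 // ltW.
Qed.

Lemma max_root_lt1 alpha : (limn_esup (max_root alpha) < 1%:E)%E ->
  exists c : R, 0 < c < 1 /\ exists n0, forall n k, (n0 <= n)%N -> (k <= n)%N ->
    modulus (alpha n k) <= c ^+ n.
Proof.
rewrite /limn_esup /limf_esup => /ereal_inf_lt [_ [V [N _ HV] <-]] supV.
have max_le n : (N <= n)%N -> (max_root alpha n <= ereal_sup (max_root alpha @` V))%E.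
  by move=> Nn; apply: ereal_sup_ubound; exists n => //; exact: HV.
have [s sV s1] : exists2 s : R, (ereal_sup (max_root alpha @` V) <= s%:E)%E & s < 1.
  move: supV; case: (ereal_sup _) => [s| |] //; first by rewrite lte_fin; exists s.
  by move=> _; exists 0; [exact: leNye|exact: ltr01].
(* The maximum ensures a positive base, and [N.+1] below excludes [n = 0], where the root is a
   convention. *)
exists (Num.max s (1 / 2)); split.
  by rewrite lt_max gt_max s1; apply/andP; split; [apply/orP; right|]; lra.
exists N.+1 => n k Nn kn.
rewrite -nroot_le; last 2 first.
- by rewrite lt_max; apply/orP; right; lra.
- by case: n Nn kn.
apply: le_trans (_ : max_root alpha n <= _)%E.
  by rewrite /max_root -[k]/(val (Ordinal (kn : (k < n.+1)%N))); exact: le_bigmax.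
apply: le_trans (max_le n (ltnW Nn)) _; apply: le_trans sV _.
by rewrite lee_fin le_max lexx.
Qed.

Lemma min_root_ge1 alpha : (1%:E <= limn_esup (min_root alpha))%E ->
  forall (c : R) n0, 0 < c < 1 -> exists2 n, (n0 <= n)%N &
    forall k, (k <= n)%N -> c ^+ n <= modulus (alpha n k).
Proof.
(* [n0.+1] excludes [n = 0]. *)
move=> H c n0 /andP[c0 c1]; pose V := [set n | (n0.+1 <= n)%N].
have : (c%:E < ereal_sup (min_root alpha @` V))%E.
  apply: (@lt_le_trans _ _ 1%:E); first by rewrite lte_fin.
  by apply: le_trans H _; apply: ereal_inf_lbound; exists V => //; exists n0.+1.
move=> /ereal_sup_gt [_ [n Vn <-] cn]; exists n; first exact: ltnW.
move=> k kn; have n1 : (0 < n)%N by exact: leq_ltn_trans Vn.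
have : ~~ (nroot_modulus n (alpha n k) <= c%:E)%E.
  rewrite -ltNge; apply: lt_le_trans cn _.
  by rewrite /min_root -[k in (_ <= nroot_modulus _ (_ _ k))%E]/(val (Ordinal (kn : (k < n.+1)%N))); exact: bigmin_le.
by rewrite nroot_le // -ltNge => /ltW.
Qed.

Lemma holomorphic_within_continuous (A K : set C) (f : C -> C) :
  holomorphic_on A f -> K `<=` A -> {within K, continuous f}.
Proof.
move=> hf KA; apply/within_continuous_modulusP => z /KA /hf /derivable_cdiffP [l Hl] e e0.
have [d d0 Hd] := Hl _ (@ltr01 R).
have m0 : 0 < modulus l + 1 by rewrite ltr_wpDl.
exists (Num.min d (e / (modulus l + 1))); first by rewrite lt_min d0 divr_gt0.
move=> w _; rewrite lt_min ltr_pdivlMr // => /andP[wd we].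
have := Hd w wd; rewrite mul1r => h1.
have := modulus_le_add (f w - f z) (l * (w - z)); rewrite modulusM.
by lra.
Qed.

Lemma disc_reachable (r : R) : 0 <= r < 1 -> reachable [set z : C | modulus z <= r].
Proof.
move=> r01; apply: connected_reachable; first exact: closed_disc_compact.
rewrite -(set0U [set z : C | modulus z <= r]).
apply: connected_setU_disc => //; first exact: compact0.
  by rewrite set0I.
exact: setT_connected.
Qed.

Lemma cvg_geo0 (q : R) : 0 < q < 1 -> (fun n => q ^+ n) @ \oo --> (0 : R).
Proof. by move=> /andP[q0 q1]; apply: cvg_expr; rewrite gtr0_norm. Qed.

(** Mergelyan's theorem on the closed disc of radius [r] makes [f] a limit of polynomials, and the
    coefficient estimate for these passes to the limit. *)
Lemma taylor_coef_bound (f : C -> C) (r : R) : holomorphic_on (@unit_disc R) f ->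
  0 < r < 1 -> exists2 B : R, 0 < B & forall k,
    modulus (derive1n k f 0 / k`!%:R) * r ^+ k <= B.
Proof.
move=> hf /andP[r0 r1]; pose K : set C := [set z | modulus z <= r].
have cK : compact K by exact: closed_disc_compact.
have KD : K `<=` @unit_disc R.
  by move=> z zr; apply/unit_discE; exact: le_lt_trans zr r1.
have fc := holomorphic_within_continuous hf KD.
have [H H0 HH] := compact_continuous_bounded cK fc.
have ap : poly_approx K f.
  apply: mergelyan => //; first by apply: disc_reachable; rewrite ltW.
  move=> z /interior_subset /KD Dz; apply/derivable_cdiffP; exact: hf.
have /choice[u Hu] : forall n : nat, exists p : {poly C}, forall z, K z ->
    modulus (p.[z] - f z) <= 2^-1 ^+ n.
  by move=> n; apply: ap; rewrite exprn_gt0 // invr_gt0.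
have h01 : 0 < (2^-1 : R) < 1 by rewrite invr_gt0 invf_lt1 // ltr0n ltr1n.
have uf : unif_limit u f r.
  exists (fun n => 2^-1 ^+ n); split; first exact: cvg_geo0.
    move=> n m nm; apply: ler_wiXn2l => //; lra.
  by move=> n z zr; apply: Hu; exact: ltW.
exists (H + 1); first by rewrite addr_gt0.
move=> k; have [e [e0 He]] := unif_limit_coef k r0 uf.
apply/ler_addgt0Pr => d d0.
have rk : 0 < r ^+ k by rewrite exprn_gt0.
have [n _ /(_ n (leqnn n)) en] : \forall n \near \oo, e n < d / r ^+ k.
  by apply: (cvgr_lt 0) => //; rewrite divr_gt0.
have h1 : modulus (u n)`_k * r ^+ k <= H + 1.
  apply: cauchy_coef; first exact: ltW.
  move=> z zr; have := Hu n z zr; have := HH z zr.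
  have h2 : 2^-1 ^+ n <= 1 :> R by apply: exprn_ile1; lra.
  by have := modulus_le_add (u n).[z] (f z); lra.
set a := derive1n k f 0 / k`!%:R in He *.
have h2 := le_trans (He n) (ltW en); rewrite ler_pdivlMr // in h2.
have h3 := modulus_le_add a (u n)`_k; rewrite modulusBC in h3.
have := ler_wpM2r (ltW rk) h3; rewrite mulrDl; lra.
Qed.

Lemma modulus_weighted_taylor alpha (f : C -> C) (c r B : R) n :
  0 < r < 1 -> 0 <= B ->
  (forall k, modulus (derive1n k f 0 / k`!%:R) * r ^+ k <= B) ->
  0 <= c -> (forall k, (k <= n)%N -> modulus (alpha n k) <= c ^+ n) ->
  modulus (weighted_taylor alpha f n 1) <= B / (1 - r) * (c / r) ^+ n.
Proof.
move=> /andP[r0 r1] B0 HB c0 Hc; rewrite /weighted_taylor.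
apply: le_trans (modulus_sum _ _ _) _.
(* The terms [B / r ^ k] are summed backwards from the largest one, [k = n], as a geometric series
   of ratio [r]. *)
apply: (@le_trans _ _ (\sum_(k < n.+1) c ^+ n * (B / r ^+ n * r ^+ (n - k)))).
  apply: ler_sum => k _; have kn : (k <= n)%N by rewrite -ltnS.
  rewrite expr1n mulr1 modulusM; apply: ler_pM => //; first exact: Hc.
  have -> : B / r ^+ n * r ^+ (n - k) = B / r ^+ k.
    rewrite -[in r ^+ n](subnK kn) exprD; field.
    by rewrite !expf_neq0 // gt_eqF.
  by rewrite ler_pdivlMr ?exprn_gt0.
rewrite -mulr_sumr -mulr_sumr expr_div_n.
have geo : \sum_(k < n.+1) r ^+ (n - k) <= (1 - r)^-1.
  have -> : \sum_(k < n.+1) r ^+ (n - k) = \sum_(k < n.+1) r ^+ k.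
    by rewrite (reindex_inj rev_ord_inj) /=; apply: eq_bigr => i _; rewrite subSS subKn // -ltnS.
  have := subrX1 r n.+1; set S := \sum_(k < n.+1) _ => SE.
  rewrite -[leRHS]mul1r ler_pdivlMr ?subr_gt0 //.
  have : 0 <= r ^+ n.+1 by rewrite exprn_ge0 // ltW.
  by move: SE; lra.
have -> : B / (1 - r) * (c ^+ n / r ^+ n) = c ^+ n * (B / r ^+ n * (1 - r)^-1) by ring.
rewrite ler_wpM2l ?exprn_ge0 // ler_wpM2l // divr_ge0 // exprn_ge0 //; exact: ltW.
Qed.

Lemma universal_max_root alpha : universal alpha !=set0 ->
  (1%:E <= limn_esup (max_root alpha))%E.
Proof.
move=> [f [hf Uf]]; rewrite leNgt; apply/negP => /max_root_lt1.
move=> [c [/andP[c0 c1] [n0 Hc]]].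
(* A radius strictly between [c] and 1, so that the ratio [c / r] is below 1. *)
have r01 : 0 < (c + 1) / 2 < 1 by apply/andP; split; lra.
have [B B0 HB] := taylor_coef_bound hf r01; set r := (c + 1) / 2 in r01 HB.
have /andP[r0 r1] := r01.
have cr : 0 < c / r < 1.
  apply/andP; split; first by rewrite divr_gt0.
  by rewrite ltr_pdivrMr // mul1r /r; lra.
have [|||||lam lam_inc] := Uf [set 1] (fun=> 1).
- exact: compact_set1.
- apply/seteqP; split => // z [-> /unit_discE]; rewrite modulus1; lra.
- exact: punctured_connected.
- apply/within_continuous_modulusP => z _ e e0; exists 1 => // w _ _.
  by rewrite subrr modulus0.
- move=> z _; apply/derivable_cdiffP; exists 0 => e e0; exists 1 => // w _.
  by rewrite mul0r !subrr modulus0 mulr_ge0 // ltW.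
move=> /uniform_cvg_modulusP /(_ (1 / 2)) [|N HN]; first by rewrite divr_gt0.
have lam_ge n : (n <= lam n)%N.
  elim: n => // n IH; apply: leq_ltn_trans IH _.
  have := lam_inc n.+1 n; rewrite !leEnat ltnn => H.
  by rewrite ltnNge H.
have small : (fun n => B / (1 - r) * (c / r) ^+ n) @ \oo --> 0.
  by rewrite -(mulr0 (B / (1 - r))); apply: cvgMr; exact: cvg_geo0.
have [N2 _ HN2] : \forall n \near \oo, B / (1 - r) * (c / r) ^+ n < 1 / 2.
  by apply: (cvgr_lt 0) => //; rewrite divr_gt0.
pose n := (N + N2 + n0)%N.
have ln : (n <= lam n)%N := lam_ge n.
have h1 := HN n 1 (leq_trans (leq_addr _ _) (leq_addr _ _)) erefl.
have h2 := HN2 (lam n) (leq_trans (leq_trans (leq_addl _ _) (leq_addr _ _)) ln).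
have h3 := @modulus_weighted_taylor alpha f c r B (lam n) r01 (ltW B0) HB (ltW c0)
  (fun k => Hc (lam n) k (leq_trans (leq_addl _ _) ln)).
have := modulus_le_add 1 (weighted_taylor alpha f (lam n) 1).
by rewrite modulus1 modulusBC; lra.
Qed.

End Bridges.

(** * Polynomial blocks, and assertion (1) *)

Section BinomialTail.
Context {R : realType}.
Local Notation C := (Cplx R).

Lemma bernoulli (x : R) n : 0 <= x <= 1 -> 1 - n%:R * x <= (1 - x) ^+ n.
Proof.
move=> /andP[x0 x1]; elim: n => [|n IH]; first by rewrite mul0r subr0 expr0.
have x1' : 0 <= 1 - x by lra.
rewrite exprS; apply: le_trans (ler_wpM2l x1' IH); rewrite -natr1.
have : 0 <= n%:R * x ^+ 2 :> R by rewrite mulr_ge0 // exprn_ge0.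
lra.
Qed.

Lemma ler_exprn2 (a b : R) n : 0 <= a -> a <= b -> a ^+ n <= b ^+ n.
Proof.
by move=> a0 ab; apply: lerXn2r => //; rewrite nnegrE // (le_trans a0).
Qed.

(* The probability of at least [M] successes in [2 M] trials: close to 0 where [u]
   is, and close to 1 where [u] is. *)
Definition binom_tail (M : nat) (u : {poly C}) : {poly C} :=
  \sum_(j < (M + M).+1 | (M <= j)%N)
    'C(M + M, j)%:R *: (u ^+ j * (1 - u) ^+ (M + M - j)).

Lemma binom_tail_horner M u z : (binom_tail M u).[z] =
  \sum_(j < (M + M).+1 | (M <= j)%N)
    'C(M + M, j)%:R * (u.[z] ^+ j * (1 - u.[z]) ^+ (M + M - j)).
Proof.
rewrite horner_sum; apply: eq_bigr => j _.
by rewrite hornerZ hornerM !horner_exp hornerD hornerN hornerC.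
Qed.

Lemma sum_binom n : \sum_(j < n.+1) 'C(n, j)%:R = 2 ^+ n :> R.
Proof.
rewrite -[2]/(1 + 1) exprDn; apply: eq_bigr => j _.
by rewrite !expr1n mulr1.
Qed.

Lemma pow_le_mix (x y : R) M t : 0 <= x -> x <= y -> (t <= M)%N ->
  x ^+ (M + t) * y ^+ (M - t) <= (x * y) ^+ M.
Proof.
move=> x0 xy tM; rewrite exprD -mulrA exprMn ler_wpM2l ?exprn_ge0 //.
have y0 : 0 <= y by exact: le_trans xy.
rewrite -[in leRHS](subnKC tM) exprD ler_wpM2r ?exprn_ge0 //.
by apply: ler_exprn2.
Qed.

(** The tolerance 1/16 originates here: [4 ^ M] is the total of the binomial coefficients, and
    [4 * (1 / 16) * (17 / 16) = 17 / 64] is below 1/2. *)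
Lemma pow_17_64 M : 2 ^+ (M + M) * (1 / 16 * (17 / 16)) ^+ M <= 2^-1 ^+ M :> R.
Proof.
by rewrite exprD -exprMn -exprMn; apply: ler_exprn2; lra.
Qed.

Lemma binom_tail_small M u z : modulus u.[z] <= 1 / 16 ->
  modulus (binom_tail M u).[z] <= 2^-1 ^+ M.
Proof.
move=> uz; apply: le_trans (pow_17_64 M); rewrite binom_tail_horner.
have u1 : modulus (1 - u.[z]) <= 17 / 16.
  by apply: le_trans (modulusB _ _) _; rewrite modulus1; lra.
apply: le_trans (modulus_sum _ _ _) _; rewrite -sum_binom mulr_suml.
rewrite [leRHS](bigID (fun j : 'I__ => (M <= j)%N)) /= -[leLHS]addr0; apply: lerD.
  apply: ler_sum => j Mj; have j2 : (j <= M + M)%N by rewrite -ltnS.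
  rewrite modulusM modulus_nat ler_wpM2l // modulusM !modulusX.
  apply: (@le_trans _ _ ((1 / 16) ^+ j * (17 / 16) ^+ (M + M - j))).
    by apply: ler_pM; rewrite ?exprn_ge0 //; apply: ler_exprn2 => //; lra.
  rewrite -{1}(subnKC Mj) (_ : M + M - j = M - (j - M))%N; last by lia.
  by apply: pow_le_mix; [lra|lra|lia].
by apply: sumr_ge0 => j _; rewrite mulr_ge0 // exprn_ge0 // mulr_ge0 //; lra.
Qed.

Lemma binom_tail_near1 M u z : modulus (u.[z] - 1) <= 1 / 16 ->
  modulus (1 - (binom_tail M u).[z]) <= 2^-1 ^+ M.
Proof.
move=> uz; apply: le_trans (pow_17_64 M); rewrite binom_tail_horner.
set w := u.[z] in uz *.
have uz' : modulus (1 - w) <= 1 / 16 by rewrite modulusBC.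
have w1 : modulus w <= 17 / 16.
  by apply: le_trans (modulus_le_add _ 1) _; rewrite modulus1; lra.
have E : 1 = \sum_(j < (M + M).+1) 'C(M + M, j)%:R * (w ^+ j * (1 - w) ^+ (M + M - j)).
  have := exprDn (1 - w) w (M + M); rewrite subrK expr1n => E.
  by rewrite [LHS]E; apply: eq_bigr => j _; rewrite mulr_natl mulrC.
rewrite {1}E (bigID (fun j : 'I__ => (M <= j)%N)) /= addrC addrK.
apply: le_trans (modulus_sum _ _ _) _; rewrite -sum_binom mulr_suml.
rewrite [leRHS](bigID (fun j : 'I__ => ~~ (M <= j)%N)) /= -[leLHS]addr0; apply: lerD.
  apply: ler_sum => j; rewrite -ltnNge => jM.
  rewrite modulusM modulus_nat ler_wpM2l // modulusM !modulusX.
  apply: (@le_trans _ _ ((17 / 16) ^+ j * (1 / 16) ^+ (M + M - j))).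
    by apply: ler_pM; rewrite ?exprn_ge0 //; apply: ler_exprn2 => //; lra.
  rewrite mulrC (_ : M + M - j = M + (M - j))%N; last by lia.
  rewrite (_ : (17 / 16) ^+ j = (17 / 16) ^+ (M - (M - j)) :> R); last first.
    by congr (_ ^+ _); lia.
  by apply: pow_le_mix; [lra|lra|lia].
by apply: sumr_ge0 => j _; rewrite mulr_ge0 // exprn_ge0 // mulr_ge0 //; lra.
Qed.

Lemma size_binom_tail M (u : {poly C}) :
  (size (binom_tail M u) <= ((M + M) * (size u).+1).+1)%N.
Proof.
apply: leq_trans (size_sum _ _ _) _; apply/bigmax_leqP => j _.
apply: leq_trans (size_scale_leq _ _) _.
have s1 : (size (1 - u)%R <= (size u).+1)%N.
  apply: leq_trans (size_polyD _ _) _; rewrite size_polyN size_poly1.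
  by rewrite geq_max ltnS leq0n leqnSn.
apply: leq_trans (size_polyMleq _ _) _.
have e1 := size_poly_exp_leq u j.
have e2 := size_poly_exp_leq (1 - u) (M + M - j).
have j2 : (j <= M + M)%N by rewrite -ltnS.
have h1 : ((size u).-1 * j <= (size u).+1 * j)%N by rewrite leq_mul2r; apply/orP; right; lia.
have h2 : ((size (1 - u)%R).-1 * (M + M - j) <= (size u).+1 * (M + M - j))%N.
  by rewrite leq_mul2r; apply/orP; right; lia.
have h3 : ((size u).+1 * j + (size u).+1 * (M + M - j) = (M + M) * (size u).+1)%N.
  by rewrite -mulnDr subnKC // mulnC.
move: e1 e2 h1 h2 h3; move: (size (u ^+ j)) (size ((1 - u) ^+ _)) => a b.
move: ((size u).-1 * j)%N ((size (1 - u)%R).-1 * (M + M - j))%N => x y.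
move: ((size u).+1 * j)%N ((size u).+1 * (M + M - j))%N => x' y'.
move: ((M + M) * (size u).+1)%N => T; lia.
Qed.

End BinomialTail.

(** [lam] is imposed by [alpha], so [M] is taken maximal with [(M + M) * s + G <= lam]: the block
    fits into degree [lam], while [lam] exceeds a multiple of [M] by a constant at most. *)
Lemma block_size (lam G s M0 N : nat) : (0 < s)%N ->
  (N + (s + s) * M0.+1 + G <= lam)%N -> exists M,
  [/\ (M0 <= M)%N, (lam <= (s + s) * M.+1 + G)%N & ((M + M) * s + G <= lam)%N].
Proof.
move=> s0 H; have ss0 : (0 < s + s)%N by rewrite addn_gt0 s0.
exists ((lam - G) %/ (s + s))%N; split.
- by rewrite leq_divRL //; nia.
- by have := ltn_ceil (lam - G) ss0; rewrite mulnC; lia.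
have := leq_trunc_div (lam - G) (s + s).
by move: (_ %/ _)%N => M; nia.
Qed.

(** The budget of a block: with [y = c ^ (2 s)], part of the gain [2 ^ - M] pays for the division by
    [alpha], and [(2 / 3) ^ M] is left over. *)
Lemma two_thirds (R : realType) (y : R) : 3 / 4 <= y -> 2^-1 <= 2 / 3 * y.
Proof. lra. Qed.

(** * One polynomial block *)

Section Block.
Context {R : realType}.
Local Notation C := (Cplx R).
Implicit Types (S : set C) (u P Q g : {poly C}).

Lemma separating_poly S (r : R) : compact S -> S `&` @unit_disc R = set0 ->
  connected (~` S) -> 0 <= r < 1 ->
  exists u, (forall z, S z -> modulus (u.[z] - 1) <= 1 / 16) /\
            (forall z, modulus z <= r -> modulus u.[z] <= 1 / 16).
Proof.
move=> cS SD conS r01; have /andP[r0 r1] := r01.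
pose L : set C := S `|` [set z | modulus z <= r].
(* [S] lies in [|z| >= 1]; a threshold halfway between [r] and 1 makes [h] constant within
   [(1 - r) / 2] of each point of [L]. *)
pose h z : C := if (1 + r) / 2 < modulus z then 1 else 0.
have S1 z : S z -> 1 <= modulus z.
  move=> Sz; rewrite leNgt; apply/negP => z1.
  have : (S `&` @unit_disc R) z by split=> //; apply/unit_discE.
  by rewrite SD.
have h1 z : S z -> h z = 1.
  by move=> /S1 z1; rewrite /h ifT //; lra.
have h0 z : modulus z <= r -> h z = 0.
  by move=> zr; rewrite /h ifF //; apply/negbTE; rewrite -leNgt; lra.
have hcst z w : L z -> modulus (w - z) < (1 - r) / 2 -> h w = h z.
  move=> [Sz|/= zr] wz.
    rewrite (h1 _ Sz) /h ifT //; have := S1 _ Sz.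
    by have := modulus_le_add z w; rewrite (modulusBC z w); lra.
  rewrite (h0 _ zr) /h ifF //; apply/negbTE; rewrite -leNgt.
  by have := modulus_le_add w z; lra.
have d0 : 0 < (1 - r) / 2 by lra.
have cL : compact L by apply: compactU => //; exact: closed_disc_compact.
have rL : reachable L.
  by apply: connected_reachable => //; exact: connected_setU_disc.
have [|||u Hu] := @mergelyan R L h cL rL _ _ (1 / 16).
- apply/within_continuous_modulusP => z Lz e e0; exists ((1 - r) / 2) => // w _ wz.
  by rewrite (hcst z w Lz wz) subrr modulus0.
- move=> z /interior_subset Lz; exists 0 => e e0; exists ((1 - r) / 2) => // w wz.
  by rewrite (hcst z w Lz wz) mul0r !subrr modulus0 mulr_ge0 // ltW.
- by lra.
exists u; split=> z Hz.
  by rewrite -(h1 _ Hz); apply: Hu; left.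
by rewrite -[u.[z]]subr0 -(h0 _ Hz); apply: Hu; right.
Qed.

Variable alpha : nat -> nat -> C.
Hypothesis alpha_neq0 : forall n k, (k <= n)%N -> alpha n k != 0.
Variable a : nat -> C.
Hypothesis alpha_cvg : forall k, (alpha n k) @[n --> \oo] --> a k.
Hypothesis alpha_min : forall (c : R) n0, 0 < c < 1 -> exists2 n, (n0 <= n)%N &
    forall k, (k <= n)%N -> c ^+ n <= modulus (alpha n k).

Definition weighted (n : nat) (p : {poly C}) (z : C) : C :=
  \sum_(k < n.+1) alpha n k * p`_k * z ^+ k.

Lemma weightedD n p q z : weighted n (p + q) z = weighted n p z + weighted n q z.
Proof.
by rewrite /weighted -big_split; apply: eq_bigr => k _ /=; rewrite coefD; ring.
Qed.

(** The limit does not depend on [n], so the correction that a new block must supply is known before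
    its index [lam] is. *)
Lemma weighted_limit P (m eps : R) : 0 < eps -> 0 <= m -> exists n1, forall n, (n1 <= n)%N ->
  forall z, modulus z <= m ->
    modulus (weighted n P z - (\poly_(k < size P) (a k * P`_k)).[z]) <= eps.
Proof.
move=> eps0 m0; pose B := \sum_(k < size P) (modulus P`_k * m ^+ k).
have B0 : 0 <= B by apply: sumr_ge0 => k _; rewrite mulr_ge0 // exprn_ge0.
pose d := eps / (B + 1).
have d0 : 0 < d by rewrite divr_gt0 // ltr_wpDl.
have /choice[N HN] : forall k, exists N, forall n, (N <= n)%N -> modulus (alpha n k - a k) < d.
  move=> k; have /cvg_modulusP /(_ _ d0) [N _ HN] := @alpha_cvg k.
  by exists N => n Nn; exact: HN.
exists (size P + \max_(k < size P) N k)%N => n nn z zm.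
have sn : (size P <= n.+1)%N by lia.
rewrite horner_poly /weighted.
have -> : \sum_(k < n.+1) alpha n k * P`_k * z ^+ k =
    \sum_(k < size P) alpha n k * P`_k * z ^+ k.
  rewrite -(subnKC sn) big_split_ord /= [X in _ + X]big1 ?addr0 // => k _.
  by rewrite nth_default ?leq_addr // mulr0 mul0r.
rewrite -sumrB; apply: le_trans (modulus_sum _ _ _) _.
apply: (@le_trans _ _ (d * B)); last first.
  by rewrite /d mulrAC ler_pdivrMr ?ltr_wpDl // ler_pM2l //; lra.
rewrite /B mulr_sumr; apply: ler_sum => k _.
have -> : alpha n k * P`_k * z ^+ k - a k * P`_k * z ^+ k =
  (alpha n k - a k) * (P`_k * z ^+ k) by ring.
rewrite modulusM [modulus (P`_k * _)]modulusM modulusX; apply: ler_pM => //.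
- by rewrite mulr_ge0 // exprn_ge0.
- apply/ltW/HN; apply: leq_trans nn; apply: leq_trans (leq_addl _ _).
  exact: (leq_bigmax (F := fun k : 'I_(size P) => N k)).
by rewrite ler_wpM2l // ler_exprn2.
Qed.

Lemma horner_bounded g (m : R) : exists2 A : R, 0 < A & forall z, modulus z <= m ->
  modulus g.[z] <= A.
Proof.
pose A := \sum_(k < size g) modulus g`_k * `|m| ^+ k.
have A0 : 0 <= A by apply: sumr_ge0 => k _; rewrite mulr_ge0 // exprn_ge0.
exists (A + 1); first by rewrite ltr_wpDl.
move=> z zm; apply: le_trans (_ : A <= _); last by rewrite lerDl.
by apply: modulus_horner_le; apply: le_trans zm (ler_norm _).
Qed.

Lemma block S (m r eps : R) g P N0 : compact S -> S `&` @unit_disc R = set0 ->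
  connected (~` S) -> (forall z, S z -> modulus z <= m) -> 1 <= m ->
  0 < r < 1 -> 0 < eps ->
  exists lam Q, [/\ (N0 <= lam)%N, forall k, modulus Q`_k * r ^+ k <= eps &
    forall z, S z -> modulus (weighted lam (P + Q) z - g.[z]) <= eps].
Proof.
move=> cS SD conS Sm m1 r01 eps0; have /andP[r0 r1] := r01.
have r01' : 0 <= r < 1 by rewrite (ltW r0).
have [u [u1 u0]] := separating_poly cS SD conS r01'.
have m0 : 0 <= m by lra.
have e2 : 0 < eps / 2 by rewrite divr_gt0.
have [n1 Hn1] := weighted_limit P e2 m0.
set Pinf := \poly_(k < size P) _ in Hn1.
pose G := g - Pinf.
have [A A0 HA] := horner_bounded G m.
have [s sE] : exists s, s = (size u).+1 by exists (size u).+1.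
have s0n : (0 < s)%N by rewrite sE.
(* Chosen so that Bernoulli's inequality gives [c ^ (2 s) >= 1 - 2 s x = 3 / 4]. *)
pose x : R := (8 * s%:R)^-1.
have s0 : 0 < s%:R :> R by rewrite ltr0n.
have s1 : 1 <= s%:R :> R by rewrite ler1n.
have xE : s%:R * x = 8^-1 by rewrite /x; field; rewrite gt_eqF.
have x0 : 0 < x by rewrite invr_gt0 mulr_gt0.
have x1 : x <= 8^-1 by rewrite -xE ler_peMl // ltW.
pose c := 1 - x.
have c01 : 0 < c < 1 by apply/andP; split; rewrite /c; lra.
have /andP[c0 c1] := c01.
have c34 : 3 / 4 <= c ^+ (s + s).
  have x01 : 0 <= x <= 1 by apply/andP; split; lra.
  have E : (s + s)%:R * x = 8^-1 + 8^-1 by rewrite (natrD R s s) mulrDl xE.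
  by apply: le_trans (bernoulli (s + s) x01); rewrite E; lra.
(* The part of [c ^ - lam] that does not depend on [M], since [lam <= 2 s (M + 1) + size G]. *)
pose kap := A / (c ^+ (s + s + size G)).
have kap0 : 0 < kap by rewrite divr_gt0 // exprn_gt0.
have [M0 HM0] : exists M0, forall M, (M0 <= M)%N ->
    kap * (2 / 3) ^+ M <= eps /\ A * 2^-1 ^+ M <= eps / 2.
  have g1 : (fun n => kap * (2 / 3) ^+ n) @ \oo --> 0.
    rewrite -(mulr0 kap); apply: cvgMr; apply: cvg_geo0; apply/andP; split; lra.
  have g2 : (fun n => A * 2^-1 ^+ n) @ \oo --> 0.
    rewrite -(mulr0 A); apply: cvgMr; apply: cvg_geo0; apply/andP; split; lra.
  have [N1 _ H1] : \forall n \near \oo, kap * (2 / 3) ^+ n < eps by apply: (cvgr_lt 0).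
  have [N2 _ H2] : \forall n \near \oo, A * 2^-1 ^+ n < eps / 2 by apply: (cvgr_lt 0).
  exists (N1 + N2)%N => M HM; split; apply/ltW; [apply: H1|apply: H2];
    apply: leq_trans HM; [exact: leq_addr|exact: leq_addl].
have [lam lamN lamc] := alpha_min (N0 + n1 + (s + s) * M0.+1 + size G)%N c01.
have [M [MM0 lamM Mlam]] := block_size s0n lamN.
pose W := G * binom_tail M u.
have sW : (size W <= lam.+1)%N.
  apply: leq_trans (size_polyMleq _ _) _.
  have := size_binom_tail M u; rewrite -sE.
  move: (size (binom_tail M u)) Mlam => y; move: ((M + M) * s)%N (size G) => v w; clear; lia.
(* The weighted sum of [Q] at index [lam] is then [W] exactly. Only the coefficients of [Q] have to
   be small, and Cauchy's estimate for [W] on [|z| <= r] provides this. *)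
pose Q := \poly_(k < lam.+1) (W`_k / alpha lam k).
exists lam, Q; split.
- apply: leq_trans lamN; rewrite -!addnA; exact: leq_addr.
- move=> k; rewrite coef_poly; case: ltnP => kl; last first.
    by rewrite modulus0 mul0r ltW.
  have Wk : modulus W`_k * r ^+ k <= A * 2^-1 ^+ M.
    apply: cauchy_coef; first exact: ltW.
    move=> z zr; rewrite hornerM modulusM; apply: ler_pM => //.
      by apply: HA; lra.
    by apply: binom_tail_small; exact: u0.
  have ak := lamc k kl.
  have cl : 0 < c ^+ lam by rewrite exprn_gt0.
  have ak0 : 0 < modulus (alpha lam k) by exact: lt_le_trans ak.
  rewrite modulusM modulusV mulrAC ler_pdivrMr //.
  apply: le_trans Wk _; apply: (@le_trans _ _ (eps * c ^+ lam)); last by rewrite ler_pM2l.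
  have [kM _] := HM0 _ MM0.
  apply: (@le_trans _ _ (kap * (2 / 3) ^+ M * c ^+ lam)); last by rewrite ler_pM2r.
  have cmono : c ^+ ((s + s) * M.+1 + size G) <= c ^+ lam.
    by apply: ler_wiXn2l => //; lra.
  apply: (@le_trans _ _ (kap * (2 / 3) ^+ M * c ^+ ((s + s) * M.+1 + size G))); last first.
    apply: ler_wpM2l => //; apply: mulr_ge0; first exact: ltW.
    by apply: exprn_ge0; apply: divr_ge0.
  have -> : c ^+ ((s + s) * M.+1 + size G) = c ^+ (s + s + size G) * (c ^+ (s + s)) ^+ M.
    by rewrite -exprM -exprD; congr (_ ^+ _); rewrite mulnS; clear; lia.
  have cn : c ^+ (s + s + size G) != 0 by rewrite expf_neq0 // gt_eqF.
  have -> : kap * (2 / 3) ^+ M * (c ^+ (s + s + size G) * (c ^+ (s + s)) ^+ M) =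
      A * (2 / 3 * c ^+ (s + s)) ^+ M.
    by rewrite /kap [LHS]mulrACA divfK // -exprMn.
  rewrite ler_pM2l //; apply: ler_exprn2; first by rewrite invr_ge0.
  exact: two_thirds.
move=> z Sz; rewrite weightedD.
have WE : weighted lam Q z = W.[z].
  rewrite /weighted (horner_coef_wide z sW); apply: eq_bigr => k _.
  by rewrite coef_poly ltn_ord mulrCA divff ?mulr1 // alpha_neq0 // -ltnS.
rewrite WE (splitr eps).
have -> : weighted lam P z + W.[z] - g.[z] =
   (weighted lam P z - Pinf.[z]) - G.[z] * (1 - (binom_tail M u).[z]).
  by rewrite /W /G !(hornerM, hornerD, hornerN); ring.
apply: le_trans (modulusB _ _) _; apply: lerD.
  apply: Hn1; last exact: Sm.
  by apply: leq_trans lamN; rewrite -!addnA addnCA; exact: leq_addr.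
have [_ kM] := HM0 _ MM0; apply: le_trans kM; rewrite modulusM; apply: ler_pM => //.
  by apply: HA; exact: Sm.
by apply: binom_tail_near1; exact: u1.
Qed.

End Block.

(** * A countable family of compact sets and targets *)

Section CountableFamily.
Context {R : realType}.
Local Notation C := (Cplx R).
Implicit Types (z w : C) (K : set C).

Definition qpoint (x : rat * rat) : C := Complex (ratr x.1) (ratr x.2).

Definition qballs (F : seq (rat * rat * rat)) : set C :=
  [set z | exists2 b, b \in F & modulus (z - qpoint b.1) < ratr b.2].

Definition qcompact (m : nat) (F : seq (rat * rat * rat)) : set C :=
  ~` (([set z | modulus z < 1] `|` qballs F) `|` [set z | m%:R < modulus z]).

Definition qpoly (s : seq (rat * rat)) : {poly C} :=
  \poly_(k < size s) qpoint (nth (0, 0) s k).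

Lemma open_disc (c : C) (r : R) : open [set z : C | modulus (z - c) < r].
Proof.
apply/open_modulusP => z /= zc; exists (r - modulus (z - c)); first by rewrite subr_gt0.
by move=> w wz; have := modulus_dist w c z; lra.
Qed.

Lemma open_unit_disc : open [set z : C | modulus z < 1].
Proof.
have := @open_disc 0 1; congr open; apply/seteqP.
by split=> z /=; rewrite subr0.
Qed.

Lemma open_exterior (m : R) : open [set z : C | m < modulus z].
Proof.
apply/open_modulusP => z /= mz; exists (modulus z - m); first by rewrite subr_gt0.
by move=> w wz; have := modulus_le_add z w; rewrite (modulusBC z w); lra.
Qed.

Lemma open_qballs F : open (qballs F).
Proof.
apply/open_modulusP => z [b bF zb].
have /open_modulusP /(_ z zb) [e e0 He] := @open_disc (qpoint b.1) (ratr b.2).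
by exists e => // w /He wb; exists b.
Qed.

Lemma qcompact_compact m F : compact (qcompact m F).
Proof.
apply: (subclosed_compact _ (@closed_disc_compact R m%:R)); last first.
  by move=> z Hz /=; rewrite leNgt; apply/negP => zm; apply: Hz; right.
rewrite closedC; apply: openU; last exact: open_exterior.
by apply: openU; [exact: open_unit_disc|exact: open_qballs].
Qed.

Lemma qcompact_disc m F : qcompact m F `&` @unit_disc R = set0.
Proof.
apply/seteqP; split => // z [Hz /unit_discE z1]; apply: Hz.
by left; left.
Qed.

Lemma qcompact_le m F z : qcompact m F z -> modulus z <= m%:R.
Proof. by move=> Hz; rewrite leNgt; apply/negP => zm; apply: Hz; right. Qed.

Lemma rat_approx (x e : R) : 0 < e -> exists q : rat, `|ratr q - x| <= e.
Proof.
move=> e0; have xe : x - e < x + e by lra.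
have [q] := rat_in_itvoo xe; rewrite in_itv /= => /andP[q1 q2].
by exists q; rewrite ler_norml; apply/andP; split; lra.
Qed.

Lemma qpoint_approx (c : C) (e : R) : 0 < e -> exists x, modulus (qpoint x - c) <= e.
Proof.
move=> e0; have e2 : 0 < e / 2 by rewrite divr_gt0.
have [a Ha] := rat_approx (cRe c) e2; have [b Hb] := rat_approx (cIm c) e2.
exists (a, b); apply: le_trans (modulus_le_ReIm _) _.
by rewrite cReD cImD cReN cImN /qpoint /= (splitr e) lerD.
Qed.

Lemma qpoly_approx (p : {poly C}) (m e : R) : 0 <= m -> 0 < e ->
  exists s, forall z, modulus z <= m -> modulus ((qpoly s).[z] - p.[z]) <= e.
Proof.
move=> m0 e0; pose B := \sum_(k < size p) m ^+ k.
have B0 : 0 <= B by apply: sumr_ge0 => k _; rewrite exprn_ge0.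
have d0 : 0 < e / (B + 1) by rewrite divr_gt0 // ltr_wpDl.
have /choice[q Hq] := fun c => qpoint_approx c d0.
exists (map q p) => z zm; rewrite /qpoly horner_poly horner_coef size_map -sumrB.
apply: le_trans (modulus_sum _ _ _) _.
apply: (@le_trans _ _ (e / (B + 1) * B)); last first.
  by rewrite mulrAC ler_pdivrMr ?ltr_wpDl // ler_pM2l //; lra.
rewrite /B mulr_sumr; apply: ler_sum => k _.
rewrite (nth_map 0) // -mulrBl modulusM modulusX; apply: ler_pM => //.
  by rewrite exprn_ge0.
exact: ler_exprn2.
Qed.

Lemma qballs_cons b F : qballs (b :: F) =
  [set z | modulus (z - qpoint b.1) < ratr b.2] `|` qballs F.
Proof.
apply/seteqP; split => z /=.
  by move=> [b']; rewrite inE => /orP[/eqP -> ?|? ?]; [left|right; exists b'].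
move=> [zb|[b' bF zb]]; first by exists b; rewrite // mem_head.
by exists b' => //; rewrite inE bF orbT.
Qed.

Lemma qballs0 : qballs [::] = set0.
Proof. by apply/seteqP; split => z // []. Qed.

(** One chain of rational balls off [K] from 0 to a point beyond [|z| = m] suffices: it links the
    unit disc to the exterior. Such chains exist because the points they reach form an open and
    closed subset of the connected complement. *)
Lemma qcompact_cover K : compact K -> K `&` @unit_disc R = set0 ->
  connected (~` K) -> exists m F, K `<=` qcompact m F /\ connected (~` qcompact m F).
Proof.
move=> cK KD conK.
have DK w : modulus w < 1 -> ~ K w.
  by move=> w1 Kw; have : (K `&` @unit_disc R) w; [split=> //; exact/unit_discE|rewrite KD].
pose good w := exists F, [/\ connected (qballs F), (forall z, qballs F z -> ~ K z),
  qballs F 0 & qballs F w].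
pose b0 : rat * rat * rat := (0, 0, 1).
have b0E : qballs [:: b0] = [set z | modulus z < 1].
  rewrite qballs_cons qballs0 setU0; apply/seteqP; split => z /=;
  by rewrite (_ : qpoint (0, 0) = 0) ?subr0 ?rmorph1 // /qpoint /= rmorph0.
have good0 : good 0.
  exists [:: b0]; rewrite b0E; split => //=; rewrite ?modulus0 //.
  by have := @disc_connected R 0 1; congr connected; apply/seteqP; split=> z /=; rewrite subr0.
pose B : set C := [set w | ~ K w /\ good w].
have BK : B = ~` K.
  apply: conK.
  - by exists 0; split => //; apply: DK; rewrite modulus0.
  - exists B; last by apply/seteqP; split => [w []|w []].
    apply/open_modulusP => w [Kw [F [F1 F2 F3 F4]]].
    have /open_modulusP /(_ w F4) [e e0 He] := @open_qballs F.
    exists e => // u /He uF; split; first exact: F2.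
    by exists F.
  exists (~` [set w | ~ K w /\ ~ good w]); last first.
    apply/seteqP; split => w /=; first by move=> [Kw gw]; split => // -[].
    move=> [Kw H]; split => //; apply: contrapT => ng; exact: H.
  rewrite closedC; apply/open_modulusP => w [Kw ng].
  have [e e0 He] := compact_far_point cK Kw.
  (* The centre is within [e / 8] of [w] and the radius is in [(3 e / 8, e / 2)]: the ball contains
     [w] and the reached point [u], yet stays off [K]. *)
  have e8 : 0 < e / 8 by rewrite divr_gt0.
  have [q Hq] := qpoint_approx w e8.
  have re : 3 / 8 * e < e / 2 by lra.
  have [rho] := rat_in_itvoo re; rewrite in_itv /= => /andP[rho1 rho2].
  have Hq' : modulus (w - qpoint q) <= e / 8 by rewrite modulusBC.
  exists (e / 8) => // u uw; split.
    by move=> /He; lra.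
  move=> [F [F1 F2 F3 F4]]; apply: ng; exists ((q, rho) :: F).
  have ub : modulus (u - qpoint q) < ratr rho.
    by have := modulus_dist u (qpoint q) w; lra.
  rewrite qballs_cons /=; split.
  - by apply: connectedU => //; [exists u|exact: disc_connected].
  - move=> z [/= zq|]; last exact: F2.
    by move=> /He; have := modulus_dist z w (qpoint q); lra.
  - by right.
  - by left => /=; lra.
have [M M0 HM] := compact_modulus_bounded cK.
pose m := (Num.truncn M).+1.
have Mm : M < m%:R := truncnS_gt M.
have Kfar : ~ K (ofR m.+1%:R).
  move=> /HM; rewrite modulus_ofR ger0_norm // -natr1; lra.
have [_ [F [F1 F2 F3 F4]]] : B (ofR m.+1%:R) by rewrite BK.
exists m, F; split.
  move=> z Kz [[/DK|/F2]|/=]; [exact|exact|].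
  by have := HM z Kz; lra.
rewrite /qcompact setCK; apply: connectedU.
- exists (ofR m.+1%:R); split; first by right.
  by rewrite /= modulus_ofR ger0_norm // ltr_nat.
- apply: connectedU => //; first by exists 0; split => //=; rewrite modulus0.
  by rewrite -b0E; case: good0 => ? _; have := @disc_connected R 0 1;
    congr connected; rewrite b0E; apply/seteqP; split=> z /=; rewrite subr0.
- exact: exterior_connected.
Qed.

End CountableFamily.

(** * Enumerating the targets and passing to the limit *)

Section Universal.
Context {R : realType}.
Local Notation C := (Cplx R).
Variable alpha : nat -> nat -> C.
Hypothesis alpha_neq0 : forall n k, (k <= n)%N -> alpha n k != 0.
Variable a : nat -> C.
Hypothesis alpha_cvg : forall k, (alpha n k) @[n --> \oo] --> a k.
Hypothesis alpha_min : forall (c : R) n0, 0 < c < 1 -> exists2 n, (n0 <= n)%N &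
    forall k, (k <= n)%N -> c ^+ n <= modulus (alpha n k).

(** Tends to 1, so that the blocks converge on the whole disc, and never falls below 1/2, which
    accounts for the factors [2 ^+ k] in the coefficient bounds. *)
Definition stage_radius (i : nat) : R := 1 - i.+2%:R^-1.

Lemma stage_radius_bounds i : 1 / 2 <= stage_radius i < 1.
Proof.
have h0 : 0 < i.+2%:R^-1 :> R by rewrite invr_gt0.
have h1 : i.+2%:R^-1 <= 2^-1 :> R by rewrite lef_pV2 ?posrE // ler_nat.
by move: h0 h1; rewrite /stage_radius; move: (_^-1) => x h0 h1; apply/andP; split; lra.
Qed.

Lemma stage_radius_ge (r : R) : r < 1 -> exists N, forall i, (N <= i)%N ->
  r <= stage_radius i.
Proof.
move=> r1; have r1' : 0 < 1 - r by rewrite subr_gt0.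
have [N HN] := exists_inv_lt r1'; exists N => i Ni.
have := HN i.+1 (leq_trans Ni (leqnSn _)); rewrite /stage_radius.
by move: (_^-1) => x; lra.
Qed.

Definition state := ({poly C} * R * nat)%type.

(* A state [(P, A, lam)] holds the partial sum [P] of the blocks chosen so far,
   the index [lam] of the last stage, and a bound [A] for the effect on the
   earlier stages of a change of the coefficients. *)
Definition stage_ok (i : nat) (x y : state) : Prop :=
  [/\ (x.2 < y.2)%N, x.1.2 <= y.1.2,
    forall k, modulus (y.1.1 - x.1.1)`_k * stage_radius i ^+ k <= 2^-1 ^+ i / x.1.2 &
    forall m F s (t : nat), unpickle i = Some (m, F, s, t) ->
      connected (~` (qcompact m F : set C)) ->
      (forall z, qcompact m F z ->
         modulus (weighted alpha y.2 y.1.1 z - (qpoly s).[z]) <= 2^-1 ^+ i) /\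
      \sum_(k < y.2.+1) modulus (alpha y.2 k) * (2 ^+ k * m%:R ^+ k) <= y.1.2].

Lemma next_stage i (x : state) : 1 <= x.1.2 -> exists y, stage_ok i x y.
Proof.
case: x => [[P A] l] /= A1; have A0 : 0 < A by exact: lt_le_trans A1.
have hi : 0 < (2^-1 : R) ^+ i by rewrite exprn_gt0 // invr_gt0.
have trivial_stage : (forall (m : nat) (F : seq (rat * rat * rat)) (s : seq (rat * rat)) (t : nat),
    unpickle i = Some (m, F, s, t) -> connected (~` (qcompact m F : set C)) -> False) ->
    exists y, stage_ok i (P, A, l) y.
  move=> H; exists (P, A, l.+1); split => //=.
    by move=> k; rewrite subrr coef0 modulus0 mul0r divr_ge0 // ltW.
  by move=> m F s t E' cF; case: (H _ _ _ _ E' cF).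
case E : (unpickle i : option (nat * seq (rat * rat * rat) * seq (rat * rat) * nat)%type)
    => [[[[m F] s] t]|]; last first.
  by apply: trivial_stage => m F s t; rewrite E.
have [conF|conF] := pselect (connected (~` (qcompact m F : set C))); last first.
  by apply: trivial_stage => m' F' s' t'; rewrite E => -[<- <- _ _].
have /andP[r2 r1] := stage_radius_bounds i.
have r01 : 0 < stage_radius i < 1 by rewrite r1 andbT; lra.
have eps0 : 0 < 2^-1 ^+ i / A by rewrite divr_gt0.
(* [block] requires a radius of at least 1, and [m] may be 0. *)
have m1 : 1 <= m%:R + 1 :> R by rewrite lerDr.
have Sm (z : C) : qcompact m F z -> modulus z <= m%:R + 1.
  by move=> /qcompact_le zm; rewrite (le_trans zm) // lerDl.
have [lam [Q [lamN HQ HS]]] := block alpha_neq0 alpha_cvg alpha_min (qpoly s) P l.+1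
  (@qcompact_compact R m F) (qcompact_disc m F) conF Sm m1 r01 eps0.
pose Sum := \sum_(k < lam.+1) modulus (alpha lam k) * (2 ^+ k * m%:R ^+ k).
exists (P + Q, Num.max A Sum, lam); split => //=.
- by rewrite le_max lexx.
- by move=> k; rewrite (addrC P) addrK.
move=> m' F' s' t'; rewrite E => -[<- <- <- _] _; split.
  move=> z Sz; apply: le_trans (HS z Sz) _.
  by rewrite ler_pdivrMr // ler_peMr // ltW.
by rewrite le_max lexx orbT.
Qed.

Lemma exists_stages : exists st : nat -> state,
  (forall i, 1 <= (st i).1.2) /\ forall i, stage_ok i (st i) (st i.+1).
Proof.
have /choice[f Hf] : forall x : nat * state, exists y,
    1 <= x.2.1.2 -> stage_ok x.1 x.2 y.
  move=> [i x] /=; have [x1|x1] := pselect (1 <= x.1.2).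
    by have [y Hy] := next_stage i x1; exists y.
  by exists x => /x1.
pose st := fix st n : state := if n is n'.+1 then f (n', st n') else (0, 1, 0%N).
have st1 i : 1 <= (st i).1.2.
  elim: i => [|i IH] /=; first by rewrite lexx.
  by have [_ h _ _] := Hf (i, st i) IH; exact: le_trans IH h.
by exists st; split=> // i; exact: Hf (i, st i) (st1 i).
Qed.

Lemma geo_sum_le (x : R) n : 0 <= x < 1 -> \sum_(k < n) x ^+ k <= (1 - x)^-1.
Proof.
move=> /andP[x0 x1]; have := subrX1 x n; set S := \sum_(k < n) _ => SE.
rewrite -[leRHS]mul1r ler_pdivlMr ?subr_gt0 //.
have : 0 <= x ^+ n by rewrite exprn_ge0.
by move: SE; move: (x ^+ n) => y; lra.
Qed.

Lemma halves_step (T : Type) (dist : T -> T -> R) (u : nat -> T) (D : R) n m :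
  (forall x, dist x x = 0) -> (forall x y z, dist x z <= dist x y + dist y z) ->
  (n <= m)%N -> 0 <= D ->
  (forall i, (n <= i)%N -> dist (u i.+1) (u i) <= D * 2^-1 ^+ i) ->
  dist (u m) (u n) <= 2 * D * 2^-1 ^+ n.
Proof.
move=> dxx dtri nm D0 step.
(* Keeping the subtracted tail makes the induction on [m - n] close. *)
have : dist (u m) (u n) <= 2 * D * 2^-1 ^+ n - 2 * D * 2^-1 ^+ m.
  rewrite -(subnKC nm); elim: (m - n)%N => [|k IH].
    by rewrite addn0 dxx subrr.
  rewrite addnS; apply: le_trans (dtri _ (u (n + k)%N) _) _.
  have := step (n + k)%N (leq_addr _ _); rewrite exprS; lra.
have : 0 <= 2 * D * 2^-1 ^+ m by rewrite mulr_ge0 ?mulr_ge0 // exprn_ge0 // invr_ge0.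
lra.
Qed.

Section Limit.
Variable st : nat -> state.
Hypothesis st_ge1 : forall i, 1 <= (st i).1.2.
Hypothesis st_ok : forall i, stage_ok i (st i) (st i.+1).
Local Notation P i := (st i).1.1.
Local Notation A i := (st i).1.2.
Local Notation lam i := (st i).2.

Lemma lam_ge i : (i <= lam i)%N.
Proof. by elim: i => // i IH; have [h _ _ _] := st_ok i; exact: leq_ltn_trans IH h. Qed.

Lemma A_mono n m : (n <= m)%N -> A n <= A m.
Proof.
move=> nm; rewrite -(subnKC nm); elim: (m - n)%N => [|k IH]; first by rewrite addn0.
by rewrite addnS; have [_ h _ _] := st_ok (n + k)%N; exact: le_trans IH h.
Qed.

Lemma A_gt0 n : 0 < A n.
Proof. exact: lt_le_trans (st_ge1 n). Qed.

Lemma coef_diff n m k : (n <= m)%N ->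
  modulus ((P m)`_k - (P n)`_k) <= 2 * (2 ^+ k / A n) * 2^-1 ^+ n.
Proof.
move=> nm; have An := A_gt0 n.
apply: (@halves_step C (fun x y => modulus (x - y)) (fun i => (P i)`_k)
  (2 ^+ k / A n)) => //.
- by move=> x; rewrite subrr modulus0.
- by move=> x y z; exact: modulus_dist.
- by rewrite divr_ge0 ?exprn_ge0 // ltW.
move=> i ni; have [_ _ h _] := st_ok i; have := h k; rewrite coefB => {}h.
have Ai := A_gt0 i; have /andP[r2 r1] := stage_radius_bounds i.
have r0 : 0 < stage_radius i by lra.
have rk : (2^-1) ^+ k <= stage_radius i ^+ k by apply: ler_exprn2; lra.
have hk : 0 < (2^-1 : R) ^+ k by rewrite exprn_gt0 // invr_gt0.
have h2 : modulus ((P i.+1)`_k - (P i)`_k) * 2^-1 ^+ k <= 2^-1 ^+ i / A n.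
  apply: (@le_trans _ _ (2^-1 ^+ i / A i)).
    by apply: le_trans h; rewrite ler_wpM2l.
  rewrite ler_wpM2l ?exprn_ge0 ?invr_ge0 // lef_pV2 ?posrE //.
  exact: A_mono.
rewrite -ler_pdivlMr // in h2; apply: le_trans h2 _.
by rewrite -[in leLHS]exprVn invrK le_eqVlt; apply/orP; left; apply/eqP; ring.
Qed.

Lemma horner_diff (r : R) : 0 < r < 1 -> exists N (D : R), 0 < D /\
  forall n m z, (N <= n)%N -> (n <= m)%N -> modulus z <= r ->
    modulus ((P m).[z] - (P n).[z]) <= D * 2^-1 ^+ n.
Proof.
(* Coefficients controlled at the larger radius [r'] leave a geometric series of ratio [r / r'] on
   [|z| <= r]. *)
move=> /andP[r0 r1]; pose r' := (1 + r) / 2.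
have r'1 : r' < 1 by rewrite /r'; lra.
have rr' : r < r' by rewrite /r'; lra.
have r'0 : 0 < r' by lra.
have q01 : 0 <= r / r' < 1.
  by rewrite divr_ge0 ?ltW // ltr_pdivrMr // mul1r.
have /andP[q0 q1] := q01.
pose E := (1 - r / r')^-1.
have E0 : 0 < E by rewrite invr_gt0 subr_gt0.
have [N HN] := stage_radius_ge r'1; exists N, (2 * E); split.
  by rewrite mulr_gt0.
move=> n m z Nn nm zr.
apply: (@halves_step C (fun x y => modulus (x - y)) (fun i => (P i).[z]) E) => //.
- by move=> x; rewrite subrr modulus0.
- by move=> x y w; exact: modulus_dist.
- exact: ltW.
move=> i ni; have [_ _ h _] := st_ok i.
move=> /=; rewrite -hornerN -hornerD; set Q := P i.+1 - P i in h *.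
apply: le_trans (modulus_horner_le Q zr) _.
rewrite mulrC; apply: (@le_trans _ _ (2^-1 ^+ i * \sum_(k < size Q) (r / r') ^+ k)).
  rewrite mulr_sumr; apply: ler_sum => k _.
  rewrite expr_div_n mulrCA mulrC ler_wpM2l ?exprn_ge0 ?(ltW r0) //.
  rewrite ler_pdivlMr ?exprn_gt0 //.
  apply: (@le_trans _ _ (modulus Q`_k * stage_radius i ^+ k)).
    by rewrite ler_wpM2l // ler_exprn2 ?(ltW r'0) // HN // (leq_trans Nn).
  apply: le_trans (h k) _; rewrite ler_pdivrMr ?A_gt0 // ler_peMr //.
rewrite ler_wpM2l ?exprn_ge0 ?invr_ge0 //.
exact: geo_sum_le.
Qed.

Lemma exists_limit : exists f : C -> C, forall r : R, 0 < r < 1 -> exists N,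
  unif_limit (fun n => P (n + N)) f r.
Proof.
have h01 : 0 < (2^-1 : R) < 1 by apply/andP; split; lra.
have cvgD (D : R) : (fun n => D * 2^-1 ^+ n) @ \oo --> 0.
  by rewrite -(mulr0 D); apply: cvgMr; exact: cvg_geo0.
have /choice[f Hf] : forall z, exists l, modulus z < 1 ->
    forall e : R, 0 < e -> exists N, forall n, (N <= n)%N -> modulus ((P n).[z] - l) <= e.
  move=> z; have [z1|z1] := pselect (modulus z < 1); last by exists 0 => /z1.
  have r01 : 0 < (1 + modulus z) / 2 < 1.
    by have := modulus_ge0 z => z0; apply/andP; split; lra.
  have [N [D [D0 HD]]] := horner_diff r01.
  have [||l Hl] := @cplx_cauchy_cvg R (fun n => (P (n + N)).[z]) (fun n => D * 2^-1 ^+ (n + N)).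
  - by rewrite (cvg_shiftn N (fun n => D * 2^-1 ^+ n) (nbhs 0)).
  - move=> n m nm; apply: HD; rewrite ?leq_addl ?leq_add2r //; lra.
  exists l => _ e e0.
  have [M _ HM] : \forall n \near \oo, D * 2^-1 ^+ n < e by apply: (cvgr_lt 0).
  exists (N + M)%N => n nn; have Nn : (N <= n)%N by lia.
  have := Hl (n - N)%N; rewrite subnK // => h; apply: le_trans h _.
  by apply/ltW/HM => /=; lia.
exists f => r r01; have [N [D [D0 HD]]] := horner_diff r01.
exists N, (fun n => D * 2^-1 ^+ n); split => //.
  move=> n m nm; rewrite ler_pM2l //; apply: ler_wiXn2l => //; lra.
have /andP[r0 r1] := r01.
move=> n z zr; apply/ler_addgt0Pr => e e0.
have [M HM] := Hf z (lt_trans zr r1) e e0.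
apply: le_trans (modulus_dist _ _ (P (n + N + M)).[z]) _; apply: lerD; last first.
  by apply: HM; exact: leq_addl.
rewrite modulusBC; apply: le_trans (HD (n + N)%N _ z _ _ (ltW zr)) _.
- exact: leq_addl.
- exact: leq_addr.
rewrite ler_pM2l //; apply: ler_wiXn2l; rewrite ?leq_addr //; lra.
Qed.

Variable f : C -> C.
Hypothesis f_lim : forall r : R, 0 < r < 1 -> exists N, unif_limit (fun n => P (n + N)) f r.

Lemma limit_holomorphic : holomorphic_on (@unit_disc R) f.
Proof.
move=> z /unit_discE z1; have z0 := modulus_ge0 z.
have r01 : 0 < (1 + modulus z) / 2 < 1 by apply/andP; split; lra.
have [N uf] := f_lim r01.
have rr : (1 + 3 * modulus z) / 4 < (1 + modulus z) / 2 by lra.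
have [cd _] := unif_limit_deriv rr uf.
by apply/derivable_cdiffP; exists (derive1 f z); apply: cd; lra.
Qed.

Lemma limit_coef n k : modulus (derive1n k f 0 / k`!%:R - (P n)`_k) <=
  2 * (2 ^+ k / A n) * 2^-1 ^+ n.
Proof.
have r01 : 0 < (1 / 2 : R) < 1 by apply/andP; split; lra.
have [N uf] := f_lim r01; have /andP[r0 _] := r01.
have [e [e0 He]] := unif_limit_coef k r0 uf.
apply/ler_addgt0Pr => d d0.
have [M _ HM] : \forall n \near \oo, e n < d by apply: (cvgr_lt 0).
pose m := (M + n)%N.
rewrite [leRHS]addrC; apply: le_trans (modulus_dist _ _ (P (m + N))`_k) _; apply: lerD.
  rewrite modulusBC; apply: le_trans (He m) _; apply/ltW/HM.
  exact: leq_addr.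
by apply: coef_diff; rewrite -addnA addnCA leq_addr.
Qed.

(** The blocks after stage [i] change coefficient [k] by at most [2 ^ - i * 2 ^ k / A], and [A]
    majorises the weighted sum of the [2 ^ k m ^ k] at this index. They therefore cost one more
    [2 ^ - i]. *)
Lemma weighted_taylor_stage i m F s (t : nat) z :
  unpickle i = Some (m, F, s, t) -> connected (~` (qcompact m F : set C)) ->
  qcompact m F z ->
  modulus (weighted_taylor alpha f (lam i.+1) z - (qpoly s).[z]) <= 2 * 2^-1 ^+ i.
Proof.
move=> E conF Sz; have [_ _ _ /(_ _ _ _ _ E conF)[/(_ z Sz) h1 h2]] := st_ok i.
apply: le_trans (modulus_dist _ _ (weighted alpha (lam i.+1) (P i.+1) z)) _.
have -> : 2 * 2^-1 ^+ i = 2^-1 ^+ i + 2^-1 ^+ i :> R by rewrite mulr_natl mulr2n.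
apply: lerD => //; rewrite /weighted_taylor /weighted -sumrB.
apply: le_trans (modulus_sum _ _ _) _.
have Ai := A_gt0 i.+1.
have zm := qcompact_le Sz.
apply: (@le_trans _ _ (2^-1 ^+ i / A i.+1 *
  \sum_(k < (lam i.+1).+1) modulus (alpha (lam i.+1) k) * (2 ^+ k * m%:R ^+ k))).
  rewrite mulr_sumr; apply: ler_sum => k _.
  rewrite -mulrBl -mulrBr modulusM modulusM modulusX.
  have := limit_coef i.+1 k.
  have -> : 2 * (2 ^+ k / A i.+1) * 2^-1 ^+ i.+1 = 2^-1 ^+ i / A i.+1 * 2 ^+ k.
    by rewrite exprS; field; rewrite gt_eqF.
  move=> h3; rewrite mulrCA -mulrA ler_wpM2l // mulrA.
  apply: ler_pM => //; first by rewrite exprn_ge0.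
  exact: ler_exprn2.
rewrite mulrAC ler_pdivrMr // ler_wpM2l // exprn_ge0 // invr_ge0 //.
Qed.

End Limit.

Lemma injective_unbounded (phi : nat -> nat) : injective phi ->
  forall J, exists t, (J <= phi t)%N.
Proof.
move=> inj J; apply: contrapT => H.
have lt t : (phi t < J)%N.
  by rewrite ltnNge; apply/negP => Jt; apply: H; exists t.
pose g (t : 'I_J.+1) : 'I_J := Ordinal (lt t).
have g_inj : injective g by move=> x y [] /inj /val_inj.
by have := leq_card g g_inj; rewrite !card_ord ltnn.
Qed.

Lemma exists_universal : universal alpha !=set0.
Proof.
have [st [st1 stok]] := exists_stages.
have [f f_lim] := exists_limit st1 stok.
exists f; split; first exact: limit_holomorphic f_lim.
move=> K h cK KD conK hc hh.
have [m [F [KF conF]]] := qcompact_cover cK KD conK.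
have apK : poly_approx K h.
  apply: mergelyan => //; first exact: connected_reachable.
  by move=> z /hh /derivable_cdiffP.
clear KD; have ex (n N : nat) : exists L, (N <= L)%N /\ forall z, K z ->
    modulus (weighted_taylor alpha f L z - h z) <= 2^-1 ^+ n.
  have e0 : 0 < (2^-1 : R) ^+ n / 4 by rewrite divr_gt0 // exprn_gt0 // invr_gt0.
  have [p Hp] := apK _ e0.
  have [s Hs] := @qpoly_approx R p m%:R _ (ler0n _ _) e0.
  (* The idle parameter [t] makes every triple [(m, F, s)] come back at arbitrarily
     late stages. *)
  have inj : injective (fun t : nat => pickle (m, F, s, t)).
    by move=> t t' /(pcan_inj pickleK) [].
  (* The summand 2 bounds the stage error [2 * 2 ^ - i] by [2 ^ - n / 2]; the approximations of [h]
     by [p] and of [p] by [qpoly s] use a quarter of [2 ^ - n] each. The summand [N] makes the index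
     large. *)
  have [t Ht] := injective_unbounded inj (n + 2 + N)%N.
  set i := pickle _ in Ht.
  have Ei : unpickle i = Some (m, F, s, t) by rewrite /i pickleK.
  exists (st i.+1).2; split.
    by apply: leq_trans (lam_ge stok _); lia.
  move=> z Kz; have := weighted_taylor_stage st1 stok f_lim Ei conF (KF z Kz) => h1.
  have zm := qcompact_le (KF z Kz).
  have hi : 2 * 2^-1 ^+ i <= 2^-1 ^+ n / 2 :> R.
    apply: (@le_trans _ _ (2 * 2^-1 ^+ (n + 2))).
      rewrite ler_pM2l //; apply: ler_wiXn2l; try lra.
      by apply: leq_trans Ht; exact: leq_addr.
    by rewrite exprD le_eqVlt; apply/orP; left; apply/eqP; field.
  have := Hp z Kz; have := Hs z zm.
  have := modulus_dist (weighted_taylor alpha f (st i.+1).2 z) (h z) (qpoly s).[z].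
  have := modulus_dist (qpoly s).[z] (h z) p.[z].
  move: hi h1; move: (_ ^+ n) (2 * _ ^+ i) => x y; lra.
have /choice[nx Hnx] : forall x : nat * nat, exists L, (x.2 <= L)%N /\ forall z, K z ->
    modulus (weighted_taylor alpha f L z - h z) <= 2^-1 ^+ x.1.
  by move=> [n N]; exact: ex.
pose lambda := fix lambda n := if n is n'.+1 then nx (n, (lambda n').+1) else nx (0%N, 0%N).
exists lambda.
  apply/increasing_seqP => n; rewrite ltEnat /=.
  by have [] := Hnx (n.+1, (lambda n).+1).
apply/uniform_cvg_modulusP => e e0.
have h01 : 0 < (2^-1 : R) < 1 by apply/andP; split; lra.
have [N _ HN] : \forall n \near \oo, (2^-1 : R) ^+ n < e.
  by apply: (cvgr_lt 0) => //; exact: cvg_geo0.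
exists N => n z Nn Kz; apply: le_lt_trans (HN n Nn).
by case: n Nn => [|n] _ /=; [have [_] := Hnx (0%N, 0%N)|have [_] := Hnx (n.+1, (lambda n).+1)]; apply.
Qed.

End Universal.

Lemma universal_min_root {R : realType} (alpha : nat -> nat -> Cplx R) :
  (forall n k : nat, (k <= n)%N -> alpha n k != 0) ->
  (forall k : nat, cvgn (fun n : nat => alpha n k)) ->
  (1%:E <= limn_esup (min_root alpha))%E -> universal alpha !=set0.
Proof.
move=> alpha0 alpha_cvg alpha_min.
have /choice[a Ha] : forall k, exists l : Cplx R, (alpha n k) @[n --> \oo] --> l.
  by move=> k; have /cvg_ex := alpha_cvg k.
exact: (@exists_universal _ _ alpha0 _ Ha (min_root_ge1 alpha_min)).
Qed.

Theorem mainTheorem1 (R : realType) (alpha : nat -> nat -> Cplx R)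
    (alpha_neq0 : forall n k : nat, (k <= n)%N -> alpha n k != 0) :
  ((forall k : nat, cvgn (fun n : nat => alpha n k)) ->
   (1%:E <= limn_esup (min_root alpha))%E ->
   universal alpha !=set0)
  /\
  (universal alpha !=set0 ->
   (1%:E <= limn_esup (max_root alpha))%E).
Proof.
by split; [exact: universal_min_root alpha_neq0 | exact: universal_max_root].
Qed.
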